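(* Let $m>p\geq 2$ be integers such that $m\not\sim p$, i.e. $\frac{\log p}{\log m}\notin\mathbb{Q}$. Let $\mu\in\mathcal{P}([0,1]^2)$ be a Borel probability measure that is invariant and ergodic under $T_p\times T_p$, and assume there exists a linear projection $\pi:\mathbb{R}^2\to\mathbb{R}$ with $\pi\notin\{P_1,P_2\}$ such that $\dim\pi\mu<\dim\mu$. Then: (1) $\mu$ is pointwise generic for $\lambda\times P_2\mu$ under the map $T_m\times T_p$; (2) if $n$ is another integer with $n\not\sim p$ and $m>n>p$, then $\mu$ is pointwise generic for $\lambda\times\lambda$ under the map $T_m\times T_n$.
   Context: For an integer $q\geq 2$, $T_q(x)=qx \bmod 1$ on $[0,1]$ (identified with $\mathbb{T}=\mathbb{R}/\mathbb{Z}$), and $T_a\times T_b$ acts on $[0,1]^2\cong\mathbb{T}^2$ coordinatewise. $\lambda$ is Lebesgue measure on $[0,1]$. $P_1(x,y)=x$, $P_2(x,y)=y$ are the principal projections; $\pi\mu$ denotes the push-forward of $\mu$ under $\pi$. For a probability measure $\mu$, $\dim\mu=\inf\{\dim_H A:\ \mu(A)>0\}$ (lower Hausdorff dimension). A measure $\mu$ on $[0,1]^2$ is pointwise generic under a map $T$ for a measure $\rho$ if for $\mu$-a.e. $z$, $\frac1N\sum_{k=0}^{N-1}f(T^kz)\to\int f\,d\rho$ for every $f\in C(\mathbb{T}^2)$. *)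

(* Defs.v *)
From HB Require Import structures.
From mathcomp Require Import all_boot all_order all_algebra.
From mathcomp Require Import all_classical all_reals all_analysis.
Set Implicit Arguments. Unset Strict Implicit. Unset Printing Implicit Defensive.
Import Order.TTheory GRing.Theory Num.Theory.
Import numFieldNormedType.Exports.
Local Open Scope classical_set_scope.
Local Open Scope ring_scope.

Section Defs.
Context {R : realType}.

Section Hausdorff.
Context {V : normedModType R}.

(* diameter (sup of distances; -oo for the empty set) *)
Definition diam (A : set V) : \bar R :=
  ereal_sup [set (`|x.1 - x.2|)%:E | x in A `*` A].

Definition hcost (s : R) (U : set V) : \bar R :=
  if pselect (U = set0) then 0%E else ((fine (diam U)) `^ s)%:E.

Definition hausdorff_delta (s delta : R) (A : set V) : \bar R :=
  ereal_inf [set (\sum_(0 <= i <oo) hcost s (F i))%E |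
    F in [set F : nat -> set V |
          A `<=` \bigcup_i F i /\ forall i, (diam (F i) <= delta%:E)%E]].

Definition hausdorff_measure (s : R) (A : set V) : \bar R :=
  ereal_sup [set hausdorff_delta s delta A | delta in [set delta : R | 0 < delta]].

Definition hausdorff_dim (A : set V) : \bar R :=
  ereal_inf [set s%:E | s in [set s : R | 0 <= s /\ hausdorff_measure s A = 0%E]].
End Hausdorff.

Definition lower_dim_gen (T : Type) (meas : set T -> Prop)
  (dimH : set T -> \bar R) (mu : set T -> \bar R) : \bar R :=
  ereal_inf [set dimH A | A in [set A | meas A /\ (0 < mu A)%E]].

(* measures on R^2 (product Borel sigma-algebra, max norm) *)
Definition dim2 (mu : set (R * R) -> \bar R) : \bar R :=
  lower_dim_gen (@measurable _ (R * R)%type) (@hausdorff_dim (R * R)%type) mu.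

Definition dim1 (mu : set R -> \bar R) : \bar R :=
  lower_dim_gen (@measurable _ R) (@hausdorff_dim R^o) mu.

Definition Tq (q : nat) (x : R) : R := q%:R * x - (Num.floor (q%:R * x))%:~R.
Definition Tprod (a b : nat) (z : R * R) : R * R := (Tq a z.1, Tq b z.2).

Definition is_invariant (mu : set (R * R) -> \bar R) (T : R * R -> R * R) :=
  forall A : set (R * R), measurable A -> mu (T @^-1` A) = mu A.

Definition is_ergodic (mu : set (R * R) -> \bar R) (T : R * R -> R * R) :=
  forall A : set (R * R), measurable A -> T @^-1` A = A ->
    mu A = 0%E \/ mu A = 1%E.

Definition torus_continuous (f : R * R -> R) :=
  continuous f /\ forall x y, f (x + 1, y) = f (x, y) /\ f (x, y + 1) = f (x, y).

Definition pointwise_generic (mu : {measure set (R * R) -> \bar R})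
  (T : R * R -> R * R) (rho : set (R * R) -> \bar R) :=
  {ae mu, forall z, forall f : R * R -> R, torus_continuous f ->
    (fun N : nat => ((N%:R)^-1 * \sum_(k < N) f (iter k T z))%:E) @ \oo -->
      (\int[rho]_x (f x)%:E)%E}.

Definition lambda01 : set R -> \bar R :=
  mrestr (@lebesgue_measure R) (measurable_itv `[0%R, 1%R]).

Definition mult_indep (m p : nat) :=
  ~ exists r : rat, ln (p%:R : R) / ln (m%:R) = ratr r.

End Defs.

(* Main.v *)
Require Import Defs.
From HB Require Import structures.
From mathcomp Require Import all_boot all_order all_algebra.
From mathcomp Require Import all_classical all_reals all_analysis.
From mathcomp Require Import measurable_realfun ring lra zify.
Set Implicit Arguments.
Unset Strict Implicit.
Unset Printing Implicit Defensive.
Import Order.TTheory GRing.Theory Num.Theory.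
Import numFieldNormedType.Exports.
Local Open Scope classical_set_scope.
Local Open Scope ring_scope.

(** The dimension drop is used only to show that both coordinate digit processes have
    positive entropy: if a coordinate had entropy zero, typical points would be covered by
    few of its digit words, and a small-dimensional set charged by [pi mu] would lift to an
    equally small-dimensional set charged by [mu].

    Positive entropy of the coordinate [u] makes its next digits unpredictable from the
    past digits of both coordinates. Hence the conditional averages of [cos (J p^x u)] and
    [sin (J p^x u)] given the past are small, in quadratic mean over [x], when the scales
    [p^x] run through an arithmetic progression: their correlations are geometric sums.

    For [p < q] write [q^k = p^(b + x)] with [b] and [x] the integral and fractional parts
    of [k alpha], [alpha = ln q / ln p]. Subtracting from [cos (J q^k u + xi_k)] its
    conditional averages at levels [b] and [b + 1] leaves, up to a small error, uncorrelated
    terms, to which a second-moment law of large numbers applies. The conditional averages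
    are bounded by a maximal function evaluated at time [k alpha]; since [alpha] is
    irrational, a tiling argument compares its ergodic limsup with its mean over all scales.
    So the averages of [cos (J q^k u + xi_k)] vanish for every phase [xi_k] that varies
    more slowly than [q^k u], in particular for the contribution of the other coordinate.
    Weyl's criterion and, for the characters of [y] alone in the first claim, Birkhoff's
    theorem conclude. *)

(** * Expectations of bounded measurable functions *)

(** The obstacle is that the times [k alpha] are irrational while [T] offers only integer shifts,
    and ergodicity of [T] alone does not control such a sampling. Two devices replace an ergodic
    theorem. Since q^k = p^(b + x) = p^((b + 1) + (x - 1)), levels b and b + 1 see the same
    frequency; weights 1 - x and x make the subtracted term compatible with a function continuous in
    time, also where b jumps. And taking the maximum over all shorter pasts makes the majorant
    monotone: its value at time t and point T z is at most its value at time t + 1 and point z.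
    Monotonicity and density of the numbers k alpha - b play the role of invariance. The constants
    lost are harmless, since the bound tends to 0 as |J| grows: then many frequencies in arithmetic
    progression fit into a narrow window of exponents x, and averaging over them is averaging over
    nearby times. The digits of both coordinates enter the past so that the phase is nearly frozen
    on each atom. As the projection is not a principal one, it determines the point together with
    either coordinate; hence both coordinates have positive entropy. *)

Section Expectation.
Context {R : realType} {d : measure_display} {X : measurableType d}.
Variable P : probability X R.

(** Every integrand below is of this kind, so integrability reduces to the closure rules that
    follow. *)
Definition bmf (f : X -> R) :=
  measurable_fun [set: X] f /\ exists M : R, forall z, `|f z| <= M.

Definition Ex (f : X -> R) : R := \int[P]_x f x.
Definition prb (A : set X) : R := fine (P A).

Lemma bmf_bound f : bmf f -> exists2 M : R, 0 < M & forall z, `|f z| <= M.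
Proof.
move=> [_ [M fM]]; exists (Num.max M 1); first by rewrite lt_max ltr01 orbT.
by move=> z; rewrite le_max fM.
Qed.

Lemma bmf_measurable f : bmf f -> measurable_fun [set: X] f.
Proof. by case. Qed.

Lemma bmf_integrable f : bmf f -> P.-integrable [set: X] (EFin \o f).
Proof.
move=> [mf [M fM]]; apply: measurable_bounded_integrable => //.
  by rewrite -ge0_fin_numE// fin_num_measure.
exists M; split; first exact: num_real.
by move=> x Mx y _ /=; exact: le_trans (fM y) (ltW Mx).
Qed.

Lemma bmf_cst (c : R) : bmf (fun=> c).
Proof. by split; [exact: measurable_cst | exists `|c|]. Qed.

Lemma bmfD f g : bmf f -> bmf g -> bmf (fun z => f z + g z).
Proof.
move=> [mf [M fM]] [mg [N gN]]; split; first exact: measurable_funD.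
by exists (M + N) => z; rewrite (le_trans (ler_normD _ _))// lerD.
Qed.

Lemma bmfM f g : bmf f -> bmf g -> bmf (fun z => f z * g z).
Proof.
move=> [mf [M fM]] [mg [N gN]]; split; first exact: measurable_funM.
by exists (M * N) => z; rewrite normrM ler_pM.
Qed.

Lemma bmfZ (c : R) f : bmf f -> bmf (fun z => c * f z).
Proof. by move=> bf; apply: bmfM => //; exact: bmf_cst. Qed.

Lemma bmfN f : bmf f -> bmf (fun z => - f z).
Proof.
move=> bf; rewrite (_ : (fun z => - f z) = (fun z => -1 * f z)); first exact: bmfZ.
by apply/funext => z; rewrite mulN1r.
Qed.

Lemma bmfB f g : bmf f -> bmf g -> bmf (fun z => f z - g z).
Proof. by move=> bf bg; apply: bmfD => //; exact: bmfN. Qed.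

Lemma bmfX f n : bmf f -> bmf (fun z => f z ^+ n).
Proof.
move=> bf; elim: n => [|n ih].
  by rewrite (_ : (fun z => f z ^+ 0) = (fun=> 1)); [exact: bmf_cst | apply/funext => z; rewrite expr0].
rewrite (_ : (fun z => f z ^+ n.+1) = (fun z => f z * f z ^+ n)); first exact: bmfM.
by apply/funext => z; rewrite exprS.
Qed.

Lemma bmf_sum (I : Type) (s : seq I) (Q : pred I) (F : I -> X -> R) :
  (forall i, bmf (F i)) -> bmf (fun z => \sum_(i <- s | Q i) F i z).
Proof.
move=> bF; elim: s => [|i s ih].
  rewrite (_ : (fun z => _) = (fun=> 0)); first exact: bmf_cst.
  by apply/funext => z; rewrite big_nil.
case: (boolP (Q i)) => Qi.
  rewrite (_ : (fun z => _) = (fun z => F i z + \sum_(i <- s | Q i) F i z)).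
    exact: bmfD.
  by apply/funext => z; rewrite big_cons Qi.
rewrite (_ : (fun z => _) = (fun z => \sum_(i <- s | Q i) F i z))//.
by apply/funext => z; rewrite big_cons (negbTE Qi).
Qed.

Lemma bmf_indic (A : set X) : measurable A -> bmf (\1_A : X -> R).
Proof.
move=> mA; split; first exact: measurable_indic.
exists 1 => z; rewrite indicE; case: (z \in A); by rewrite ?normr1 ?normr0.
Qed.

Lemma bmf_max f g : bmf f -> bmf g -> bmf (fun z => Num.max (f z) (g z)).
Proof.
move=> [mf [M fM]] [mg [N gN]]; split; first exact: measurable_maxr.
exists (Num.max M N) => z; rewrite le_max.
by case: (leP (f z) (g z)) => _; rewrite ?fM ?gN ?orbT.
Qed.

Lemma bmf_comp (S : X -> X) f : measurable_fun [set: X] S -> bmf f -> bmf (f \o S).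
Proof.
move=> mS [mf [M fM]]; split; first exact: measurableT_comp.
by exists M => z; exact: fM.
Qed.

Lemma Ex_cst (c : R) : Ex (fun=> c) = c.
Proof.
rewrite /Ex Rintegral_cst// -[RHS]mulr1; congr (_ * _).
exact: (congr1 fine (probability_setT P)).
Qed.

Lemma ExD f g : bmf f -> bmf g -> Ex (fun z => f z + g z) = Ex f + Ex g.
Proof. by move=> bf bg; rewrite /Ex RintegralD//; exact: bmf_integrable. Qed.

Lemma ExB f g : bmf f -> bmf g -> Ex (fun z => f z - g z) = Ex f - Ex g.
Proof. by move=> bf bg; rewrite /Ex RintegralB//; exact: bmf_integrable. Qed.

Lemma ExZ (c : R) f : bmf f -> Ex (fun z => c * f z) = c * Ex f.
Proof. by move=> bf; rewrite /Ex RintegralZl//; exact: bmf_integrable. Qed.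

Lemma ExZr (c : R) f : bmf f -> Ex (fun z => f z * c) = Ex f * c.
Proof. by move=> bf; rewrite /Ex RintegralZr//; exact: bmf_integrable. Qed.

Lemma Ex_sum (I : Type) (s : seq I) (Q : pred I) (F : I -> X -> R) :
  (forall i, bmf (F i)) ->
  Ex (fun z => \sum_(i <- s | Q i) F i z) = \sum_(i <- s | Q i) Ex (F i).
Proof.
move=> bF; elim: s => [|i s ih].
  rewrite big_nil -[RHS](Ex_cst 0); congr Ex.
  by apply/funext => z; rewrite big_nil.
rewrite big_cons; case: (boolP (Q i)) => Qi.
  rewrite -ih -ExD//; last exact: bmf_sum.
  by congr Ex; apply/funext => z; rewrite big_cons Qi.
rewrite -ih; congr Ex; by apply/funext => z; rewrite big_cons (negbTE Qi).
Qed.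

Lemma Ex_le_ae f g : bmf f -> bmf g -> {ae P, forall z, f z <= g z} -> Ex f <= Ex g.
Proof.
move=> bf bg fg.
have fgi : P.-integrable [set: X] (EFin \o f) by exact: bmf_integrable.
have ggi : P.-integrable [set: X] (EFin \o g) by exact: bmf_integrable.
rewrite -subr_ge0 -ExB//.
(* The difference agrees almost everywhere with its positive part, which is nonnegative at every
   point. *)
have -> : Ex (fun z => g z - f z) = Ex (fun z => Num.max (g z - f z) 0).
  rewrite /Ex /Rintegral; congr fine; apply: ae_eq_integral => //.
  - by apply/measurable_EFinP; apply: measurable_funB; [case: bg | case: bf].
  - apply/measurable_EFinP; apply: measurable_maxr; last exact: measurable_cst.
    by apply: measurable_funB; [case: bg | case: bf].
  - apply: filterS fg => z fgz _ /=; congr EFin.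
    by rewrite max_l// subr_ge0.
by apply: Rintegral_ge0 => z _; rewrite le_max lexx orbT.
Qed.

Lemma Ex_le f g : bmf f -> bmf g -> (forall z, f z <= g z) -> Ex f <= Ex g.
Proof. by move=> bf bg fg; apply: Ex_le_ae => //; apply: aeW. Qed.

Lemma Ex_eq_ae f g : bmf f -> bmf g -> {ae P, forall z, f z = g z} -> Ex f = Ex g.
Proof.
move=> bf bg fg; apply/eqP; rewrite eq_le; apply/andP; split;
  by apply: Ex_le_ae => //; apply: filterS fg => z ->.
Qed.

Lemma Ex_ge0 f : (forall z, 0 <= f z) -> 0 <= Ex f.
Proof. by move=> f0; apply: Rintegral_ge0. Qed.

Lemma Ex_norm_le f M : bmf f -> (forall z, `|f z| <= M) -> `|Ex f| <= M.
Proof.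
move=> bf fM; rewrite ler_norml; apply/andP; split.
  rewrite -(Ex_cst (- M)); apply: Ex_le => //; first exact: bmf_cst.
  by move=> z; have := fM z; rewrite ler_norml => /andP[].
rewrite -[leRHS](Ex_cst M); apply: Ex_le => //; first exact: bmf_cst.
by move=> z; have := fM z; rewrite ler_norml => /andP[].
Qed.

Lemma Ex_indic (A : set X) : measurable A -> Ex (\1_A : X -> R) = prb A.
Proof. by move=> mA; rewrite /Ex /Rintegral integral_indic// setIT. Qed.

Lemma prb_ge0 A : 0 <= prb A.
Proof. by rewrite /prb fine_ge0. Qed.

Lemma prbE A : measurable A -> P A = (prb A)%:E.
Proof. by move=> mA; rewrite /prb fineK// fin_num_measure. Qed.

Lemma prb_le A B : measurable A -> measurable B -> A `<=` B -> prb A <= prb B.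
Proof.
by move=> mA mB AB; rewrite -lee_fin -!prbE// le_measure// inE.
Qed.

Lemma prb_le1 A : measurable A -> prb A <= 1.
Proof. by move=> mA; rewrite -lee_fin -prbE// probability_le1. Qed.

Lemma prb_setT : prb setT = 1.
Proof. by rewrite /prb probability_setT. Qed.

Lemma prb_setC A : measurable A -> prb (~` A) = 1 - prb A.
Proof.
move=> mA; apply: EFin_inj; rewrite -prbE; last exact: measurableC.
by rewrite probability_setC// prbE.
Qed.

Lemma prbU_le A B : measurable A -> measurable B -> prb (A `|` B) <= prb A + prb B.
Proof.
move=> mA mB; rewrite -lee_fin -prbE; last exact: measurableU.
by rewrite EFinD -!prbE// measureU2.
Qed.

Lemma prb_setD A B : measurable A -> measurable B -> B `<=` A ->
  prb (A `\` B) = prb A - prb B.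
Proof.
move=> mA mB BA; apply: EFin_inj; rewrite -prbE; last exact: measurableD.
by rewrite EFinB -!prbE// measureD//= ?setIidr// -ge0_fin_numE// fin_num_measure.
Qed.

Lemma prb_null_ae A : measurable A -> prb A = 0 -> {ae P, forall z, ~ A z}.
Proof.
move=> mA A0; exists A; split => //; first by rewrite prbE// A0.
by move=> z /contrapT.
Qed.

Lemma prb_ae_full A : measurable A -> {ae P, forall z, A z} -> prb A = 1.
Proof.
move=> mA [N [mN N0 AN]].
have : prb (~` A) <= 0.
  have /le_trans := prb_le (measurableC mA) mN AN; apply.
  by rewrite /prb N0.
by rewrite prb_setC// => h; apply/eqP; rewrite eq_le prb_le1//= -subr_le0.
Qed.

Lemma prb_ae0 A : measurable A -> {ae P, forall z, ~ A z} -> prb A = 0.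
Proof.
move=> mA h; have := prb_ae_full (measurableC mA) h.
by rewrite prb_setC//; lra.
Qed.

Lemma markov_prb f (l : R) : bmf f -> (forall z, 0 <= f z) ->
  l * prb [set z | l <= f z] <= Ex f.
Proof.
move=> bf f0.
have mA : measurable [set z | l <= f z].
  rewrite -[X in measurable X]setTI; apply: measurable_fun_ler => //.
  by case: bf.
rewrite -Ex_indic// -ExZ; last exact: bmf_indic.
apply: Ex_le => //; first by apply: bmfZ; exact: bmf_indic.
move=> z; rewrite indicE; case: (boolP (z \in _)) => [|_]; last by rewrite mulr0.
by rewrite inE/= mulr1.
Qed.

(** Continuity from above at the empty set; it turns [eventually, at each point] into a uniform
    stage outside a small set. *)
Lemma prb_cvg0 (F : nat -> set X) : (forall n, measurable (F n)) ->
  (forall n, F n.+1 `<=` F n) -> \bigcap_n F n = set0 ->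
  forall e : R, 0 < e -> exists n, prb (F n) < e.
Proof.
move=> mF dF F0 e e0.
have niF : nonincreasing_seq F.
  apply/nonincreasing_seqP => n; apply/subsetPset; exact: dF.
have := @nonincreasing_cvg_mu _ _ _ P F.
have PF0 : (P (F 0%N) < +oo)%E by rewrite -ge0_fin_numE// fin_num_measure.
rewrite F0 measure0 => /(_ PF0 mF measurable0 niF) /fine_cvgP[_] /cvgr0Pnorm_lt /(_ e e0) [N _ /(_ N (leqnn N))] /=.
by move=> h; exists N; apply: le_lt_trans h; rewrite ler_norm.
Qed.

End Expectation.

(** * Finite labels and conditional averages *)

Section Labels.
Context {R : realType} {d : measure_display} {X : measurableType d}.
Variable P : probability X R.
Local Notation Ex := (Ex P).
Local Notation prb := (prb P).

(** A finite sub-sigma-algebra is encoded by a label map, so that conditional expectations are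
    finite averages over fibres. *)
Definition mlab (F : finType) (U : X -> F) :=
  forall a, measurable (U @^-1` [set a]).

Definition atom (F : eqType) (U : X -> F) (z : X) := [set z' | U z' = U z].

Definition refines (F G : Type) (V : X -> G) (U : X -> F) :=
  forall z z', V z = V z' -> U z = U z'.

Lemma mlab_set (F : finType) (U : X -> F) (B : set F) : mlab U ->
  measurable (U @^-1` B).
Proof.
move=> mU; rewrite (_ : _ @^-1` _ = \big[setU/set0]_(a <- enum F | `[< B a >]) (U @^-1` [set a])).
  by apply: bigsetU_measurable => a _; exact: mU.
rewrite -bigcup_seq_cond; apply/seteqP; split => z /=.
  by move=> Bz; exists (U z) => //=; apply/andP; split; [by rewrite mem_enum | exact/asboolP].
by move=> [a /= /andP[_ /asboolP Ba] ->].
Qed.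

Lemma measurable_atom (F : finType) (U : X -> F) z : mlab U -> measurable (atom U z).
Proof. by move=> mU; exact: (mU (U z)). Qed.

Lemma mlab_pair (F G : finType) (U : X -> F) (V : X -> G) :
  mlab U -> mlab V -> mlab (fun z => (U z, V z)).
Proof.
move=> mU mV [a b]; rewrite (_ : _ @^-1` _ = (U @^-1` [set a]) `&` (V @^-1` [set b])).
  exact: measurableI.
by apply/seteqP; split => z /= [-> ->].
Qed.

Lemma mlab_comp (F : finType) (U : X -> F) (S : X -> X) :
  measurable_fun [set: X] S -> mlab U -> mlab (U \o S).
Proof.
move=> mS mU a; rewrite comp_preimage -[X in measurable X]setTI.
exact: mS.
Qed.

Lemma lab_indicE (F : finType) (U : X -> F) (g : F -> R) z :
  g (U z) = \sum_a g a * \1_(U @^-1` [set a]) z.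
Proof.
rewrite (bigD1 (U z))//= big1 ?addr0.
  by rewrite indicE mem_set ?mulr1.
move=> a aU; rewrite indicE memNset ?mulr0//= => Ua.
by rewrite Ua eqxx in aU.
Qed.

Lemma bmf_lab (F : finType) (U : X -> F) (g : F -> R) : mlab U -> bmf (fun z => g (U z)).
Proof.
move=> mU.
rewrite (_ : (fun z => _) = (fun z => \sum_a g a * \1_(U @^-1` [set a]) z)).
  by apply: bmf_sum => a; apply: bmfZ; exact: bmf_indic.
by apply/funext => z; rewrite lab_indicE.
Qed.

Lemma lab_factor (F : finType) (U : X -> F) (g : X -> R) :
  (forall z z', U z = U z' -> g z = g z') -> exists h : F -> R, forall z, g z = h (U z).
Proof.
move=> gU; exists (fun a => if pselect (exists z, U z = a) is left e then g (projT1 (cid e)) else 0).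
move=> z; case: pselect => [e|]; last by case; exists z.
by case: cid => z' /= /esym; exact: gU.
Qed.

Lemma bmf_labm (F : finType) (U : X -> F) (g : X -> R) : mlab U ->
  (forall z z', U z = U z' -> g z = g z') -> bmf g.
Proof.
move=> mU /lab_factor[h gh]; rewrite (_ : g = fun z => h (U z)); first exact: bmf_lab.
exact/funext.
Qed.

Lemma Ex_lab (F : finType) (U : X -> F) (g : F -> R) (f : X -> R) : mlab U -> bmf f ->
  Ex (fun z => f z * g (U z)) = \sum_a g a * Ex (fun z => f z * \1_(U @^-1` [set a]) z).
Proof.
move=> mU bf.
have bI a : bmf (\1_(U @^-1` [set a]) : X -> R) by apply: bmf_indic.
transitivity (Ex (fun z => \sum_a g a * (f z * \1_(U @^-1` [set a]) z))).
  congr Ex; apply/funext => z; rewrite lab_indicE mulr_sumr.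
  by apply: eq_bigr => a _; ring.
rewrite Ex_sum => [|a]; last by apply: bmfZ; exact: bmfM.
by apply: eq_bigr => a _; rewrite ExZ//; exact: bmfM.
Qed.

Lemma Ex_labE (F : finType) (U : X -> F) (g : F -> R) : mlab U ->
  Ex (fun z => g (U z)) = \sum_a g a * prb (U @^-1` [set a]).
Proof.
move=> mU; rewrite (_ : (fun z => _) = (fun z => 1 * g (U z))); last first.
  by apply/funext => z; rewrite mul1r.
rewrite (@Ex_lab _ U g (fun=> 1))//; last exact: bmf_cst.
apply: eq_bigr => a _; congr (_ * _); rewrite -Ex_indic//.
by congr Ex; apply/funext => z; rewrite mul1r.
Qed.

Lemma atom_pos_ae (F : finType) (U : X -> F) : mlab U ->
  {ae P, forall z, 0 < prb (atom U z)}.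
Proof.
move=> mU; pose B := [set a | prb (U @^-1` [set a]) = 0].
have h : prb (U @^-1` B) = 0.
  rewrite -Ex_indic; last exact: mlab_set.
  have -> : (\1_(U @^-1` B) : X -> R) = fun z => (\1_B (U z) : R).
    by apply/funext => z; rewrite !indicE; congr (_%:R); apply: asbool_equiv_eq.
  rewrite Ex_labE// big1// => a _; rewrite indicE.
  by case: (boolP (a \in B)) => [|_]; rewrite ?mul0r// inE /B/= => ->; rewrite mulr0.
have := prb_null_ae (mlab_set B mU) h; apply: filterS => z.
by rewrite lt_neqAle prb_ge0 andbT => Bz; apply/eqP => e; apply: Bz; rewrite /B/= /atom in e *.
Qed.

(** Conditional expectation given a finite partition. On a null atom the division gives 0, so bounds
    and measurability hold at every point, not only almost everywhere. *)
Definition cond (F : eqType) (U : X -> F) (f : X -> R) (z : X) : R :=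
  Ex (fun z' => f z' * \1_(atom U z) z') / prb (atom U z).

Lemma cond_lab (F : finType) (U : X -> F) f z z' : U z = U z' -> cond U f z = cond U f z'.
Proof. by move=> e; rewrite /cond /atom e. Qed.

Lemma bmf_cond (F : finType) (U : X -> F) f : mlab U -> bmf (cond U f).
Proof. by move=> mU; apply: bmf_labm mU _ => z z'; exact: cond_lab. Qed.

Lemma Ex_null (A : set X) f : measurable A -> bmf f -> prb A = 0 ->
  Ex (fun z => f z * \1_A z) = 0.
Proof.
move=> mA bf A0; rewrite -(Ex_cst P 0); apply: Ex_eq_ae.
- by apply: bmfM => //; exact: bmf_indic.
- exact: bmf_cst.
- have := prb_null_ae mA A0; apply: filterS => z nAz.
  by rewrite indicE memNset// mulr0.
Qed.

Lemma Ex_cond (F : finType) (U : X -> F) f g : mlab U -> bmf f ->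
  (forall z z', U z = U z' -> g z = g z') ->
  Ex (fun z => cond U f z * g z) = Ex (fun z => f z * g z).
Proof.
move=> mU bf /lab_factor[h gh].
pose c a := Ex (fun z' => f z' * \1_(U @^-1` [set a]) z') / prb (U @^-1` [set a]).
transitivity (Ex (fun z => c (U z) * h (U z))).
  by congr Ex; apply/funext => z; rewrite gh.
rewrite (@Ex_labE _ U (fun a => c a * h a))//.
transitivity (Ex (fun z => f z * h (U z))); last first.
  by congr Ex; apply/funext => z; rewrite gh.
rewrite Ex_lab//; apply: eq_bigr => a _.
rewrite mulrAC mulrC; congr (_ * _); rewrite /c.
have [p0|p0] := eqVneq (prb (U @^-1` [set a])) 0; last by rewrite divfK.
by rewrite p0 mulr0 Ex_null.
Qed.

Lemma cond_cst (F : finType) (U : X -> F) c z : mlab U -> 0 < prb (atom U z) ->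
  cond U (fun=> c) z = c.
Proof.
move=> mU p0; have mA := measurable_atom z mU.
by rewrite /cond ExZ ?Ex_indic ?mulfK ?gt_eqF//; exact: bmf_indic.
Qed.

Lemma condD (F : finType) (U : X -> F) f g z : mlab U -> bmf f -> bmf g ->
  cond U (fun z => f z + g z) z = cond U f z + cond U g z.
Proof.
move=> mU bf bg; have bI : bmf (\1_(atom U z) : X -> R).
  by apply: bmf_indic; exact: measurable_atom.
rewrite /cond -mulrDl -ExD; [|exact: bmfM..].
by congr (Ex _ / _); apply/funext => z'; rewrite mulrDl.
Qed.

Lemma condZ (F : finType) (U : X -> F) c f z : mlab U -> bmf f ->
  cond U (fun z => c * f z) z = c * cond U f z.
Proof.
move=> mU bf; have bI : bmf (\1_(atom U z) : X -> R).
  by apply: bmf_indic; exact: measurable_atom.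
rewrite /cond mulrA -ExZ; last exact: bmfM.
by congr (Ex _ / _); apply/funext => z'; rewrite mulrA.
Qed.

Lemma cond_le_ae (F : finType) (U : X -> F) f g z : mlab U -> bmf f -> bmf g ->
  {ae P, forall z', U z' = U z -> f z' <= g z'} -> cond U f z <= cond U g z.
Proof.
move=> mU bf bg h; have bI : bmf (\1_(atom U z) : X -> R).
  by apply: bmf_indic; exact: measurable_atom.
rewrite /cond ler_wpM2r ?invr_ge0 ?prb_ge0//; apply: Ex_le_ae; [exact: bmfM..|].
apply: filterS h => z' h; rewrite indicE.
case: (boolP (z' \in _)) => [|_]; last by rewrite !mulr0.
by rewrite inE /= !mulr1 => /h.
Qed.

Lemma cond_close (F : finType) (U : X -> F) f g z e : mlab U -> bmf f -> bmf g ->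
  0 < prb (atom U z) -> {ae P, forall z', U z' = U z -> `|f z' - g z'| <= e} ->
  `|cond U f z - cond U g z| <= e.
Proof.
move=> mU bf bg p0 h; rewrite ler_distl; apply/andP; split.
  rewrite lerBlDr -[X in _ + X](@cond_cst _ U e z)// -condD//; last exact: bmf_cst.
  apply: cond_le_ae => //; first by apply: bmfD => //; exact: bmf_cst.
  apply: filterS h => z' h /h; rewrite ler_distl => /andP[]; lra.
rewrite -[X in _ + X](@cond_cst _ U e z)// -condD//; last exact: bmf_cst.
apply: cond_le_ae => //; first by apply: bmfD => //; exact: bmf_cst.
by apply: filterS h => z' h /h; rewrite ler_distl => /andP[].
Qed.

Lemma cond_norm_le (F : finType) (U : X -> F) f z M : mlab U -> bmf f ->
  (forall z, `|f z| <= M) -> `|cond U f z| <= M.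
Proof.
move=> mU bf fM; have M0 : 0 <= M := le_trans (normr_ge0 _) (fM z).
have [p0|p0] := eqVneq (prb (atom U z)) 0; first by rewrite /cond p0 invr0 mulr0 normr0.
have pp : 0 < prb (atom U z) by rewrite lt_neqAle eq_sym p0 prb_ge0.
have := @cond_close _ U f (fun=> 0) z M mU bf (bmf_cst _) pp.
by rewrite cond_cst// subr0; apply; apply: aeW => z' _; rewrite subr0.
Qed.

Lemma refines_atom (F G : finType) (V : X -> G) (U : X -> F) z :
  refines V U -> atom V z `<=` atom U z.
Proof. by move=> VU z' /VU. Qed.

(** The difference [cond V f - cond U f] is orthogonal to [cond U f * g], so its weighted square is
    the difference of the two sides. The coarse weight [g] is there for the first-passage events of
    [doob]. *)
Lemma cond_jensen (F G : finType) (V : X -> G) (U : X -> F) f g :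
  mlab U -> mlab V -> refines V U -> bmf f ->
  (forall z z', U z = U z' -> g z = g z') -> (forall z, 0 <= g z) ->
  Ex (fun z => cond U f z ^+ 2 * g z) <= Ex (fun z => cond V f z ^+ 2 * g z).
Proof.
move=> mU mV VU bf gU g0.
have bg : bmf g by exact: bmf_labm mU gU.
have bU : bmf (cond U f) by exact: bmf_cond.
have bV : bmf (cond V f) by exact: bmf_cond.
have b1 : bmf (fun z => cond U f z ^+ 2 * g z) by apply: bmfM => //; exact: bmfX.
have b2 : bmf (fun z => cond V f z ^+ 2 * g z) by apply: bmfM => //; exact: bmfX.
have b3 : bmf (fun z => cond V f z * (cond U f z * g z)) by do 2!apply: bmfM => //.
have e1 : Ex (fun z => cond V f z * (cond U f z * g z)) =
          Ex (fun z => cond U f z ^+ 2 * g z).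
  rewrite Ex_cond// => [|z z' /VU e]; last by rewrite (gU _ _ e) (cond_lab _ e).
  rewrite -(@Ex_cond _ U f (fun z => cond U f z * g z))//; last first.
    by move=> z z' e; rewrite (gU _ _ e) (cond_lab _ e).
  by congr Ex; apply/funext => z; rewrite expr2 mulrA.
have : 0 <= Ex (fun z => cond V f z ^+ 2 * g z -
    (2 * (cond V f z * (cond U f z * g z)) - cond U f z ^+ 2 * g z)).
  apply: Ex_ge0 => z.
  have -> : cond V f z ^+ 2 * g z - (2 * (cond V f z * (cond U f z * g z)) - cond U f z ^+ 2 * g z) = (cond V f z - cond U f z) ^+ 2 * g z by ring.
  by rewrite mulr_ge0// sqr_ge0.
rewrite ExB//; last by apply: bmfB => //; exact: bmfZ.
rewrite ExB//; last exact: bmfZ.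
rewrite ExZ// e1; lra.
Qed.

Definition preserving (T : X -> X) :=
  measurable_fun [set: X] T /\ forall A, measurable A -> P (T @^-1` A) = P A.

Lemma preimage_measurable T A : preserving T -> measurable A -> measurable (T @^-1` A).
Proof. by move=> [mT _] mA; rewrite -[X in measurable X]setTI; exact: mT. Qed.

Lemma prb_preimage T A : preserving T -> measurable A -> prb (T @^-1` A) = prb A.
Proof. by move=> [mT pT] mA; rewrite /prb pT. Qed.

Lemma preserving_id : preserving id.
Proof. by split => // A mA; rewrite preimage_id. Qed.

Lemma preserving_comp S T : preserving S -> preserving T -> preserving (S \o T).
Proof.
move=> [mS pS] [mT pT]; split; first exact: measurableT_comp.
move=> A mA; rewrite comp_preimage pT ?pS//.
by rewrite -[X in measurable X]setTI; exact: mS.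
Qed.

Lemma preserving_iter T n : preserving T -> preserving (iter n T).
Proof.
move=> pT; elim: n => [|n ih]; first exact: preserving_id.
by have := preserving_comp pT ih.
Qed.

Lemma Ex_preserving T f : preserving T -> bmf f -> Ex (f \o T) = Ex f.
Proof.
move=> [mT pT] bf; rewrite /Ex /Rintegral; congr fine.
pose m : {measure set X -> \bar R} := P.
have h : (\int[pushforward m T]_y (EFin \o f) y = \int[m]_x ((EFin \o f) \o T) x)%E.
  rewrite (integral_pushforward mT)//.
  - by apply/measurable_EFinP; case: bf.
  - exact: (bmf_integrable P (bmf_comp mT bf)).
rewrite -h; apply: eq_measure_integral => A mA _ /=.
by rewrite /pushforward pT.
Qed.

Lemma cond_preserving (F : finType) (U : X -> F) f T z : mlab U -> bmf f -> preserving T ->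
  cond (U \o T) (f \o T) z = cond U f (T z).
Proof.
move=> mU bf pT; rewrite /cond.
have -> : atom (U \o T) z = T @^-1` atom U (T z) by [].
have mA := measurable_atom (T z) mU.
rewrite prb_preimage//; congr (_ / _).
rewrite -(@Ex_preserving T (fun z' => f z' * \1_(atom U (T z)) z'))//.
by apply: bmfM => //; exact: bmf_indic.
Qed.

Lemma ae_preserving T (Q : X -> Prop) : preserving T ->
  {ae P, forall z, Q z} -> {ae P, forall z, Q (T z)}.
Proof.
move=> pT [N [mN N0 QN]]; exists (T @^-1` N); split.
- exact: preimage_measurable.
- by case: pT => _ ->.
- by move=> z /= nQ; apply: QN.
Qed.

End Labels.

(** * Ergodic averages along a single orbit *)

Section Averages.
Context {R : realType}.
Implicit Types (a b : nat -> R) (l e : R).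

(** Cesaro convergence to 0, multiplied out so that no division by [n] occurs. *)
Definition avg0 a := forall e : R, 0 < e ->
  exists n0, forall n, (n0 <= n)%N -> `|\sum_(k < n) a k| <= e * n%:R.

(* [limsup (1/n) \sum_(k < n) a k > l] *)
Definition io_avg a l := exists m : nat, forall n0, exists2 n,
  (n0 <= n)%N & n%:R * (l + m.+1%:R^-1) <= \sum_(k < n) a k.

Lemma exists_inv e : 0 < e -> exists m : nat, m.+1%:R^-1 < e.
Proof.
move=> e0; have := archi_boundP (ltW (divr_gt0 ltr01 e0)).
rewrite div1r; set m := Num.Def.archi_bound _ => h; exists m.
have h' : e^-1 < m.+1%:R by apply: (lt_trans h); rewrite ltr_nat.
by rewrite -[ltRHS]invrK ltf_pV2// ?posrE ?invr_gt0.
Qed.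

Lemma exists_nat_ge (x : R) : exists m : nat, x <= m%:R.
Proof.
exists (Num.Def.archi_bound `|x|); apply: le_trans (ler_norm x) _.
by apply/ltW/archi_boundP.
Qed.

Lemma io_avgN a l e : ~ io_avg a l -> 0 < e ->
  exists n0, forall n, (n0 <= n)%N -> \sum_(k < n) a k < n%:R * (l + e).
Proof.
move=> nio e0; have [m me] := exists_inv e0.
have /existsNP[n0 h] : ~ forall n0, exists2 n, (n0 <= n)%N &
    n%:R * (l + m.+1%:R^-1) <= \sum_(k < n) a k.
  by move=> h; apply: nio; exists m.
exists n0 => n n0n; rewrite ltNge; apply/negP => h'; apply: h; exists n => //.
by apply: le_trans h'; rewrite ler_wpM2l// lerD2l ltW.
Qed.

Lemma sum_le_shift a b e n : (forall k, a k <= b k + e) ->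
  \sum_(k < n) a k <= \sum_(k < n) b k + n%:R * e.
Proof.
move=> ab; have -> : n%:R * e = \sum_(k < n) e by rewrite sumr_const card_ord mulr_natl.
by rewrite -big_split/=; apply: ler_sum => k _; exact: ab.
Qed.

Lemma io_avg_le a b e l : (forall k, a k <= b k + e) ->
  io_avg a (l + e) -> io_avg b l.
Proof.
move=> ab [m h]; exists m => n0; have [n n0n hn] := h n0; exists n => //.
by have := sum_le_shift n ab; move: hn; set u := _^-1 => hn; lra.
Qed.

Lemma io_avg_mono a b l : (forall k, a k <= b k) -> io_avg a l -> io_avg b l.
Proof. by move=> ab h; apply: (@io_avg_le a b 0) => [k|]; rewrite addr0. Qed.

Lemma io_avg_lt a l l' : l' <= l -> io_avg a l -> io_avg a l'.
Proof.
move=> ll' [m h]; exists m => n0; have [n n0n hn] := h n0; exists n => //.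
by apply: le_trans hn; rewrite ler_wpM2l// lerD2r.
Qed.

Lemma io_avg_tile a l : 0 <= l -> io_avg a l ->
  exists2 n, (0 < n)%N & n%:R * l <= \sum_(k < n) a k.
Proof.
move=> l0 [m h]; have [n n0 hn] := h 1%N; exists n => //.
by apply: le_trans hn; rewrite ler_wpM2l// lerDl invr_ge0.
Qed.

Lemma io_avg_shift_aux a l M (s : nat) c : (forall k, `|a k| <= M) ->
  (forall n, \sum_(k < n) a (s + k)%N <= \sum_(k < n) a k + c) ->
  io_avg (fun k => a (s + k)%N) l -> io_avg a l.
Proof.
move=> aM hc [m h].
pose e : R := m.+1%:R^-1 / 2.
have e0 : 0 < e by rewrite divr_gt0// invr_gt0.
have [m' m'e] := exists_inv e0.
exists m' => n0; have [n1 hn1] := exists_nat_ge (c / e).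
have [n] := h (maxn n0 n1); rewrite geq_max => /andP[n0n n1n] hn; exists n => //.
have cn : c <= n%:R * e.
  rewrite -ler_pdivrMr//; apply: le_trans hn1 _; by rewrite ler_nat.
have hn' := le_trans hn (hc n).
have : n%:R * (l + m'.+1%:R^-1) <= n%:R * (l + e) by rewrite ler_wpM2l// lerD2l ltW.
have e2 : m.+1%:R^-1 = e + e by rewrite /e; set u := _^-1; lra.
move: hn'; rewrite e2 !mulrDr; move: cn; set u := _^-1; set x := _%:R * e; set y := _ * u; lra.
Qed.

Lemma sum_shift_diff a M (s n : nat) : (forall k, `|a k| <= M) ->
  `|\sum_(k < n) a (s + k)%N - \sum_(k < n) a k| <= (s + s)%:R * M.
Proof.
move=> aM; elim: s => [|s ih].
  by rewrite mul0r (_ : _ - _ = 0) ?normr0// subrr.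
have h : \sum_(k < n) a (s.+1 + k)%N = \sum_(k < n) a (s + k)%N + a (s + n)%N - a s.
  have e1 : \sum_(k < n.+1) a (s + k)%N = \sum_(k < n) a (s + k)%N + a (s + n)%N.
    by rewrite big_ord_recr.
  have e2 : \sum_(k < n.+1) a (s + k)%N = a s + \sum_(k < n) a (s.+1 + k)%N.
    rewrite big_ord_recl/= addn0; congr (_ + _).
    by apply: eq_bigr => k _; congr a; rewrite addSnnS.
  by rewrite -e1 e2; ring.
rewrite h.
have -> : (s.+1 + s.+1)%:R * M = (s + s)%:R * M + (M + M).
  by rewrite !natrD -![s.+1]addn1 !natrD; ring.
have -> : \sum_(k < n) a (s + k)%N + a (s + n)%N - a s - \sum_(k < n) a k =
  (\sum_(k < n) a (s + k)%N - \sum_(k < n) a k) + (a (s + n)%N - a s) by ring.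
apply: le_trans (ler_normD _ _) _; rewrite lerD//.
by apply: le_trans (ler_normB _ _) _; rewrite lerD.
Qed.

(** A shift changes the partial sums by a bounded amount, which half of the margin in [io_avg]
    absorbs. *)
Lemma io_avg_shift a l M (s : nat) : (forall k, `|a k| <= M) ->
  io_avg (fun k => a (s + k)%N) l <-> io_avg a l.
Proof.
move=> aM; split.
  apply: (@io_avg_shift_aux _ _ M _ ((s + s)%:R * M)) => // n.
  have := sum_shift_diff s n aM; rewrite ler_distl => /andP[]; lra.
move=> [m h].
pose e : R := m.+1%:R^-1 / 2.
have e0 : 0 < e by rewrite divr_gt0// invr_gt0.
have [m' m'e] := exists_inv e0.
exists m' => n0; have [n1 hn1] := exists_nat_ge ((s + s)%:R * M / e).
have [n] := h (maxn n0 n1); rewrite geq_max => /andP[n0n n1n] hn; exists n => //.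
have cn : (s + s)%:R * M <= n%:R * e.
  rewrite -ler_pdivrMr//; apply: le_trans hn1 _; by rewrite ler_nat.
have := sum_shift_diff s n aM; rewrite ler_distl => /andP[h1 _].
have : n%:R * (l + m'.+1%:R^-1) <= n%:R * (l + e) by rewrite ler_wpM2l// lerD2l ltW.
have e2 : m.+1%:R^-1 = e + e by rewrite /e; set u := _^-1; lra.
move: hn; rewrite e2 !mulrDr; move: cn; set u := _^-1; set x := _%:R * e; set y := _ * u; lra.
Qed.

Lemma avg0D a b : avg0 a -> avg0 b -> avg0 (fun k => a k + b k).
Proof.
move=> ha hb e e0; have e20 : 0 < e / 2 by rewrite divr_gt0.
have [n0 h0] := ha _ e20; have [n1 h1] := hb _ e20.
exists (maxn n0 n1) => n; rewrite geq_max => /andP[/h0 {}h0 /h1 {}h1].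
rewrite big_split/=; apply: le_trans (ler_normD _ _) _; lra.
Qed.

Lemma avg0Z a c : avg0 a -> avg0 (fun k => c * a k).
Proof.
move=> ha e e0; have c0 : 0 < `|c| + 1 by rewrite ltr_wpDl.
have [n0 h0] := ha _ (divr_gt0 e0 c0); exists n0 => n /h0 h.
rewrite -mulr_sumr normrM; apply: (@le_trans _ _ ((`|c| + 1) * `|\sum_(k < n) a k|)).
  by rewrite ler_wpM2r// lerDl.
by rewrite mulrC -ler_pdivlMr// mulrAC.
Qed.

Lemma eq_avg0 a b : a =1 b -> avg0 a -> avg0 b.
Proof. by move=> /funext ->. Qed.

(* Greedy tiling of [0, N) by the windows supplied by the hypothesis. *)
Lemma tile_sum a l (N0 : nat) : 0 <= l -> (forall k, 0 <= a k) ->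
  (forall k, exists2 n, (0 < n <= N0)%N & n%:R * l <= \sum_(i < n) a (k + i)%N) ->
  forall N, (N%:R - N0%:R) * l <= \sum_(k < N) a k.
Proof.
move=> l0 a0 h N.
suff : forall N k, (N%:R - N0%:R) * l <= \sum_(i < N) a (k + i)%N.
  by move=> /(_ N 0%N).
move=> {}N; elim/ltn_ind: N => N ih k.
have [NN0|N0N] := leqP N N0.
  apply: (@le_trans _ _ 0); last by apply: sumr_ge0.
  by rewrite mulr_le0_ge0// subr_le0 ler_nat.
have [n /andP[n0 nN0] hn] := h k.
have nN : (n <= N)%N by exact: leq_trans nN0 (ltnW N0N).
have Nn : (N - n < N)%N by rewrite ltn_subrL n0 (leq_trans _ N0N).
have := ih _ Nn (k + n)%N; rewrite natrB// => ih'.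
have -> : \sum_(i < N) a (k + i)%N = \sum_(i < n) a (k + i)%N + \sum_(i < N - n) a (k + n + i)%N.
  rewrite -[in LHS](subnKC nN) big_split_ord/=; congr (_ + _).
  by apply: eq_bigr => i _; rewrite addnA.
move: hn ih'; lra.
Qed.

End Averages.

(** * Tiling of orbits and Birkhoff's theorem *)

Section Ergodic.
Context {R : realType} {d : measure_display} {X : measurableType d}.
Variable P : probability X R.
Local Notation Ex := (Ex P).
Local Notation prb := (prb P).

Lemma measurable_ge (f : X -> R) l : bmf f -> measurable [set z | l <= f z].
Proof.
move=> [mf _]; rewrite -[X in measurable X]setTI.
by apply: measurable_fun_ler => //; exact: measurable_cst.
Qed.

Lemma measurable_io_avg (g : nat -> X -> R) l : (forall k, bmf (g k)) ->
  measurable [set z | io_avg (fun k => g k z) l].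
Proof.
move=> bg.
rewrite (_ : [set z | _] = \bigcup_m \bigcap_n0 \bigcup_(n in [set n | (n0 <= n)%N])
   [set z | n%:R * (l + m.+1%:R^-1) <= \sum_(k < n) g k z]).
  apply: bigcup_measurable => m _; apply: bigcapT_measurable => n0.
  apply: bigcup_measurable => n _.
  by apply: measurable_ge; exact: bmf_sum.
apply/seteqP; split => z /=.
  by move=> [m h]; exists m => // n0 _; have [n nn0 hn] := h n0; exists n.
by move=> [m _ h]; exists m => n0; have [n nn0 hn] := h n0 I; exists n.
Qed.

(** Adding [l] on [B k] makes a bad time [k] a tile of length 1, so every orbit from [E] is tiled;
    integrating, the correction costs at most [l * eta] per unit of time. *)
Lemma tiling_bound (g : nat -> X -> R) (E : set X) (B : nat -> set X) (l eta : R) (N0 : nat) :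
  0 <= l -> (forall k, bmf (g k)) -> (forall k z, 0 <= g k z) ->
  measurable E -> (forall k, measurable (B k)) -> (forall k, prb (B k) <= eta) ->
  (0 < N0)%N ->
  (forall k z, E z -> ~ B k z ->
     exists2 n, (0 < n <= N0)%N & n%:R * l <= \sum_(i < n) g (k + i)%N z) ->
  forall N, (N%:R - N0%:R) * l * prb E <= \sum_(k < N) Ex (g k) + N%:R * (l * eta).
Proof.
move=> l0 bg g0 mE mB Be N00 h N.
pose g' k z := g k z + l * \1_(B k) z.
have bB k : bmf (fun z => l * (\1_(B k) z : R)) by apply: bmfZ; exact: bmf_indic.
have bg' k : bmf (g' k) by exact: bmfD.
have g'0 k z : 0 <= g' k z by rewrite addr_ge0// mulr_ge0// indicE.
have hE z : E z -> (N%:R - N0%:R) * l <= \sum_(k < N) g' k z.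
  move=> Ez; apply: (@tile_sum _ (fun k => g' k z)) => // k.
  have [Bz|nBz] := pselect (B k z).
    exists 1%N; first by rewrite N00.
    by rewrite big_ord1 addn0 mul1r /g' indicE mem_set// mulr1 lerDr.
  have [n nN hn] := h k z Ez nBz; exists n => //; apply: le_trans hn _.
  by apply: ler_sum => i _; rewrite lerDl mulr_ge0// indicE.
rewrite -Ex_indic// -ExZ; last exact: bmf_indic.
apply: (@le_trans _ _ (Ex (fun z => \sum_(k < N) g' k z))).
  apply: Ex_le; [by apply: bmfZ; exact: bmf_indic|exact: bmf_sum|] => z.
  rewrite indicE; case: (boolP (z \in E)) => [|_]; last by rewrite mulr0 sumr_ge0.
  by rewrite inE mulr1; exact: hE.
rewrite Ex_sum//.
have -> : N%:R * (l * eta) = \sum_(k < N) (l * eta) by rewrite sumr_const card_ord mulr_natl.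
rewrite -big_split/=; apply: ler_sum => k _.
rewrite ExD// lerD2l ExZ ?Ex_indic//; last exact: bmf_indic.
exact: ler_wpM2l.
Qed.

Lemma measurable_tileless (g : nat -> X -> R) l N : (0 < N)%N -> (forall k, bmf (g k)) ->
  measurable [set z | forall n, (0 < n <= N)%N -> \sum_(k < n) g k z < n%:R * l].
Proof.
move=> N0 bg.
rewrite (_ : [set z | _] = \bigcap_(n in [set n | (0 < n <= N)%N])
    ~` [set z | n%:R * l <= \sum_(k < n) g k z]).
  apply: bigcap_measurable => [|n _]; last by apply/measurableC/measurable_ge/bmf_sum.
  by exists 1%N => //=.
apply/seteqP; split => z /= h n nN /=.
  by apply/negP; rewrite -ltNge; exact: h.
by rewrite ltNge; apply/negP; exact: h.
Qed.

(** Each point of [E] has some tile, so the points without a tile of length at most [N] decrease to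
    the empty set. *)
Lemma tileless_small (g : nat -> X -> R) l (E : set X) (e : R) : (forall k, bmf (g k)) ->
  measurable E -> (forall z, E z -> exists2 n, (0 < n)%N & n%:R * l <= \sum_(k < n) g k z) ->
  0 < e -> exists2 N, (0 < N)%N & prb (E `&` [set z | forall n, (0 < n <= N)%N ->
      \sum_(k < n) g k z < n%:R * l]) < e.
Proof.
move=> bg mE hE e0.
pose F N := E `&` [set z | forall n, (0 < n <= N.+1)%N -> \sum_(k < n) g k z < n%:R * l].
have mF n : measurable (F n) by apply: measurableI => //; exact: measurable_tileless.
have dF n : F n.+1 `<=` F n.
  by move=> z [Ez h]; split => // k /andP[k0 kn]; apply: h; rewrite k0 (leq_trans kn).
have eF : \bigcap_n F n = set0.
  apply/seteqP; split => // z /= h.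
  have [n n0 hn] := hE z (h 0%N I).1.
  have := (h n I).2 n; rewrite n0 leqnSn => /(_ isT).
  by rewrite ltNge hn.
by have [N hN] := prb_cvg0 P mF dF eF e0; exists N.+1.
Qed.

Variable T : X -> X.
Hypothesis pT : preserving P T.
Hypothesis ergT : forall A, measurable A -> T @^-1` A = A -> prb A = 0 \/ prb A = 1.

(** The exceptional set is invariant, hence null or of full measure. In the latter case orbits are
    tiled by blocks of average at least [l], which forces the mean of [f] up to nearly [l]. *)
Lemma birkhoff_upper (f : X -> R) l : bmf f -> (forall z, 0 <= f z) -> Ex f < l ->
  {ae P, forall z, ~ io_avg (fun k => f (iter k T z)) l}.
Proof.
move=> bf f0 fl.
have l0 : 0 < l by apply: le_lt_trans fl; exact: Ex_ge0.
have piter k := preserving_iter k pT.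
have bg k : bmf (f \o iter k T) by apply: bmf_comp => //; case: (piter k).
pose E := [set z | io_avg (fun k => f (iter k T z)) l].
have mE : measurable E by exact: (@measurable_io_avg (fun k => f \o iter k T)).
have [M _ fM] := bmf_bound bf.
have TE : T @^-1` E = E.
  have iff z : io_avg (fun k => f (iter k T (T z))) l <-> io_avg (fun k => f (iter k T z)) l.
    have -> : (fun k => f (iter k T (T z))) = (fun k => (fun i => f (iter i T z)) (1 + k)%N).
      by apply/funext => k; rewrite add1n iterSr.
    by apply: (@io_avg_shift _ _ _ M) => k; exact: fM.
  by apply/seteqP; split => z /iff.
have [E0|E1] := ergT mE TE; first exact: prb_null_ae E0.
exfalso.
(* The correction [l * eta] then uses only half of the gap [l - Ex f]. *)
pose eta := (l - Ex f) / 2 / l.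
have eta0 : 0 < eta by rewrite !divr_gt0// subr_gt0.
have [N0 N00 hN0] := @tileless_small (fun k => f \o iter k T) l E eta bg mE
  (fun z => @io_avg_tile _ _ l (ltW l0)) eta0.
set B0 := (_ `&` _) in hN0.
have mB0 : measurable B0.
  by apply: measurableI => //; exact: (@measurable_tileless (fun k => f \o iter k T)).
have TkE k z : E z -> E (iter k T z).
  by elim: k => //= k ih /ih; rewrite -[in X in X -> _]TE.
have H : forall N, (N%:R - N0%:R) * l <= N%:R * Ex f + N%:R * (l * eta).
  move=> N; have : (N%:R - N0%:R) * l * prb E <=
    \sum_(k < N) Ex (f \o iter k T) + N%:R * (l * eta).
    apply: (@tiling_bound (fun k => f \o iter k T) E (fun k => iter k T @^-1` B0)) => //.
    - exact: ltW.
    - by move=> k z; exact: f0.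
    - by move=> k; exact: preimage_measurable (piter k) mB0.
    - by move=> k; rewrite (prb_preimage (piter k))// ltW.
    - move=> k z Ez nB.
      have /existsNP[n] : ~ forall n, (0 < n <= N0)%N ->
          \sum_(i < n) f (iter i T (iter k T z)) < n%:R * l.
        by move=> h; apply: nB; split => //; exact: TkE.
      move=> /not_implyP[nN /negP]; rewrite -leNgt => hn; exists n => //.
      by apply: le_trans hn _; apply: ler_sum => i _; rewrite /= addnC iterD.
  rewrite E1 mulr1; under eq_bigr do rewrite (Ex_preserving (piter _))//.
  by rewrite sumr_const card_ord -[Ex f *+ N]mulr_natl.
have le2 : l * eta = (l - Ex f) / 2 by rewrite /eta mulrC divfK// gt_eqF.
have [N hN] := exists_nat_ge ((N0%:R * l + 1) / ((l - Ex f) / 2)).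
have dl : 0 < (l - Ex f) / 2 by rewrite divr_gt0// subr_gt0.
move: hN; rewrite ler_pdivrMr// => hN.
have := H N; rewrite le2; lra.
Qed.

Lemma birkhoff (f : X -> R) : bmf f ->
  {ae P, forall z, avg0 (fun k => f (iter k T z) - Ex f)}.
Proof.
move=> bf.
(* [birkhoff_upper] wants a nonnegative function, hence the added constant [M]; the lower estimate
   is this one applied to [- f]. *)
have key g : bmf g -> {ae P, forall z, forall e, 0 < e ->
    exists n0, forall n, (n0 <= n)%N -> \sum_(k < n) g (iter k T z) <= n%:R * (Ex g + e)}.
  move=> bg; have [M M0 gM] := bmf_bound bg.
  pose h z := g z + M.
  have bh : bmf h by apply: bmfD => //; exact: bmf_cst.
  have h0 z : 0 <= h z by have := gM z; rewrite /h ler_norml => /andP[]; lra.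
  have H : {ae P, forall z, forall m : nat, ~ io_avg (fun k => h (iter k T z)) (Ex h + m.+1%:R^-1)}.
    apply: ae_foralln => m; apply: birkhoff_upper => //.
    by rewrite ltrDl invr_gt0.
  apply: filterS H => z H e e0.
  have [m me] := exists_inv (divr_gt0 e0 (ltr0n R 2)).
  have e20 : 0 < e / 2 by rewrite divr_gt0.
  have [n0 hn0] := io_avgN (H m) e20; exists n0 => n /hn0.
  have -> : \sum_(k < n) h (iter k T z) = \sum_(k < n) g (iter k T z) + n%:R * M.
    by rewrite big_split/= sumr_const card_ord mulr_natl.
  have -> : Ex h = Ex g + M by rewrite /h ExD// ?Ex_cst//; exact: bmf_cst.
  move=> hn; have n0' : 0 <= n%:R :> R by [].
  have : n%:R * m.+1%:R^-1 <= n%:R * (e / 2) by rewrite ler_wpM2l// ltW.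
  move: hn; set u := m.+1%:R^-1; rewrite !mulrDr; set y := _ * u; lra.
have := key _ (bmfN bf); have := key _ bf; apply: filterS2 => z h1 h2 e e0.
have [n1 {}h1] := h1 e e0; have [n2 {}h2] := h2 e e0.
exists (maxn n1 n2) => n; rewrite geq_max => /andP[/h1 {}h1 /h2 {}h2].
have EN : Ex (fun z => - f z) = - Ex f.
  by rewrite -[RHS]mulN1r -ExZ//; congr Ex; apply/funext => x; rewrite mulN1r.
move: h2; rewrite EN sumrN big_split/= sumr_const card_ord -mulr_natl ler_norml => h2.
by apply/andP; split; lra.
Qed.

End Ergodic.

(** * A strong law for bounded variables uncorrelated at a distance *)

Section LLN.
Context {R : realType} {d : measure_display} {X : measurableType d}.
Variable P : probability X R.
Local Notation Ex := (Ex P).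
Local Notation prb := (prb P).

Lemma sum_inv_square_le n : \sum_(i < n) (i.+1%:R ^+ 2)^-1 <= 2 :> R.
Proof.
suff : \sum_(i < n) (i.+1%:R ^+ 2)^-1 <= 2 * (1 - n.+1%:R^-1) :> R.
  move=> /le_trans; apply; rewrite mulrBr mulr1 gerBl mulr_ge0//.
elim: n => [|n ih]; first by rewrite big_ord0 invr1 subrr mulr0.
rewrite big_ord_recr/=; apply: (le_trans (lerD ih (lexx _))).
have e : n.+2%:R = n.+1%:R + 1 :> R by rewrite -natr1.
rewrite e; have : 1 <= n.+1%:R :> R by rewrite ler1n.
move: (n.+1%:R : R) => x x1; have x0 : 0 < x by lra.
rewrite -subr_ge0.
have -> : 2 * (1 - (x + 1)^-1) - (2 * (1 - x^-1) + (x ^+ 2)^-1) = (x - 1) / (x ^+ 2 * (x + 1)).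
  by field; apply/andP; split; rewrite gt_eqF//; lra.
by rewrite divr_ge0// ?mulr_ge0 ?sqr_ge0//; lra.
Qed.

Lemma borel_cantelli_square (A : nat -> set X) (C : R) : 0 <= C ->
  (forall n, measurable (A n)) -> (forall n, prb (A n) <= C / n.+1%:R ^+ 2) ->
  {ae P, forall z, exists n0, forall n, (n0 <= n)%N -> ~ A n z}.
Proof.
move=> C0 mA hA.
have : P (lim_sup_set A) = 0%E.
  apply: lim_sup_set_cvg0 => //.
  apply: (@le_lt_trans _ _ (C * 2)%:E); last exact: ltry.
  apply: lime_le; first exact: is_cvg_nneseries.
  apply: nearW => n; rewrite big_mkord.
  apply: (@le_trans _ _ (\sum_(i < n) prb (A i))%:E).
    by rewrite -sumEFin; apply: lee_sum => i _; rewrite -prbE.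
  rewrite lee_fin; apply: (@le_trans _ _ (\sum_(i < n) C * (i.+1%:R ^+ 2)^-1)).
    exact: ler_sum.
  by rewrite -mulr_sumr ler_wpM2l// sum_inv_square_le.
move=> h; exists (lim_sup_set A); split => //.
  by apply: bigcapT_measurable => n; apply: bigcup_measurable => k _.
move=> z /= /forallNP hz n _; have /existsNP[k /not_implyP[nk /contrapT Ak]] := hz n.
by exists k.
Qed.

(* Second moments along squares, then interpolation between consecutive squares. *)
Lemma lln (Y : nat -> X -> R) (B : R) (M : nat) : (forall k, bmf (Y k)) ->
  (forall k z, `|Y k z| <= B) ->
  (forall k l, (k + M <= l)%N -> Ex (fun z => Y k z * Y l z) = 0) ->
  {ae P, forall z, avg0 (fun k => Y k z)}.
Proof.
move=> bY YB orth.
have [z0|ne] := pselect (exists z : X, True); last first.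
  by apply: aeW => z; exfalso; apply: ne; exists z.
have B0 : 0 <= B by case: z0 => z _; exact: le_trans (normr_ge0 _) (YB 0%N z).
pose S n z := \sum_(k < n) Y k z.
have bS n : bmf (S n) by exact: bmf_sum.
have bYY k l : bmf (fun z => Y k z * Y l z) by exact: bmfM.
(* Only the last [M] summands of [S n] can be correlated with [Y n]. *)
have cross n : `|Ex (fun z => S n z * Y n z)| <= M%:R * B ^+ 2.
  have -> : Ex (fun z => S n z * Y n z) = \sum_(k < n) Ex (fun z => Y k z * Y n z).
    by rewrite -Ex_sum//; congr Ex; apply/funext => z; rewrite /S mulr_suml.
  rewrite (big_ord_widen_cond n xpredT (fun k => Ex (fun z => Y k z * Y n z)))//=.
  apply: le_trans (ler_norm_sum _ _ _) _.
  have bd k : `|Ex (fun z => Y k z * Y n z)| <= B ^+ 2.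
    by apply: Ex_norm_le => // z; rewrite normrM expr2 ler_pM.
  apply: (@le_trans _ _ (\sum_(k < n) (if (n - M <= k)%N then B ^+ 2 else 0))).
    rewrite big_mkcond/=; apply: ler_sum => k _; rewrite ltn_ord.
    case: ifP => // /negbT; rewrite -ltnNge ltn_subRL addnC => h.
    by rewrite orth ?normr0// ltnW.
  rewrite -(big_mkord xpredT (fun k => if (n - M <= k)%N then B ^+ 2 else 0)).
  rewrite (big_cat_nat (n := (n - M)%N))//= ?leq_subr//.
  rewrite big_nat big1 ?add0r => [|i /andP[_ h]]; last by rewrite leqNgt h.
  rewrite big_nat (eq_bigr (fun=> B ^+ 2)) => [|i /andP[-> _]//].
  rewrite -big_nat sumr_const_nat -[_ ^+ 2 *+ _]mulr_natl ler_wpM2r ?sqr_ge0//.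
  by rewrite ler_nat leq_subLR addnC -leq_subLR.
have sq n : Ex (fun z => S n z ^+ 2) <= n%:R * ((2 * M%:R + 1) * B ^+ 2).
  elim: n => [|n ih].
    rewrite mul0r (_ : (fun z => _) = fun=> 0) ?Ex_cst//.
    by apply/funext => z; rewrite /S big_ord0 expr0n.
  have -> : Ex (fun z => S n.+1 z ^+ 2) =
      Ex (fun z => S n z ^+ 2) + (2 * Ex (fun z => S n z * Y n z) + Ex (fun z => Y n z ^+ 2)).
    rewrite -ExZ; last exact: bmfM.
    rewrite -ExD; [|by apply: bmfZ; exact: bmfM|exact: bmfX].
    rewrite -ExD; [|exact: bmfX|by apply: bmfD; [apply: bmfZ; exact: bmfM|exact: bmfX]].
    by congr Ex; apply/funext => z; rewrite /S big_ord_recr/=; ring.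
  have h1 : Ex (fun z => Y n z ^+ 2) <= B ^+ 2.
    rewrite -[leRHS](Ex_cst P); apply: Ex_le; [exact: bmfX|exact: bmf_cst|] => z.
    by rewrite -real_normK ?num_real// !expr2 ler_pM.
  have := cross n; rewrite ler_norml => /andP[_ h2].
  rewrite -natr1; lra.
pose C := (2 * M%:R + 1) * B ^+ 2.
have C0 : 0 <= C by rewrite mulr_ge0// ?sqr_ge0// addr_ge0// mulr_ge0.
have squares : {ae P, forall z, forall m : nat, exists n0, forall n, (n0 <= n)%N ->
    `|S (n.+1 ^ 2)%N z| <= m.+1%:R^-1 * (n.+1 ^ 2)%:R}.
  apply: ae_foralln => m.
  pose c (n : nat) : R := (m.+1%:R^-1 * (n.+1 ^ 2)%:R) ^+ 2.
  have c0 n : 0 < c n.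
    by rewrite exprn_gt0// mulr_gt0// ?invr_gt0// ltr0n expn_gt0.
  have mA n : measurable [set z | c n <= S (n.+1 ^ 2)%N z ^+ 2].
    by apply: measurable_ge; exact: bmfX.
  have hA n : prb [set z | c n <= S (n.+1 ^ 2)%N z ^+ 2] <= (C * m.+1%:R ^+ 2) / n.+1%:R ^+ 2.
    rewrite -(ler_pM2l (c0 n)); apply: le_trans (markov_prb _ _ (bmfX 2 (bS _)) _) _.
      by move=> z; exact: sqr_ge0.
    apply: le_trans (sq _) _; rewrite /c natrX.
    have n0 : n.+1%:R != 0 :> R by rewrite pnatr_eq0.
    have m0 : m.+1%:R != 0 :> R by rewrite pnatr_eq0.
    rewrite le_eqVlt; apply/orP; left; apply/eqP.
    rewrite -/C; move: n0 m0; move: (n.+1%:R : R) (m.+1%:R : R) => x y n0 m0.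
    by field; rewrite n0 m0.
  have := borel_cantelli_square _ mA hA.
  have -> : 0 <= C * m.+1%:R ^+ 2 by rewrite mulr_ge0// sqr_ge0.
  move=> /(_ isT); apply: filterS => z [n0 hz]; exists n0 => n /hz /negP; rewrite -ltNge /c => h.
  have p0 : 0 <= m.+1%:R^-1 * (n.+1 ^ 2)%:R :> R by rewrite mulr_ge0.
  by rewrite -(ger0_norm p0) ltW// -ltr_sqr -?topredE/= ?nnegrE// !real_normK ?num_real.
apply: filterS squares => z hz e e0.
have e20 : 0 < e / 2 by rewrite divr_gt0.
have [m me] := exists_inv e20; have [n0 hn0] := hz m.
have [n1 hn1] := exists_nat_ge (3 * B / (e / 2)).
exists ((maxn n0 n1).+2 ^ 2)%N => N hN.
have [n /andP[nN Nn]] : exists n, (n.+1 ^ 2 <= N < n.+2 ^ 2)%N.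
  have : (0 < N)%N by apply: leq_trans hN; rewrite expn_gt0.
  elim: {hN} N => // -[|N] ih _; first by exists 0%N.
  have [n /andP[h1 h2]] := ih isT.
  have [h3|h3] := ltnP N.+2 (n.+2 ^ 2); first by exists n; rewrite h3 (leq_trans h1).
  exists n.+1; rewrite h3 (leq_ltn_trans h2)// ltn_exp2r//.
have : ((maxn n0 n1).+2 ^ 2 < n.+2 ^ 2)%N by exact: leq_ltn_trans hN Nn.
rewrite ltn_exp2r// ltnS => hmn.
have n0n : (n0 <= n)%N by move: hmn; lia.
have n1n : (n1 <= n)%N by move: hmn; lia.
have -> : \sum_(k < N) Y k z = S (n.+1 ^ 2)%N z + \sum_(i < N - n.+1 ^ 2) Y (n.+1 ^ 2 + i)%N z.
  by rewrite -[in LHS](subnKC nN) big_split_ord.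
apply: le_trans (ler_normD _ _) _.
have h1 := hn0 n n0n.
have h2 : `|\sum_(i < N - n.+1 ^ 2) Y (n.+1 ^ 2 + i)%N z| <= (N - n.+1 ^ 2)%:R * B.
  apply: le_trans (ler_norm_sum _ _ _) _.
  have -> : (N - n.+1 ^ 2)%:R * B = \sum_(i < N - n.+1 ^ 2) B by rewrite sumr_const card_ord mulr_natl.
  exact: ler_sum.
(* The gap between the squares of n + 1 and n + 2 is 2 n + 3, at most 3 (n + 1). *)
have h3 : (N - n.+1 ^ 2)%:R * B <= 3 * n.+1%:R * B.
  rewrite ler_wpM2r// -natrM ler_nat leq_subLR.
  by apply: (leq_trans (ltnW Nn)); rewrite -!mulnn; lia.
have h4 : 3 * n.+1%:R * B <= e / 2 * (n.+1 ^ 2)%:R.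
  have : 3 * B / (e / 2) <= n.+1%:R by apply: le_trans hn1 _; rewrite ler_nat ltnW.
  rewrite ler_pdivrMr// natrX => h.
  have -> : 3 * n.+1%:R * B = n.+1%:R * (3 * B) by ring.
  rewrite expr2 mulrC; have -> : e / 2 * (n.+1%:R * n.+1%:R) = (n.+1%:R * (e / 2)) * n.+1%:R by ring.
  by rewrite ler_wpM2r.
have h5 : m.+1%:R^-1 * (n.+1 ^ 2)%:R <= e / 2 * (n.+1 ^ 2)%:R :> R by rewrite ler_wpM2r// ltW.
have h6 : e / 2 * (n.+1 ^ 2)%:R <= e / 2 * N%:R by rewrite ler_wpM2l ?ler_nat// ltW.
have h7 := le_trans (le_trans h1 h5) h6.
have h8 := le_trans (le_trans (le_trans h2 h3) h4) h6.
by apply: le_trans (lerD h7 h8) _; rewrite -mulrDl -splitr.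
Qed.

End LLN.

(** * Density of an irrational rotation and averaging over scales *)

Section Kronecker.
Context {R : realType}.
Variable alpha : R.
Hypothesis alpha0 : 0 < alpha.
Hypothesis irr : ~ exists r : rat, alpha = ratr r.

(** Pigeonhole: the fractional parts of [Q.+2] multiples of [alpha] fall into [Q.+1] boxes.
    Irrationality keeps the resulting difference away from 0. *)
Lemma dirichlet e : 0 < e -> exists k b : nat, 0 < `|k%:R * alpha - b%:R| < e.
Proof.
move=> e0; have [Q Qe] := exists_inv e0.
pose fr (i : nat) : R := i%:R * alpha - (Num.truncn (i%:R * alpha))%:R.
have fr01 i : 0 <= fr i < 1.
  have /truncn_itv/andP[h1 h2] : 0 <= i%:R * alpha by rewrite mulr_ge0// ltW.
  by rewrite /fr subr_ge0 h1 ltrBlDl natr1.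
pose f (i : 'I_Q.+2) : 'I_Q.+1 := inord (Num.truncn (Q.+1%:R * fr i)).
have fval i : (f i)%:R <= Q.+1%:R * fr i < (f i).+1%:R.
  have /andP[h0 h1] := fr01 i.
  have p0 : 0 <= Q.+1%:R * fr i by rewrite mulr_ge0.
  rewrite /f inordK ?truncn_itv// -(ltr_nat R).
  have /andP[h2 _] := truncn_itv p0; apply: (le_lt_trans h2).
  by rewrite -[ltRHS]mulr1 ltr_pM2l.
have /injectivePn[i [j ij fij]] : ~~ injectiveb f.
  apply/negP => /injectiveP /leq_card; by rewrite !card_ord ltnn.
wlog lij : i j ij fij / (i < j)%N.
  move=> H; have [lij|lji|/val_inj eij] := ltngtP i j; [exact: (H i j)| |by rewrite eij eqxx in ij].
  by apply: (H j i) => //; rewrite eq_sym.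
have close : `|fr j - fr i| < e.
  apply: lt_trans Qe; rewrite -(ltr_pM2l (ltr0Sn R Q)) divff ?pnatr_eq0//.
  rewrite -[X in X * `|_|](ger0_norm (ler0n R Q.+1)) -normrM mulrBr.
  have /andP[h1 h2] := fval i; have /andP[h3 h4] := fval j.
  rewrite fij in h1 h2; rewrite -natr1 in h2 h4.
  by rewrite ltr_norml; apply/andP; split; lra.
have ti : (Num.truncn (i%:R * alpha) <= Num.truncn (j%:R * alpha))%N.
  rewrite truncn_ge_nat ?mulr_ge0 ?(ltW alpha0)//.
  have /truncn_itv/andP[h1 _] : 0 <= i%:R * alpha by rewrite mulr_ge0// ltW.
  apply: le_trans h1 _; by rewrite ler_pM2r// ler_nat ltnW.
exists (j - i)%N, (Num.truncn (j%:R * alpha) - Num.truncn (i%:R * alpha))%N.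
have -> : (j - i)%:R * alpha - (Num.truncn (j%:R * alpha) - Num.truncn (i%:R * alpha))%:R
   = fr j - fr i :> R.
  by rewrite !natrB ?(ltnW lij)// /fr; ring.
rewrite close andbT normr_gt0; apply/eqP => h; apply: irr.
set x := Num.truncn (j%:R * alpha) in ti; set y := Num.truncn (i%:R * alpha) in ti.
exists ((x - y)%:R / (j - i)%:R).
have ji : (j - i)%:R != 0 :> R by rewrite pnatr_eq0 subn_eq0 -ltnNge.
rewrite fmorph_div/= !rmorph_nat; apply: (mulIf ji); rewrite divfK//.
by move: h; rewrite /fr -/x -/y !natrB ?(ltnW lij)//; lra.
Qed.

(** Multiples of a small step approximate [y]. Since [k] and [b] are natural numbers, a positive
    step starts from [y] raised by an integer, a negative one descends from a large multiple of
    [alpha]. *)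
Lemma kronecker y e : 0 < e -> exists k b : nat, `|k%:R * alpha - b%:R - y| < e.
Proof.
move=> e0; have [k0 [b0 /andP[]]] := dirichlet e0.
set h := k0%:R * alpha - b0%:R => h0 he.
have approx x : 0 <= x -> exists n : nat, `|n%:R * `|h| - x| < e.
  move=> x0; exists (Num.truncn (x / `|h|)).
  have /truncn_itv/andP[h1 h2] : 0 <= x / `|h| by rewrite divr_ge0.
  move: h1 h2; rewrite ler_pdivlMr// ltr_pdivrMr// -natr1 => h1 h2.
  by rewrite ltr_norml; apply/andP; split; lra.
have [hp|hn] := leP 0 h.
  have [b hb] := exists_nat_ge (- y).
  have [|n] := approx (y + b%:R); first lra.
  rewrite (ger0_norm hp) => hn; exists (n * k0)%N, (n * b0 + b)%N.
  move: hn; rewrite natrD !natrM /h.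
  by have -> : n%:R * (k0%:R * alpha - b0%:R) - (y + b%:R) =
    n%:R * k0%:R * alpha - (n%:R * b0%:R + b%:R) - y by ring.
have [k hk] := exists_nat_ge (y / alpha).
rewrite ler_pdivrMr// in hk.
have [|n] := approx (k%:R * alpha - y); first lra.
rewrite (ltr0_norm hn) => hn'; exists (n * k0 + k)%N, (n * b0)%N.
move: hn'; rewrite natrD !natrM /h -normrN.
by have -> : - (n%:R * - (k0%:R * alpha - b0%:R) - (k%:R * alpha - y)) =
   (n%:R * k0%:R + k%:R) * alpha - n%:R * b0%:R - y by ring.
Qed.

End Kronecker.

Lemma le_of_affine {R : realType} (x y : R) (N0 N1 : nat) :
  (forall N : nat, (N1 <= N)%N -> (N%:R - N0%:R) * x <= N%:R * y) -> x <= y.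
Proof.
move=> h; rewrite leNgt; apply/negP => yx; have xy : 0 < x - y by rewrite subr_gt0.
have [N hN] := exists_nat_ge ((N0%:R * x + 1) / (x - y)).
have {h} := h (maxn N1 N) (leq_maxl _ _).
have : (N0%:R * x + 1) / (x - y) <= (maxn N1 N)%:R.
  by apply: le_trans hN _; rewrite ler_nat leq_maxr.
rewrite ler_pdivrMr//; lra.
Qed.

(** * Irrational sampling of a quantity monotone along the dynamics *)

Section FlowBound.
Context {R : realType} {d : measure_display} {X : measurableType d}.
Variable P : probability X R.
Local Notation Ex := (Ex P).
Local Notation prb := (prb P).
Variables (T : X -> X) (alpha : R) (Psi : R -> X -> R) (c : R).
Hypothesis pT : preserving P T.
Hypothesis alpha0 : 0 < alpha.
Hypothesis dens : forall y e : R, 0 < e -> exists k b : nat, `|k%:R * alpha - b%:R - y| < e.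
Hypothesis bPsi : forall t, bmf (Psi t).
Hypothesis Psi01 : forall t z, 0 <= Psi t z <= 1.
Hypothesis ucPsi : forall e : R, 0 < e -> exists2 dl, 0 < dl & forall t t' z,
  0 <= t -> 0 <= t' -> `|t - t'| < dl -> `|Psi t z - Psi t' z| <= e.
Hypothesis monoPsi : forall t z, 0 <= t -> Psi t (T z) <= Psi (t + 1) z.
Hypothesis hc : forall e : R, 0 < e -> exists N1, forall N, (N1 <= N)%N ->
  \sum_(k < N) Ex (Psi (k%:R * alpha)) <= N%:R * (c + e).

Let E s l := [set z | io_avg (fun k => Psi (s + k%:R * alpha) z) l].

Let mE s l : measurable (E s l).
Proof. exact: (@measurable_io_avg _ _ _ (fun k => Psi (s + k%:R * alpha))). Qed.

Let piter k : preserving P (iter k T). Proof. exact: preserving_iter. Qed.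

Let ka0 (k : nat) : 0 <= k%:R * alpha. Proof. by rewrite mulr_ge0// ltW. Qed.

Let E_le s l l' : l' <= l -> E s l `<=` E s l'.
Proof. by move=> ll' z; exact: io_avg_lt. Qed.

Let E_iter b s l z : 0 <= s -> E s l (iter b T z) -> E (s + b%:R) l z.
Proof.
elim: b z => [|b ih] z s0 /=; first by rewrite addr0.
rewrite -iterS iterSr => /(ih _ s0); apply: io_avg_mono => k.
have -> : s + b.+1%:R + k%:R * alpha = (s + b%:R + k%:R * alpha) + 1 by rewrite -natr1; ring.
by apply: monoPsi; rewrite !addr_ge0.
Qed.

Let E_shift s l k : E (s + k%:R * alpha) l = E s l.
Proof.
have iff z : io_avg (fun i => Psi (s + k%:R * alpha + i%:R * alpha) z) l <->
             io_avg (fun i => Psi (s + i%:R * alpha) z) l.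
  have -> : (fun i : nat => Psi (s + k%:R * alpha + i%:R * alpha) z) =
      (fun i => (fun j : nat => Psi (s + j%:R * alpha) z) (k + i)%N).
    by apply/funext => i; rewrite natrD mulrDl addrA.
  apply: (@io_avg_shift _ _ _ 1) => i.
  by have /andP[h1 h2] := Psi01 (s + i%:R * alpha) z; rewrite ger0_norm.
by apply/seteqP; split => z /iff.
Qed.

Let E_close e : 0 < e -> exists2 dl, 0 < dl & forall s s' l,
  0 <= s -> 0 <= s' -> `|s - s'| < dl -> E s (l + e) `<=` E s' l.
Proof.
move=> /ucPsi[dl dl0 h]; exists dl => // s s' l s0 s'0 ss' z; apply: io_avg_le => k.
have := h (s + k%:R * alpha) (s' + k%:R * alpha) z.
rewrite !addr_ge0// => /(_ isT isT).
have -> : s + k%:R * alpha - (s' + k%:R * alpha) = s - s' by ring.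
by move=> /(_ ss'); rewrite ler_distl => /andP[].
Qed.

(** Choose [k] and [b] with k alpha - b close to s - s'. Pulling back by [iter b T] preserves
    measure and raises the phase to s + b, which is close to s' + k alpha; dropping the first [k]
    samples brings it to s'. *)
Let v_le s s' l e : 0 < e -> 0 <= s -> 0 <= s' -> prb (E s (l + e)) <= prb (E s' l).
Proof.
move=> e0 s0 s'0; have [dl dl0 hdl] := E_close e0.
have [k [b kb]] := dens (s - s') dl0.
rewrite -(prb_preimage (piter b))//.
apply: (@le_trans _ _ (prb (E (s + b%:R) (l + e)))).
  apply: prb_le => //; first by apply: preimage_measurable (piter b) _.
  by move=> z; exact: E_iter.
rewrite -(E_shift s' l k); apply: prb_le => //; apply: hdl; rewrite ?addr_ge0//.
by rewrite -normrN; have -> : - (s + b%:R - (s' + k%:R * alpha)) = k%:R * alpha - b%:R - (s - s') by ring.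
Qed.

(* By density of the times [k alpha - b] the limsup hardly depends on the starting phase;
   the sets [E 0 (lev i)] decrease with [i], so at some level two successive ones almost
   coincide, and tiling orbits at that level bounds their common measure. *)
Lemma flow_bound l : 0 < l -> l * prb (E 0 (3 * l)) <= c.
Proof.
move=> l0; apply/ler_addgt0Pr => e e0.
have den0 : 0 < 1 + 2 * l by rewrite addr_gt0// mulr_gt0.
(* The total error is [eta] from the mean and [l * (eta + eta)] from two exceptional sets, which is
   [e]. *)
pose eta := e / (1 + 2 * l).
have eta0 : 0 < eta by rewrite divr_gt0.
have [M Meta] := exists_inv eta0.
(* [M.+1] equal steps from 2 l to 3 l: the probabilities drop by at most 1 in all, so one step loses
   at most [eta]. *)
pose lev (i : nat) := 2 * l + i%:R * (l / M.+1%:R).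
have lM0 : 0 < l / M.+1%:R by rewrite divr_gt0.
have [i iM gap] : exists2 i, (i < M.+1)%N & prb (E 0 (lev i)) - prb (E 0 (lev i.+1)) <= eta.
  apply: contrapT => H.
  have H' (i : 'I_M.+1) : eta <= prb (E 0 (lev i)) - prb (E 0 (lev i.+1)).
    by rewrite leNgt; apply/negP => h; apply: H; exists i => //; exact: ltW.
  have : \sum_(i < M.+1) eta <= \sum_(i < M.+1) (prb (E 0 (lev i)) - prb (E 0 (lev i.+1))).
    exact: ler_sum.
  rewrite sumr_const card_ord -(big_mkord xpredT (fun i => prb (E 0 (lev i)) - prb (E 0 (lev i.+1)))).
  rewrite (eq_bigr (fun i => - prb (E 0 (lev i.+1)) - - prb (E 0 (lev i)))); last first.
    by move=> j _; ring.
  rewrite (telescope_sumr (fun i => - prb (E 0 (lev i))))//.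
  have h1 := prb_le1 P (mE 0 (lev 0)); have h2 := prb_ge0 P (E 0 (lev M.+1)).
  have : 1 < eta *+ M.+1.
    by rewrite -mulr_natr -ltr_pdivrMr// mul1r.
  lra.
set lam := lev i.
have lam2 : 2 * l <= lam by rewrite /lam /lev lerDl mulr_ge0// ltW.
have lam3 : lam <= 3 * l.
  rewrite /lam /lev (_ : 3 * l = 2 * l + l); last by ring.
  by rewrite lerD2l mulrCA -[leRHS]mulr1 ler_pM2l// ler_pdivrMr// mul1r ler_nat ltnW.
pose b k := Num.truncn (k%:R * alpha); pose s (k : nat) := k%:R * alpha - (b k)%:R.
have s01 k : 0 <= s k < 1.
  have /truncn_itv/andP[h1 h2] := ka0 k.
  by rewrite /s /b subr_ge0 h1 ltrBlDl natr1.
have s0 k : 0 <= s k by case/andP: (s01 k).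
have bs k : s k + (b k)%:R = k%:R * alpha by rewrite /s subrK.
(* [E_iter] puts [A k] inside [E 0 lam], while [v_le] bounds its measure below by that of the next
   level; the choice of [i] makes the two almost equal. *)
pose A k := iter (b k) T @^-1` E (s k) lam.
have mA k : measurable (A k) by exact: preimage_measurable (piter _) _.
have AE k : A k `<=` E 0 lam.
  by move=> z /(E_iter (s0 k)); rewrite bs -[k%:R * alpha]add0r E_shift.
have prbA k : prb (E 0 lam `\` A k) <= eta.
  rewrite prb_setD// prb_preimage//; apply: le_trans gap; rewrite lerD2l lerN2.
  have -> : lev i.+1 = lam + l / M.+1%:R by rewrite /lam /lev -[i.+1%:R]natr1; ring.
  exact: v_le.
(* One half of [l] is lost in rounding the phase, another in moving the tile back to [z]; at least l
   is left of lam, since lam is at least 2 l. *)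
have l20 : 0 < l / 2 by rewrite divr_gt0.
have [dl1 dl10 hdl1] := E_close l20.
have [dl2 dl20 hdl2] := ucPsi l20.
(* A grid of phases leaves finitely many cases, hence one bound [N0] on the tile lengths for all
   [k]. *)
have [Q Qdl] : exists Q : nat, Q.+1%:R^-1 < Num.min dl1 dl2.
  by apply: exists_inv; rewrite lt_min dl10.
move: Qdl; rewrite lt_min => /andP[Qdl1 Qdl2].
pose g (j : nat) (k : nat) := Psi (j%:R / Q.+1%:R + k%:R * alpha).
have j0 (j : nat) : 0 <= j%:R / Q.+1%:R :> R by rewrite divr_ge0.
pose Bad j N := E (j%:R / Q.+1%:R) (lam - l / 2) `&`
    [set z | forall n, (0 < n <= N)%N -> \sum_(k < n) g j k z < n%:R * (lam - l / 2)].
have /choice[Nf hNf] : forall j, exists N, (0 < N)%N /\ prb (Bad j N) < eta.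
  move=> j; have lam0 : 0 <= lam - l / 2 by lra.
  have [N Np h] := @tileless_small _ _ _ P (g j) (lam - l / 2) (E (j%:R / Q.+1%:R) (lam - l / 2))
    eta (fun k => bPsi _) (mE _ _) (fun z => io_avg_tile lam0) eta0.
  by exists N.
pose N0 := (\max_(j < Q.+2) Nf j).+1.
have NfN0 (j : 'I_Q.+2) : (Nf j <= N0)%N by rewrite /N0 ltnW// ltnS (leq_bigmax j).
have mBad j N : (0 < N)%N -> measurable (Bad j N).
  move=> Np; apply: measurableI => //; apply: (@measurable_tileless _ _ _ (g j)) => // k.
  exact: bPsi.
have prbBad (j : 'I_Q.+2) : prb (Bad j N0) <= eta.
  apply: ltW; apply: le_lt_trans (hNf j).2; apply: prb_le.
  - exact: mBad.
  - by apply: mBad; exact: (hNf j).1.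
  - move=> z [Ez h]; split => // n /andP[n0 nN]; apply: h.
    by rewrite n0 (leq_trans nN).
pose jj k : 'I_Q.+2 := inord (Num.truncn (Q.+1%:R * s k)).
have jclose k : `|s k - (jj k)%:R / Q.+1%:R| <= Q.+1%:R^-1.
  have /andP[h1 h2] := s01 k.
  have p0 : 0 <= Q.+1%:R * s k by rewrite mulr_ge0.
  have /andP[h3 h4] := truncn_itv p0.
  have -> : nat_of_ord (jj k) = Num.truncn (Q.+1%:R * s k).
    rewrite inordK// -(ltr_nat R); apply: (le_lt_trans h3).
    by apply: (@lt_trans _ _ Q.+1%:R); rewrite ?ltr_nat// -[ltRHS]mulr1 ltr_pM2l.
  rewrite -(ler_pM2l (ltr0Sn R Q)) divff ?pnatr_eq0//.
  rewrite -[X in X * `|_|](ger0_norm (ler0n R Q.+1)) -normrM mulrBr mulrCA divff ?pnatr_eq0// mulr1.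
  rewrite -[(Num.truncn _).+1%:R]natr1 in h4.
  by rewrite ler_norml; apply/andP; split; lra.
pose B k := (E 0 lam `\` A k) `|` iter (b k) T @^-1` Bad (jj k) N0.
have N00 : (0 < N0)%N by [].
have mB' k : measurable (iter (b k) T @^-1` Bad (jj k) N0).
  by apply: preimage_measurable (piter _) _; exact: mBad.
have mEA k : measurable (E 0 lam `\` A k) by exact: measurableD.
have tile N : (N%:R - N0%:R) * l * prb (E 0 lam) <=
    \sum_(k < N) Ex (Psi (k%:R * alpha)) + N%:R * (l * (eta + eta)).
  apply: (@tiling_bound _ _ _ P (fun k => Psi (k%:R * alpha)) (E 0 lam) B) => //.
  - exact: ltW.
  - by move=> k z; case/andP: (Psi01 (k%:R * alpha) z).
  - by move=> k; exact: measurableU.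
  - move=> k; apply: le_trans (prbU_le P (mEA k) (mB' k)) _.
    rewrite lerD// prb_preimage//; exact: mBad.
  - move=> k z Ez nB.
    have Az : A k z by apply: contrapT => nA; apply: nB; left; split.
    have nBad : ~ Bad (jj k) N0 (iter (b k) T z) by move=> h; apply: nB; right.
    have Ej : E ((jj k)%:R / Q.+1%:R) (lam - l / 2) (iter (b k) T z).
      apply: (hdl1 (s k)) => //; last by rewrite subrK.
      exact: le_lt_trans (jclose k) Qdl1.
    have /existsNP[n /not_implyP[nN /negP]] : ~ forall n, (0 < n <= N0)%N ->
        \sum_(i < n) g (jj k) i (iter (b k) T z) < n%:R * (lam - l / 2).
      by move=> h; apply: nBad; split.
    rewrite -leNgt => hn; exists n => //.
    have : \sum_(i < n) g (jj k) i (iter (b k) T z) <=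
        \sum_(i < n) Psi ((k + i)%:R * alpha) z + n%:R * (l / 2).
      apply: (@sum_le_shift _ (fun i => g (jj k) i (iter (b k) T z))
        (fun i => Psi ((k + i)%:R * alpha) z)) => r.
      have h1 : Psi (s k + r%:R * alpha) (iter (b k) T z) <= Psi ((k + r)%:R * alpha) z.
        have -> : (k + r)%:R * alpha = s k + r%:R * alpha + (b k)%:R.
          by rewrite natrD mulrDl -bs; ring.
        have : 0 <= s k + r%:R * alpha by rewrite addr_ge0.
        move: (s k + r%:R * alpha) (b k) z {Ez nB Az nBad Ej hn} => t m.
        elim: m t => [|m ih] t z t0 /=; first by rewrite addr0.
        rewrite -iterS iterSr; apply: le_trans (ih _ _ t0) _.
        by rewrite -natr1 addrA; apply: monoPsi; rewrite addr_ge0.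
      have h2 : `|g (jj k) r (iter (b k) T z) - Psi (s k + r%:R * alpha) (iter (b k) T z)| <= l / 2.
        apply: hdl2.
        - by rewrite addr_ge0// j0.
        - by rewrite addr_ge0.
        - have -> : (jj k)%:R / Q.+1%:R + r%:R * alpha - (s k + r%:R * alpha) =
            - (s k - (jj k)%:R / Q.+1%:R) by ring.
          by rewrite normrN; exact: le_lt_trans (jclose k) Qdl2.
      by move: h2; rewrite ler_distl => /andP[]; lra.
    have : n%:R * l <= n%:R * (lam - l / 2 - l / 2).
      by rewrite ler_wpM2l//; lra.
    rewrite !mulrBr; move: hn; rewrite mulrBr; lra.
have [N1 hN1] := hc eta0.
apply: (@le_trans _ _ (l * prb (E 0 lam))).
  by rewrite ler_wpM2l ?(ltW l0)//; apply: prb_le => //; exact: E_le.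
have -> : e = eta + l * (eta + eta).
  have : e = eta * (1 + 2 * l) by rewrite /eta divfK// gt_eqF.
  by move=> ->; ring.
apply: (@le_of_affine _ _ _ N0 N1) => N N1N; rewrite mulrA.
apply: le_trans (tile N) _; have := hN1 N N1N; lra.
Qed.

End FlowBound.

(** * Entropy of a finite-valued stationary process *)

Section Entropy.
Context {R : realType} {d : measure_display} {X : measurableType d}.
Variable P : probability X R.
Local Notation Ex := (Ex P).
Local Notation prb := (prb P).

Definition info (F : eqType) (U : X -> F) (z : X) : R := - ln (prb (atom U z)).
Definition entropy (F : eqType) (U : X -> F) : R := Ex (info U).

Lemma bmf_info (F : finType) (U : X -> F) : mlab U -> bmf (info U).
Proof.
by move=> mU; apply: bmf_labm mU _ => z z' e; rewrite /info /atom e.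
Qed.

Lemma atom_eq (F G : eqType) (U : X -> F) (V : X -> G) :
  refines U V -> refines V U -> atom U = atom V.
Proof.
by move=> UV VU; apply/funext => z; apply/seteqP; split => z'; [exact: UV | exact: VU].
Qed.

Lemma entropy_eq (F G : eqType) (U : X -> F) (V : X -> G) :
  refines U V -> refines V U -> entropy U = entropy V.
Proof. by move=> UV VU; rewrite /entropy /info (atom_eq UV VU). Qed.

Lemma entropy_refines (F G : finType) (U : X -> F) (V : X -> G) :
  mlab U -> mlab V -> refines V U -> entropy U <= entropy V.
Proof.
move=> mU mV VU; apply: Ex_le_ae; [exact: bmf_info..|].
apply: filterS (atom_pos_ae P mV) => z p0; rewrite lerN2 ler_ln ?posrE//.
  by apply: prb_le; [exact: measurable_atom..|exact: refines_atom].
apply: lt_le_trans p0 _.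
by apply: prb_le; [exact: measurable_atom..|exact: refines_atom].
Qed.

Lemma info_preserving (F : finType) (U : X -> F) S z : preserving P S -> mlab U ->
  info (U \o S) z = info U (S z).
Proof.
move=> pS mU; rewrite /info; congr (- ln _).
have -> : atom (U \o S) z = S @^-1` atom U (S z) by [].
by rewrite prb_preimage//; exact: measurable_atom.
Qed.

Lemma entropy_preserving (F : finType) (U : X -> F) S : preserving P S -> mlab U ->
  entropy (U \o S) = entropy U.
Proof.
move=> pS mU; rewrite /entropy -(Ex_preserving pS (bmf_info mU)).
by congr Ex; apply/funext => z; rewrite info_preserving.
Qed.

Lemma marginal (F G : finType) (U : X -> F) (W : X -> G) w : mlab U -> mlab W ->
  \sum_u prb ((fun z => (U z, W z)) @^-1` [set (u, w)]) = prb (W @^-1` [set w]).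
Proof.
move=> mU mW; have mUW := mlab_pair mU mW.
rewrite -[RHS]Ex_indic//.
transitivity (Ex (fun z => \sum_u \1_((fun z => (U z, W z)) @^-1` [set (u, w)]) z)).
  rewrite Ex_sum => [|u]; last by apply: bmf_indic; exact: mUW.
  by apply: eq_bigr => u _; rewrite Ex_indic//; exact: mUW.
congr Ex; apply/funext => z; rewrite [RHS]indicE.
case: (boolP (z \in _)) => [|]; rewrite ?inE /= => Wz.
  rewrite (bigD1 (U z))//= big1 ?addr0; first by rewrite indicE mem_set//= Wz.
  by move=> u /eqP uU; rewrite indicE memNset//= => -[/esym].
rewrite big1// => u _; rewrite indicE memNset//= => -[_ e].
by move: Wz; rewrite notin_setE/= e.
Qed.

Lemma ln_le_sub1 (x : R) : 0 < x -> ln x <= x - 1.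
Proof.
move=> x0; have := @le_ln1Dx R (x - 1); rewrite (addrC 1) subrK; apply.
by rewrite ltrBrDl subrr.
Qed.

(** Nonnegativity of the mutual information of [U] and [V] given [W]: the likelihood ratio of
    conditional independence has mean at most 1, and ln x is at most x - 1. *)
Lemma submodular (F G K : finType) (U : X -> F) (V : X -> G) (W : X -> K) :
  mlab U -> mlab V -> mlab W ->
  entropy (fun z => ((U z, V z), W z)) + entropy W <=
  entropy (fun z => (U z, W z)) + entropy (fun z => (V z, W z)).
Proof.
move=> mU mV mW.
have mUW := mlab_pair mU mW; have mVW := mlab_pair mV mW.
have mUVW := mlab_pair (mlab_pair mU mV) mW.
pose uw := (fun z => (U z, W z)); pose vw := (fun z => (V z, W z)).
pose uvw := (fun z => ((U z, V z), W z)).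
pose p (Y : eqType) (L : X -> Y) z := prb (atom L z).
pose ratio z := (p _ uw z * p _ vw z) / (p _ uvw z * p _ W z).
have bratio : bmf ratio.
  apply: (bmf_labm (U := uvw)) => // z z' [e1 e2 e3].
  by rewrite /ratio /p /atom /uw /vw /uvw e1 e2 e3.
have Er : Ex ratio <= 1.
  pose q (Y : finType) (L : X -> Y) a := prb (L @^-1` [set a]).
  have -> : Ex ratio = \sum_a (q _ uw (a.1.1, a.2) * q _ vw (a.1.2, a.2) /
      (q _ uvw a * q _ W a.2)) * q _ uvw a.
    by rewrite -(Ex_labE P (fun a => q _ uw (a.1.1, a.2) * q _ vw (a.1.2, a.2) /
      (q _ uvw a * q _ W a.2)) mUVW).
  apply: (@le_trans _ _ (\sum_a q _ uw (a.1.1, a.2) * q _ vw (a.1.2, a.2) / q _ W a.2)).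
    apply: ler_sum => -[[u v] w] _ /=.
    have [->|q0] := eqVneq (q _ uvw (u, v, w)) 0.
      by rewrite mulr0 mulr_ge0 ?invr_ge0 ?mulr_ge0// prb_ge0.
    by rewrite invfM [_^-1 * _^-1]mulrC mulrA divfK.
  rewrite -(pair_bigA _ (fun a w => q _ uw (a.1, w) * q _ vw (a.2, w) / q _ W w))/=.
  rewrite exchange_big/=.
  apply: (@le_trans _ _ (\sum_w q _ W w)); last first.
    rewrite -(eq_bigr _ (fun w _ => mul1r (q _ W w))) -(Ex_labE P (fun=> 1) mW).
    by rewrite Ex_cst.
  apply: ler_sum => w _.
  rewrite -(pair_bigA _ (fun u v => q _ uw (u, w) * q _ vw (v, w) / q _ W w))/=.
  under eq_bigr do rewrite -mulr_suml -mulr_sumr (marginal _ mV mW).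
  rewrite -!mulr_suml (marginal _ mU mW) -/(q _ W w).
  have [->|q0] := eqVneq (q _ W w) 0; first by rewrite invr0 mulr0.
  by rewrite mulfK.
have : Ex (fun z => (info uw z + info vw z) - (info uvw z + info W z)) >= Ex (fun z => 1 - ratio z).
  have [b1 b2 b3 b4] : [/\ bmf (info uw), bmf (info vw), bmf (info uvw) & bmf (info W)].
    by split; exact: bmf_info.
  apply: Ex_le_ae; [by apply: bmfB => //; exact: bmf_cst|by apply: bmfB; exact: bmfD|].
  apply: filterS (atom_pos_ae P mUVW) => z p0.
  have pos (Y : finType) (L : X -> Y) : mlab L -> refines uvw L -> 0 < p _ L z.
    move=> mL rL; apply: lt_le_trans p0 _.
    by apply: prb_le; [exact: measurable_atom..|exact: refines_atom].
  have p1 : 0 < p _ uw z by apply: pos => // ? ? -[e1 e2 e3]; rewrite /uw e1 e3.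
  have p2 : 0 < p _ vw z by apply: pos => // ? ? -[e1 e2 e3]; rewrite /vw e2 e3.
  have p3 : 0 < p _ W z by apply: pos => // ? ? -[e1 e2 e3].
  have r0 : 0 < ratio z by rewrite divr_gt0 ?mulr_gt0.
  have := ln_le_sub1 r0.
  rewrite /ratio ln_div ?posrE ?mulr_gt0// !lnM ?posrE// /info -/(p _ uw z) -/(p _ vw z)
    -/(p _ uvw z) -/(p _ W z).
  rewrite -/(ratio z); lra.
have [b1 b2 b3 b4] : [/\ bmf (info uw), bmf (info vw), bmf (info uvw) & bmf (info W)].
  by split; exact: bmf_info.
have [bs bt] := (bmfD b1 b2, bmfD b3 b4); have bc := @bmf_cst R _ X 1.
rewrite (ExB P bs bt) (ExB P bc bratio) (ExD P b1 b2) (ExD P b3 b4) Ex_cst.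
rewrite /entropy -/uw -/vw -/uvw; lra.
Qed.

Variable T : X -> X.
Hypothesis pT : preserving P T.

Section Words.
Context {D : finType}.
Variable dg : X -> D.
Hypothesis mdg : mlab dg.

Definition wd n z : n.-tuple D := [tuple dg (iter i T z) | i < n].

Lemma wdP n z z' : wd n z = wd n z' <-> forall i, (i < n)%N -> dg (iter i T z) = dg (iter i T z').
Proof.
split=> [e i ni|h]; last by apply: eq_from_tnth => i; rewrite !tnth_mktuple; exact: h.
by have := congr1 (fun t => tnth t (Ordinal ni)) e; rewrite !tnth_mktuple.
Qed.

Lemma mlab_wd n : mlab (wd n).
Proof.
move=> t; rewrite (_ : _ @^-1` _ = \bigcap_i
    (if insub i is Some j then (dg \o iter i T) @^-1` [set tnth t j] else setT)).
  apply: bigcapT_measurable => i; case: insub => // j; rewrite comp_preimage.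
  exact: preimage_measurable (preserving_iter i pT) _.
apply/seteqP; split => z /=.
  by move=> <- i _; case: insubP => // j _ <- /=; rewrite tnth_mktuple.
move=> h; apply: eq_from_tnth => i; rewrite tnth_mktuple.
by have := h i I; rewrite valK.
Qed.

Lemma wd_refines m n : (m <= n)%N -> refines (wd n) (wd m).
Proof. by move=> mn z z' /wdP h; apply/wdP => i im; apply: h; exact: leq_trans mn. Qed.

Lemma wd_cat m n z z' : wd (m + n) z = wd (m + n) z' <->
  wd m z = wd m z' /\ wd n (iter m T z) = wd n (iter m T z').
Proof.
split=> [/wdP h|[/wdP h1 /wdP h2]].
  split; apply/wdP => i ni; first by apply: h; exact: ltn_addr.
  by rewrite -!iterD addnC; apply: h; rewrite ltn_add2l.
apply/wdP => i imn; have [im|mi] := ltnP i m; first exact: h1.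
by have := h2 (i - m)%N; rewrite ltn_subLR// imn -!iterD subnK//; exact.
Qed.

Lemma wd1 z z' : wd 1 z = wd 1 z' <-> dg z = dg z'.
Proof.
split=> [/wdP/(_ 0%N isT)//|e]; apply/wdP => -[|//] _; exact: e.
Qed.

Definition wH n := entropy (wd n).

Lemma wH_le m n : (m <= n)%N -> wH m <= wH n.
Proof. by move=> mn; apply: entropy_refines; [exact: mlab_wd..|exact: wd_refines]. Qed.

Lemma wH0 : wH 0 = 0.
Proof.
rewrite /wH /entropy -[RHS](Ex_cst P); congr Ex; apply/funext => z.
rewrite /info (_ : atom _ _ = setT) ?prb_setT ?ln1 ?oppr0//.
by apply/seteqP; split => // z' _; apply/wdP.
Qed.

(** [submodular] for the first and the last letter of a word of length [n.+2], given the [n] letters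
    between them. *)
Lemma wH_concave n : wH n.+2 - wH n.+1 <= wH n.+1 - wH n.
Proof.
have m1 : mlab (dg \o iter n.+1 T) by apply: mlab_comp => //; case: (preserving_iter n.+1 pT).
have m2 : mlab (wd n \o T) by apply: mlab_comp; [case: pT|exact: mlab_wd].
have := submodular mdg m1 m2.
have -> : entropy (fun z => (dg z, (dg \o iter n.+1 T) z, (wd n \o T) z)) = wH n.+2.
  apply: entropy_eq => z z'.
    move=> /pair_equal_spec[/pair_equal_spec[e1 e2] e3]; apply/(@wd_cat 1 n.+1); split; first exact/wd1.
    rewrite -[n.+1]addn1; apply/(@wd_cat n 1); split; first exact: e3.
    by apply/wd1; move: e2; rewrite /= -!iterSr.
  move=> /(@wd_cat 1 n.+1)[/wd1 -> ]; rewrite -[n.+1]addn1 => /(@wd_cat n 1)[/= -> /wd1].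
  by rewrite -!iterSr /= addn1 => ->.
have -> : entropy (wd n \o T) = wH n by rewrite entropy_preserving//; exact: mlab_wd.
have -> : entropy (fun z => (dg z, (wd n \o T) z)) = wH n.+1.
  apply: entropy_eq => z z'; first by move=> /pair_equal_spec[e1 e2]; apply/(@wd_cat 1 n); split; [exact/wd1|].
  by move=> /(@wd_cat 1 n)[/wd1 -> /= ->].
have -> : entropy (fun z => ((dg \o iter n.+1 T) z, (wd n \o T) z)) = wH n.+1.
  rewrite -[RHS](entropy_preserving pT (mlab_wd (n := n.+1))).
  apply: entropy_eq => z z'; rewrite -[n.+1]addn1 /=.
    move=> /pair_equal_spec[e1 e2]; apply/(@wd_cat n 1); split=> //; apply/wd1.
    by move: e1; rewrite addn1 -!iterSr.
  by move=> /(@wd_cat n 1)[-> /wd1]; rewrite -!iterSr addn1 /= => ->.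
lra.
Qed.

Let dH n := wH n.+1 - wH n.

Let dH_le m n : (m <= n)%N -> dH n <= dH m.
Proof.
move=> /subnK <-; elim: (n - m)%N => // k ih; apply: le_trans ih; exact: wH_concave.
Qed.

(** The increments decrease by [wH_concave], so this infimum is their limit: the entropy rate of the
    process. *)
Definition erate : R := inf [set dH n | n in setT].

Let dH_ge0 n : 0 <= dH n. Proof. by rewrite subr_ge0; exact: wH_le. Qed.

Let hasinf : has_inf [set dH n | n in setT].
Proof. by split; [exists (dH 0), 0%N | exists 0 => _ [n _ <-]]. Qed.

Lemma erate_ge0 : 0 <= erate.
Proof. by apply: lb_le_inf; [case: hasinf|move=> _ [n _ <-]]. Qed.

Lemma erate_le n : erate <= wH n.+1 - wH n.
Proof. by apply: ge_inf; [case: hasinf|exists n]. Qed.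

Lemma erate_lim e : 0 < e -> exists n0, forall n, (n0 <= n)%N -> wH n.+1 - wH n <= erate + e.
Proof.
move=> e0; have [_ [n0 _ <-] h] := inf_adherent e0 hasinf.
by exists n0 => n n0n; apply: le_trans (ltW h); exact: dH_le.
Qed.

Lemma wH_lower m n : n%:R * erate <= wH (m + n) - wH m.
Proof.
elim: n => [|n ih]; first by rewrite mul0r addn0 subrr.
have := erate_le (m + n); rewrite addnS -natr1; lra.
Qed.

Lemma wH_upper e : 0 < e -> exists2 C, 0 <= C & forall n, wH n <= C + n%:R * (erate + e).
Proof.
move=> e0; have [n0 h0] := erate_lim e0.
have ee : 0 <= erate + e by rewrite addr_ge0 ?erate_ge0// ltW.
have w0 : 0 <= wH n0 by rewrite -wH0 wH_le.
exists (wH n0) => // n; have [nn0|n0n] := leqP n n0.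
  by apply: le_trans (wH_le nn0) _; rewrite lerDl mulr_ge0.
have : wH n <= wH n0 + (n - n0)%:R * (erate + e).
  rewrite -{1}(subnK (ltnW n0n)); elim: (n - n0)%N => [|k ih]; first by rewrite mul0r addr0.
  have := h0 (k + n0)%N (leq_addl _ _); rewrite addSn -natr1; lra.
move=> /le_trans; apply; rewrite lerD2l ler_wpM2r// ler_nat leq_subr.
exact.
Qed.

End Words.
End Entropy.

(** * Markov weights of words *)

Section Weights.
Context {R : realType} {d : measure_display} {X : measurableType d}.
Variable P : probability X R.
Local Notation Ex := (Ex P).
Local Notation prb := (prb P).
Variable T : X -> X.
Hypothesis pT : preserving P T.
Context {D : finType}.
Variable dg : X -> D.
Hypothesis mdg : mlab dg.

(** Indexed by plain sequences, so that the recursion in [markov] can use [take] and [behead]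
    without tracking lengths. *)
Definition cyl (s : seq D) : set X :=
  [set z | [seq dg (iter i T z) | i <- iota 0 (size s)] = s].

Lemma seq_wd n z : [seq dg (iter i T z) | i <- iota 0 n] = wd T dg n z.
Proof. by rewrite /= -val_enum_ord -map_comp. Qed.

Lemma cyl_wd n (v : n.-tuple D) : cyl v = wd T dg n @^-1` [set v].
Proof.
apply/seteqP; split => z; rewrite /cyl /= size_tuple; first by rewrite seq_wd => e; exact: val_inj.
by move=> <-; rewrite seq_wd.
Qed.

Lemma measurable_cyl s : measurable (cyl s).
Proof. by have := cyl_wd (in_tuple s); rewrite /= => ->; exact: (mlab_wd pT mdg). Qed.

Lemma cyl_cons a s : cyl (a :: s) = dg @^-1` [set a] `&` T @^-1` cyl s.
Proof.
apply/seteqP; split => z; rewrite /cyl /=.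
  move=> [-> e]; split=> //; rewrite -[RHS]e -[in RHS]add1n iotaDl -map_comp.
  by apply: eq_map => i; rewrite /= -iterSr.
move=> [-> e]; rewrite -[in RHS]e -[1%N]addn0 iotaDl -map_comp; congr cons.
by apply: eq_map => i; rewrite /= -iterSr.
Qed.

Lemma sum_cyl_cons s : \sum_a prb (cyl (a :: s)) = prb (cyl s).
Proof.
have mT := preimage_measurable pT (measurable_cyl s).
rewrite -(prb_preimage pT (measurable_cyl s)) -Ex_indic//.
transitivity (Ex (fun z => \sum_a \1_(cyl (a :: s)) z)).
  rewrite Ex_sum => [|a]; last by apply: bmf_indic; exact: measurable_cyl.
  by apply: eq_bigr => a _; rewrite Ex_indic//; exact: measurable_cyl.
congr Ex; apply/funext => z.
under eq_bigr do rewrite cyl_cons indicI /=.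
rewrite -mulr_suml -[RHS]mul1r; congr (_ * _).
by rewrite [RHS](lab_indicE dg (fun=> 1) z); apply: eq_bigr => a _; rewrite mul1r.
Qed.

Lemma sum_tuple_cons n (F : seq D -> R) :
  \sum_(v : n.+1.-tuple D) F v = \sum_(a : D) \sum_(v : n.-tuple D) F (a :: v).
Proof.
rewrite pair_bigA/= (reindex (fun av : D * n.-tuple D => [tuple of av.1 :: av.2]))//=.
exists (fun v => (thead v, [tuple of behead v])) => [[a v] _|v _] /=.
  by congr (_, _); exact: val_inj.
by rewrite [RHS]tuple_eta; exact: val_inj.
Qed.

Lemma sum_cyl n : \sum_(v : n.-tuple D) prb (cyl v) = 1.
Proof.
elim: n => [|n ih].
  rewrite (big_pred1 [tuple]) => [|v]; last by rewrite [v]tuple0; apply/esym/eqP.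
  by rewrite (_ : cyl _ = setT) ?prb_setT//; apply/seteqP; split.
rewrite (sum_tuple_cons _ (fun s => prb (cyl s))) exchange_big/= -[RHS]ih.
by apply: eq_bigr => v _; rewrite sum_cyl_cons.
Qed.

Variable W0 : nat.

(* The Markov chain of order [W0] read backwards in time: a letter is drawn
   conditionally on the [W0] letters that follow it. *)
Fixpoint markov k (s : seq D) : R := if k is k'.+1 then
  prb (cyl (take W0.+1 s)) / prb (cyl (take W0 (behead s))) * markov k' (behead s)
  else prb (cyl s).

Lemma markov_ge0 k s : 0 <= markov k s.
Proof.
elim: k s => [|k ih] s /=; first exact: prb_ge0.
by rewrite mulr_ge0// divr_ge0// prb_ge0.
Qed.

(** Summed over the first letter, the transition factors give 1, or 0 when the context is null;
    hence an inequality only. *)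
Lemma sum_markov k n : \sum_(v : (n + k).-tuple D) markov k v <= 1.
Proof.
elim: k => [|k ih].
  by rewrite /= addn0 sum_cyl.
rewrite addnS (sum_tuple_cons _ (markov k.+1)) exchange_big/=; apply: le_trans ih.
apply: ler_sum => v _; rewrite -mulr_suml ler_piMl ?markov_ge0//.
rewrite -mulr_suml sum_cyl_cons.
have [->|h] := eqVneq (prb (cyl (take W0 v))) 0; first by rewrite mul0r.
by rewrite divff.
Qed.

(** A substitute for the true probability of a word: its negative logarithm is a Birkhoff sum up to
    one boundary term, so [birkhoff] gives the upper half of the Shannon-McMillan-Breiman theorem.
    For words no longer than [W0] it is the cylinder probability itself. *)
Definition q n (s : seq D) : R := markov (n - W0) s.

Lemma q_ge0 n s : 0 <= q n s. Proof. exact: markov_ge0. Qed.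

Lemma sum_q n : \sum_(v : n.-tuple D) q n v <= 1.
Proof.
rewrite /q; have [nW|Wn] := leqP n W0.
  by rewrite (eqP (_ : n - W0 == 0)%N) ?subn_eq0// sum_cyl.
have := sum_markov (n - W0) W0; rewrite subnKC//; exact: ltnW.
Qed.

Lemma q_le1 n (v : n.-tuple D) : q n v <= 1.
Proof.
apply: le_trans (sum_q n); rewrite (bigD1 v)//= lerDl sumr_ge0// => *; exact: q_ge0.
Qed.

Let wdi := info P (wd T dg W0).
Let step z := info P (wd T dg W0.+1) z - info P (wd T dg W0) (T z).

Lemma all_atoms_pos : {ae P, forall z, forall n k, 0 < prb (atom (wd T dg n) (iter k T z))}.
Proof.
apply: ae_foralln => n; apply: ae_foralln => k.
apply: (ae_preserving (Q := fun z => 0 < prb (atom (wd T dg n) z)) (preserving_iter k pT)).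
exact: (atom_pos_ae P (mlab_wd pT mdg (n := n))).
Qed.

Lemma atom_cyl n z : atom (wd T dg n) z = cyl (wd T dg n z).
Proof. by rewrite cyl_wd. Qed.

Lemma wd_take m n z : (m <= n)%N -> take m (wd T dg n z) = wd T dg m z.
Proof. by move=> mn; rewrite -!seq_wd -map_take take_iota (minn_idPl mn). Qed.

Lemma wd_behead n z : behead (wd T dg n.+1 z) = wd T dg n (T z).
Proof.
rewrite -!seq_wd /= -[1%N]addn0 iotaDl -map_comp.
by apply: eq_map => i; rewrite /= -iterSr.
Qed.

(** Logarithms turn the product of transition factors into a sum of [step] along the orbit; the
    terminal word of length [W0] contributes the boundary term. *)
Lemma markov_ln z : (forall n k, 0 < prb (atom (wd T dg n) (iter k T z))) -> forall k,
  0 < markov k (wd T dg (W0 + k) z) /\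
  - ln (markov k (wd T dg (W0 + k) z)) = wdi (iter k T z) + \sum_(t < k) step (iter t T z).
Proof.
move=> + k; elim: k z => [|k ih] z hz.
  rewrite /= addn0 big_ord0 addr0 -atom_cyl; split; first exact: (hz W0 0%N).
  by [].
have [p1 p2] := ih (T z) (fun n j => eq_rect _ (fun x => 0 < prb (atom _ x)) (hz n j.+1) _ (iterSr _ _ _)).
rewrite /= addnS wd_behead wd_take ?ltnS ?leq_addr// wd_take ?leq_addr//.
rewrite -!atom_cyl.
have h1 : 0 < prb (atom (wd T dg W0.+1) z) := hz W0.+1 0%N.
have h2 : 0 < prb (atom (wd T dg W0) (T z)) := hz W0 1%N.
split; first by rewrite mulr_gt0// divr_gt0.
rewrite lnM ?posrE ?divr_gt0// ln_div ?posrE// big_ord_recl /=.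
rewrite opprD p2 -iterSr iterS; rewrite (eq_bigr (fun t : 'I_k => step (iter (bump 0 t) T z))).
  by rewrite /step /info /wdi /info; lra.
by move=> t _; rewrite -iterSr.
Qed.

Hypothesis ergT : forall A, measurable A -> T @^-1` A = A -> prb A = 0 \/ prb A = 1.

Let bmf_wdi n : bmf (info P (wd T dg n)).
Proof. exact: (bmf_info P (mlab_wd pT mdg (n := n))). Qed.

Let bmf_wdiT n : bmf (info P (wd T dg n) \o T).
Proof. by apply: bmf_comp => //; case: pT. Qed.

Lemma bmf_step : bmf step.
Proof. exact: (bmfB (bmf_wdi W0.+1) (bmf_wdiT W0)). Qed.

Lemma Ex_step : Ex step = wH P T dg W0.+1 - wH P T dg W0.
Proof.
rewrite (ExB P (bmf_wdi W0.+1) (bmf_wdiT W0)).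
by rewrite (Ex_preserving pT (bmf_wdi W0)).
Qed.

Lemma q_pos : {ae P, forall z, forall n, 0 < q n (wd T dg n z)}.
Proof.
apply: filterS all_atoms_pos => z hz n; rewrite /q; have [nW|Wn] := leqP n W0.
  rewrite (eqP (_ : n - W0 == 0)%N) ?subn_eq0//= -atom_cyl; exact: (hz n 0%N).
by have [+ _] := markov_ln hz (n - W0); rewrite subnKC// ltnW.
Qed.

(** Linear growth with a uniform constant controls the mean on the small set where [q_eventually]
    has not yet taken effect. *)
Lemma q_bound : exists2 B, 0 <= B & {ae P, forall z, forall n, (W0 <= n)%N ->
  - ln (q n (wd T dg n z)) <= B * n.+1%:R}.
Proof.
have bi : bmf wdi by exact: bmf_wdi.
have [M1 M10 h1] := bmf_bound bi; have [M2 M20 h2] := bmf_bound bmf_step.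
exists (M1 + M2); first by rewrite addr_ge0// ltW.
apply: filterS all_atoms_pos => z hz n Wn; rewrite /q.
have [_ e] := markov_ln hz (n - W0); rewrite subnKC// in e; rewrite e.
have a1 : wdi (iter (n - W0) T z) <= M1 by apply: le_trans (ler_norm _) _.
have a2 : \sum_(t < n - W0) step (iter t T z) <= n%:R * M2.
  apply: (@le_trans _ _ (\sum_(t < n - W0) M2)).
    by apply: ler_sum => t _; apply: le_trans (ler_norm _) _.
  rewrite sumr_const card_ord -[_ *+ _]mulr_natl ler_wpM2r ?ler_nat ?leq_subr//; exact: ltW.
have n0 : 0 <= n%:R * M1 by rewrite mulr_ge0// ltW.
by rewrite -natr1; lra.
Qed.

Lemma q_eventually e : 0 < e -> {ae P, forall z, exists n0, forall n, (n0 <= n)%N ->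
  - ln (q n (wd T dg n z)) <= n%:R * (wH P T dg W0.+1 - wH P T dg W0 + e)}.
Proof.
move=> e0.
have bi : bmf wdi by exact: bmf_wdi.
have [M1 M10 h1] := bmf_bound bi.
have d0 : 0 <= wH P T dg W0.+1 - wH P T dg W0 by rewrite subr_ge0; exact: wH_le.
have := birkhoff pT ergT bmf_step; rewrite Ex_step; move: d0; set dl := _ - _ => d0.
apply: filterS2 all_atoms_pos => z hz hb.
have e20 : 0 < e / 2 by rewrite divr_gt0.
have [n0 hn0] := hb _ e20.
have [n1 hn1] := exists_nat_ge (M1 / (e / 2)).
exists (n0 + n1 + W0)%N => n hn; rewrite /q.
have Wn : (W0 <= n)%N by lia.
have [_ er] := markov_ln hz (n - W0); rewrite subnKC// in er; rewrite er.
have a1 : wdi (iter (n - W0) T z) <= M1 by apply: le_trans (ler_norm _) _.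
have /hn0 : (n0 <= n - W0)%N by lia.
rewrite big_split/= sumr_const card_ord -[_ *+ (n - W0)]mulr_natl ler_norml => /andP[_ a2].
have a3 : M1 <= e / 2 * n%:R.
  rewrite mulrC -ler_pdivrMr//; apply: le_trans hn1 _; rewrite ler_nat; lia.
have a4 : (n - W0)%:R * (dl + e / 2) <= n%:R * (dl + e / 2).
  by rewrite ler_wpM2r ?ler_nat ?leq_subr// addr_ge0// ltW.
lra.
Qed.

End Weights.

(** * Unpredictability of a process of positive entropy *)

(** The closing inequality of [unpredictable]: [w] is a conditional entropy, [l] is ln e, [x] the
    mean excess, [y] the mean likelihood ratio and [p] the probability of the predictable points. *)
Lemma prediction_arith {R : realType} (n h dl C w l x y p : R) :
  n * (h - dl) - C <= w ->
  w <= - l + n * (h + dl) + (- (n * (h + dl)) * p + (x + y)) ->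
  x <= dl * n -> y <= 1 -> 0 <= n * (dl * p) ->
  n * (h * p) <= C + 1 - l + 3 * dl * n.
Proof. lra. Qed.

Section Prediction.
Context {R : realType} {d : measure_display} {X : measurableType d}.
Variable P : probability X R.
Local Notation Ex := (Ex P).
Local Notation prb := (prb P).
Variable T : X -> X.
Hypothesis pT : preserving P T.
Hypothesis ergT : forall A, measurable A -> T @^-1` A = A -> prb A = 0 \/ prb A = 1.
Context {D D' : finType}.
Variables (dz : X -> D) (dx : X -> D').
Hypothesis mdz : mlab dz.
Hypothesis mdx : mlab dx.
Hypothesis dzx : refines dz dx.

Let wz := wd T dz.
Let wx := wd T dx.
Let mwz n : mlab (wz n). Proof. exact: (mlab_wd pT mdz). Qed.
Let mwx n : mlab (wx n). Proof. exact: (mlab_wd pT mdx). Qed.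
Let piter k : preserving P (iter k T). Proof. exact: preserving_iter. Qed.

Let mwxi i n : mlab (wx n \o iter i T).
Proof. exact: (mlab_comp (piter i).1 (@mwx n)). Qed.

Definition joint i n z := (wd T dz i z, wd T dx n (iter i T z)).

Lemma mlab_joint i n : mlab (joint i n).
Proof. exact: (mlab_pair (@mwz i) (@mwxi i n)). Qed.

Lemma wzx_refines n : refines (wz n) (wx n).
Proof. by move=> z z' /wdP h; apply/wdP => i ni; apply: dzx; exact: h. Qed.

(** [submodular] for the past of [dz] and its next block, given the next block of [dx]. The rate of
    [dz] appears on both sides and cancels; [C] does not depend on the length [i] of the past. *)
Lemma joint_entropy e : 0 < e -> exists2 C, 0 <= C & forall i n,
  n%:R * (erate P T dx - e) - C <= entropy P (joint i n) - wH P T dz i.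
Proof.
move=> e0; have [C C0 hC] := wH_upper pT mdz e0; exists C => // i n.
have := submodular P (@mwz i) (mlab_comp (piter i).1 (@mwz n)) (@mwxi i n).
have -> : entropy P (fun z => (wz i z, (wz n \o iter i T) z, (wx n \o iter i T) z)) = wH P T dz (i + n).
  apply: entropy_eq => z z'.
    by move=> /pair_equal_spec[/pair_equal_spec[e1 e2] _]; apply/wd_cat.
  by move=> /wd_cat[e1 e2] /=; rewrite (wzx_refines e2) /wz e1 e2.
have -> : entropy P (wx n \o iter i T) = wH P T dx n by rewrite entropy_preserving.
have -> : entropy P (fun z => ((wz n \o iter i T) z, (wx n \o iter i T) z)) = wH P T dz n.
  rewrite -[RHS](entropy_preserving (piter i) (@mwz n)).
  apply: entropy_eq => z z' /=; first by move=> /pair_equal_spec[].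
  by move=> e1; rewrite e1 (wzx_refines e1).
have -> : entropy P (fun z => (wz i z, (wx n \o iter i T) z)) = entropy P (joint i n) by [].
have h1 := wH_lower pT mdz i n.
have h2 := hC n.
have h3 := wH_lower pT mdx 0 n; rewrite add0n (wH0 P) in h3.
move: h1 h2 h3; move: (wH P T dz (i + n)) (wH P T dz i) (wH P T dz n) (wH P T dx n) (entropy P (joint i n)).
move: (erate P T dz) (erate P T dx) => *; lra.
Qed.

(** The conditional probability of the coming [dx] block of length [n] given the first [i] letters
    of [dz]. *)
Definition predict i n z := prb (atom (joint i n) z) / prb (atom (wd T dz i) z).

Lemma bmf_predict i n : bmf (predict i n).
Proof.
apply: (bmf_labm (@mlab_joint i n)) => z z' /pair_equal_spec[e1 e2].
by rewrite /predict /atom /joint e1 e2.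
Qed.

Lemma predict_ae i n : {ae P, forall z, [/\ 0 < predict i n z, predict i n z <= 1 &
  - ln (predict i n z) = info P (joint i n) z - info P (wd T dz i) z]}.
Proof.
apply: filterS (atom_pos_ae P (@mlab_joint i n)) => z p0.
have le : prb (atom (joint i n) z) <= prb (atom (wd T dz i) z).
  apply: prb_le; [apply: measurable_atom; exact: mlab_joint|exact: measurable_atom|].
  by apply: refines_atom => y y' /pair_equal_spec[].
have p1 := lt_le_trans p0 le.
rewrite /predict; split; [exact: divr_gt0|by rewrite ler_pdivrMr// mul1r|].
by rewrite ln_div ?posrE// /info; lra.
Qed.

(** Integrating a likelihood ratio against the true law leaves the total mass of [q] on blocks,
    averaged over pasts. *)
Lemma Ex_q_pred W0 i n :
  Ex (fun z => q P T dx W0 n (wd T dx n (iter i T z)) / predict i n z) <= 1.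
Proof.
have mJ := @mlab_joint i n.
pose pj a := prb (joint i n @^-1` [set a]).
pose pz w := prb (wd T dz i @^-1` [set w]).
have -> : Ex (fun z => q P T dx W0 n (wd T dx n (iter i T z)) / predict i n z) =
   Ex (fun z => (fun a : i.-tuple D * n.-tuple D' => q P T dx W0 n a.2 / (pj a / pz a.1)) (joint i n z)) by [].
rewrite (Ex_labE P (fun a : i.-tuple D * n.-tuple D' => q P T dx W0 n a.2 / (pj a / pz a.1)) mJ).
apply: (@le_trans _ _ (\sum_(a : i.-tuple D * n.-tuple D') pz a.1 * q P T dx W0 n a.2)).
  apply: ler_sum => a _; rewrite -/(pj a).
  have [->|p0] := eqVneq (pj a) 0; first by rewrite mulr0 mulr_ge0 ?prb_ge0 ?q_ge0.
  by rewrite invf_div mulrA divfK// mulrC.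
rewrite -(pair_bigA _ (fun w v => pz w * q P T dx W0 n (v : n.-tuple D')))/=.
under eq_bigr do rewrite -mulr_sumr.
apply: (@le_trans _ _ (\sum_w pz w)).
  by apply: ler_sum => w _; rewrite ler_piMr ?prb_ge0// sum_q.
rewrite -(eq_bigr _ (fun w _ => mul1r (pz w))) -(Ex_labE P (fun=> 1) (@mwz i)).
by rewrite Ex_cst.
Qed.

(* Conditioning on the past of the larger process [dz] leaves the full entropy of [dx] in
   the next block; typical blocks of [dx] carry no more than that, so it is spread evenly. *)
Lemma unpredictable : 0 < erate P T dx -> forall e, 0 < e ->
  exists n, forall i, prb [set z | e <= predict i n z] <= e.
Proof.
move=> h0 e e0.
set h := erate P T dx in h0 *.
wlog e1 : e e0 / e <= 1.
  move=> H; have [e1|e1] := leP e 1; first exact: H.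
  have [n hn] := H 1 ltr01 (lexx 1); exists n => i.
  apply: le_trans (prb_le1 P _) (ltW e1); apply: measurable_ge; exact: bmf_predict.
(* Then [3 * dl * n] is half of [n * e * h]; the other half is kept for the constant [K]. *)
pose dl := e * h / 6.
have dl0 : 0 < dl by rewrite divr_gt0// mulr_gt0.
have [W0 hW0] := erate_lim pT mdx (divr_gt0 dl0 (ltr0n R 2)).
have {}hW0 := hW0 W0 (leqnn _); rewrite -/h in hW0.
pose L n z := - ln (q P T dx W0 n (wx n z)).
have L0 n z : 0 <= L n z by rewrite oppr_ge0 ln_le0// q_le1.
have bL n : bmf (L n).
  by apply: (bmf_labm (@mwx n)) => z z' e2; rewrite /L e2.
pose G n z := Num.max (L n z - n%:R * (h + dl)) 0.
have bG n : bmf (G n).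
  by apply: bmf_max; [apply: bmfB => //; exact: bmf_cst|exact: bmf_cst].
(* The excess is positive only on [S n1], a set of small probability by [q_eventually], and there it
   is at most [B * n.+1%:R]. *)
have [n1 hG] : exists n1, forall n, (n1 <= n)%N -> Ex (G n) <= dl * n%:R.
  have [B B0 hB] := q_bound pT mdx W0.
  pose S n := [set z | exists2 m, (n <= m)%N & m%:R * (h + dl) < L m z].
  have mS n : measurable (S n).
    rewrite (_ : S n = \bigcup_(m in [set m | (n <= m)%N]) ~` [set z | 0 <= m%:R * (h + dl) - L m z]).
      apply: bigcup_measurable => m _; apply: measurableC; apply: measurable_ge.
      by apply: bmfB => //; exact: bmf_cst.
    apply/seteqP; split => z [m nm /=].
      by move=> hm; exists m => //=; rewrite subr_ge0; apply/negP; rewrite -ltNge.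
    by rewrite subr_ge0 => /negP; rewrite -ltNge => hm; exists m.
  pose S' := \bigcap_n S n.
  have S'0 : prb S' = 0.
    apply: prb_ae0; first exact: bigcapT_measurable.
    have := q_eventually pT mdx W0 ergT (divr_gt0 dl0 (ltr0n R 2)).
    apply: filterS => z [n0 hn0] hS; have [m nm hm] := hS n0 I.
    have := hn0 m nm; rewrite -/(wx m z) -/(L m z).
    have : m%:R * (wH P T dx W0.+1 - wH P T dx W0 + dl / 2) <= m%:R * (h + dl).
      by rewrite ler_wpM2l//; lra.
    lra.
  have eta0 : 0 < dl / (B * 2 + 1) by rewrite divr_gt0// ltr_wpDl// mulr_ge0.
  have [n1 hn1] : exists n1, prb (S n1) < dl / (B * 2 + 1).
    have mS' : measurable S' by exact: bigcapT_measurable.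
    have mD n : measurable (S n `\` S') by exact: measurableD.
    have dD n : S n.+1 `\` S' `<=` S n `\` S'.
      move=> z [[m nm hm] nS]; split=> //; exists m => //; exact: ltnW.
    have eD : \bigcap_n (S n `\` S') = set0.
      apply/seteqP; split => // z h1; have [_ nS] := h1 0%N I.
      by apply: nS => m _; case: (h1 m I).
    have [n1 hn1] := prb_cvg0 P mD dD eD eta0; exists n1; apply: le_lt_trans hn1.
    apply: (@le_trans _ _ (prb ((S n1 `\` S') `|` S'))).
      apply: prb_le => //; first exact: measurableU.
      by move=> z hz; have [zS|zS] := pselect (S' z); [right|left].
    by apply: le_trans (prbU_le P (mD n1) mS') _; rewrite S'0 addr0.
  exists (n1 + W0 + 1)%N => n hn.
  apply: (@le_trans _ _ (Ex (fun z => (B * n.+1%:R) * \1_(S n1) z))).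
    apply: Ex_le_ae => //; first by apply: bmfZ; exact: bmf_indic.
    apply: filterS hB => z hz; rewrite /G ge_max; apply/andP; split; last first.
      by rewrite !mulr_ge0// indicE.
    rewrite indicE; case: (boolP (z \in S n1)) => [_|]; last first.
      rewrite notin_setE => nS; rewrite mulr0 subr_le0 leNgt; apply/negP => hh.
      by apply: nS; exists n => //; apply: leq_trans hn; rewrite -addnA leq_addr.
    rewrite mulr1; apply: le_trans (hz n _); last by apply: leq_trans hn; rewrite addnAC leq_addl.
    by rewrite -/(L n z) gerBl mulr_ge0// addr_ge0 ?(ltW h0) ?(ltW dl0).
  rewrite ExZ ?Ex_indic//; last exact: bmf_indic.
  have h3 : B * n.+1%:R * prb (S n1) <= B * n.+1%:R * (dl / (B * 2 + 1)).
    by rewrite ler_wpM2l ?mulr_ge0// ltW.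
  apply: le_trans h3 _.
  have n10 : n.+1%:R <= 2 * n%:R :> R by rewrite -natrM ler_nat; lia.
  rewrite mulrA ler_pdivrMr; last by rewrite ltr_wpDl// mulr_ge0.
  have : B * n.+1%:R <= B * (2 * n%:R) by rewrite ler_wpM2l.
  have n0 : 0 <= n%:R :> R by [].
  move: n0 dl0; move: (n%:R : R) => x x0 dl0 h4.
  have h5 : B * n.+1%:R * dl <= B * (2 * x) * dl by rewrite ler_wpM2r// ltW.
  have : 0 <= dl * x by rewrite mulr_ge0// ltW.
  lra.
have [C C0 hC] := joint_entropy dl0.
pose K := C + 1 - ln e.
have [n2 hn2] := exists_nat_ge (K / (e * h / 2)).
exists (n1 + n2 + 1)%N => i; set n := (n1 + n2 + 1)%N.
have np : 0 < n%:R :> R by rewrite ltr0n /n addn1.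
have Kn : K <= n%:R * (e * h / 2).
  rewrite -ler_pdivrMr ?divr_gt0 ?mulr_gt0//; apply: le_trans hn2 _.
  by rewrite ler_nat /n; lia.
pose A := [set z | e <= predict i n z].
have mA : measurable A by apply: measurable_ge; exact: bmf_predict.
pose rat z := q P T dx W0 n (wd T dx n (iter i T z)) / predict i n z.
have brat : bmf rat.
  apply: (bmf_labm (@mlab_joint i n)) => z z' /pair_equal_spec[e2 e3].
  by rewrite /rat /predict /atom /joint e2 e3.
have bGi : bmf (G n \o iter i T) by apply: bmf_comp => //; case: (piter i).
have bA : bmf (\1_A : X -> R) by exact: bmf_indic.
have bJ : bmf (info P (joint i n)) by apply: bmf_info; exact: mlab_joint.
have bI : bmf (info P (wd T dz i)) by exact: bmf_info.
(* A pointwise majorant of [- ln (predict i n z)]: on [A] this is at most [- ln e] and the indicator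
   cancels [n%:R * (h + dl)]; off [A] it is the information of the block under [q] plus ln of [rat],
   and ln rat is at most rat - 1. *)
pose rhs z := (- ln e + n%:R * (h + dl)) + (- (n%:R * (h + dl)) * \1_A z + ((G n \o iter i T) z + rat z)).
have brhs : bmf rhs.
  by apply: bmfD; [exact: bmf_cst|apply: bmfD; [exact: bmfZ|exact: bmfD]].
have : Ex (fun z => info P (joint i n) z - info P (wd T dz i) z) <= Ex rhs.
  apply: Ex_le_ae => //; first exact: bmfB.
  apply: filterS2 (predict_ae i n) (ae_preserving (Q := fun z => forall n, 0 < q P T dx W0 n (wd T dx n z)) (piter i) (q_pos pT mdx W0)) => z [r0 r1 <-] /(_ n) q0.
  have rat0 : 0 < rat z by rewrite /rat divr_gt0.
  have lne : 0 <= - ln e by rewrite oppr_ge0 ln_le0.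
  rewrite /rhs indicE; case: (boolP (z \in A)) => [|]; rewrite ?notin_setE ?inE /A /= => zA.
    have : - ln (predict i n z) <= - ln e by rewrite lerN2 ler_ln ?posrE.
    have : 0 <= G n (iter i T z) by rewrite le_max lexx orbT.
    lra.
  have h1 : - ln (predict i n z) <= L n (iter i T z) + rat z - 1.
    have := ln_le_sub1 rat0.
    rewrite {1}/rat ln_div ?posrE// -/(wx n _) /L; lra.
  have h2 : L n (iter i T z) - n%:R * (h + dl) <= G n (iter i T z) by rewrite le_max lexx.
  lra.
rewrite (ExB P bJ bI) -/(entropy P (joint i n)) -/(wH P T dz i).
rewrite (ExD P (@bmf_cst _ _ _ _)); last by apply: bmfD; [exact: bmfZ|exact: bmfD].
rewrite (ExD P (bmfZ _ bA)); last exact: bmfD.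
rewrite (ExD P bGi brat) Ex_cst ExZ// Ex_indic// (Ex_preserving (piter i) (bG n)).
have h1 := hC i n; rewrite -/h in h1.
have h2 : Ex (G n) <= dl * n%:R by apply: hG; rewrite /n -addnA leq_addr.
have h3 := Ex_q_pred W0 i n; rewrite -/rat in h3.
move=> h4.
have pA := prb_ge0 P A.
have h5 : n%:R * (h * prb A) <= K + 3 * dl * n%:R.
  have h6 : 0 <= n%:R * (dl * prb A) by rewrite !mulr_ge0// ltW.
  exact: (prediction_arith h1 h4 h2 h3 h6).
have h7 : 3 * dl * n%:R = n%:R * (e * h / 2) by rewrite /dl; lra.
have : n%:R * (h * prb A) <= n%:R * (h * e).
  apply: le_trans h5 _; rewrite h7; apply: le_trans (lerD Kn (lexx _)) _.
  by rewrite -mulrDr ler_wpM2l//; lra.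
by rewrite ler_pM2l// ler_pM2l.
Qed.

End Prediction.

(** * Digit expansions *)

Lemma nat_adjacent a b : (a < b.+2)%N -> (b < a.+2)%N -> [\/ b = a, b = a.+1 | b.+1 = a].
Proof.
move=> ab ba; have [lt|gt|->] := ltngtP a b; last by constructor 1.
  by constructor 2; lia.
by constructor 3; lia.
Qed.

Section Digits.
Context {R : realType}.
Variable p : nat.
Hypothesis hp : (2 <= p)%N.
Local Notation Tp := (Tq p : R -> R).

Let p0 : (0 < p)%N. Proof. exact: leq_trans hp. Qed.
Let pR0 : 0 < p%:R :> R. Proof. by rewrite ltr0n. Qed.
(** ['I_p.-1.+1] has [p] elements as [p] is positive, and has the successor form that [inord]
    requires. *)
Definition dig (x : R) : 'I_p.-1.+1 := inord (Num.truncn (p%:R * x)).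

Lemma Tq01 x : 0 <= Tp x < 1.
Proof.
have /andP[h1 h2] := floor_itv (p%:R * x); rewrite intrD in h2.
by rewrite /Tq subr_ge0 h1 ltrBlDl.
Qed.

Lemma truncn_lt_exp n (x : R) : 0 <= x < 1 -> (Num.truncn (p%:R ^+ n * x) < p ^ n)%N.
Proof.
move=> /andP[x0 x1]; have pn : 0 < p%:R ^+ n :> R by rewrite exprn_gt0.
have h0 : 0 <= p%:R ^+ n * x by rewrite mulr_ge0// ltW.
have /andP[h1 _] := truncn_itv h0.
rewrite -(ltr_nat R) natrX; apply: le_lt_trans h1 _.
by rewrite -[ltRHS]mulr1 ltr_pM2l.
Qed.

Lemma dig_spec x : 0 <= x < 1 -> p%:R * x = (dig x)%:R + Tp x.
Proof.
move=> x01; have /andP[x0 x1] := x01.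
have h0 : 0 <= p%:R * x by rewrite mulr_ge0// ltW.
have := truncn_lt_exp 1 x01; rewrite expr1 expn1 => ht.
rewrite /dig inordK ?prednK// /Tq.
have /andP[h1 h2] := truncn_itv h0.
rewrite (@floor_def _ _ (Num.truncn (p%:R * x))); first by rewrite pmulrn; ring.
by rewrite intrD -!pmulrn natr1 h1.
Qed.

Lemma iterTq01 (x : R) k : 0 <= x < 1 -> 0 <= iter k Tp x < 1.
Proof. by case: k => //= k _; exact: Tq01. Qed.

Lemma word_diff (x x' : R) i : 0 <= x < 1 -> 0 <= x' < 1 ->
  (forall k, (k < i)%N -> dig (iter k Tp x) = dig (iter k Tp x')) ->
  p%:R ^+ i * (x - x') = iter i Tp x - iter i Tp x'.
Proof.
move=> hx hx'; elim: i => [|i ih] h; first by rewrite expr0 mul1r.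
rewrite exprS -mulrA ih => [|k ki]; last by apply: h; exact: ltnW.
rewrite mulrBr !dig_spec ?iterTq01// (h i (leqnn _)) /=; ring.
Qed.

Lemma word_close (x x' : R) i : 0 <= x < 1 -> 0 <= x' < 1 ->
  (forall k, (k < i)%N -> dig (iter k Tp x) = dig (iter k Tp x')) ->
  `|x - x'| <= (p%:R ^+ i)^-1.
Proof.
move=> hx hx' h; have := word_diff hx hx' h.
have pn : 0 < p%:R ^+ i :> R by rewrite exprn_gt0.
move=> e; rewrite -(ler_pM2l pn) divff ?gt_eqF//.
rewrite -[X in X * _](gtr0_norm pn) -normrM e.
have /andP[h1 h2] := iterTq01 i hx; have /andP[h3 h4] := iterTq01 i hx'.
by rewrite ler_norml; apply/andP; split; lra.
Qed.

(** The index of the [p]-adic cell of generation [n] containing [x]: it records the first [n] digits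
    and, unlike them, makes neighbouring cells comparable. *)
Definition numer n (x : R) := Num.truncn (p%:R ^+ n * x).

Lemma numerS n (x : R) : 0 <= x < 1 -> numer n.+1 x = (p ^ n * dig x + numer n (Tp x))%N.
Proof.
move=> x01; have /andP[T0 T1] := Tq01 x.
have pn : 0 < p%:R ^+ n :> R by rewrite exprn_gt0.
have h0 : 0 <= p%:R ^+ n * Tp x by rewrite mulr_ge0// ltW.
have /andP[h1 h2] := truncn_itv h0.
rewrite /numer; apply: truncn_def; rewrite exprS -mulrA mulrCA (dig_spec x01) (mulrDr _ (dig x)%:R).
by rewrite -addnS !natrD !natrM !natrX lerD2l ltrD2l h1.
Qed.

Lemma numer_word n (x x' : R) : 0 <= x < 1 -> 0 <= x' < 1 -> numer n x = numer n x' ->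
  forall k, (k < n)%N -> dig (iter k Tp x) = dig (iter k Tp x').
Proof.
elim: n x x' => // n ih x x' hx hx'; rewrite !numerS// => e.
have pn : (0 < p ^ n)%N by rewrite expn_gt0 p0.
have := congr1 (divn^~ (p ^ n)%N) e.
rewrite !(addnC (p ^ n * _)%N) !(mulnC (p ^ n)%N) !divnDMl// !divn_small ?add0n; last 2 first.
- exact: truncn_lt_exp (Tq01 _).
- exact: truncn_lt_exp (Tq01 _).
move=> /val_inj ed [_|k]; first exact: ed.
rewrite ltnS => kn; rewrite !iterSr; apply: ih => //; try exact: Tq01.
by apply/eqP; rewrite -(eqn_add2l (p ^ n * dig x)%N) {2}ed e.
Qed.

Lemma numer_adjacent n (x x' : R) : 0 <= x -> 0 <= x' -> `|x - x'| < (p%:R ^+ n)^-1 ->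
  [\/ numer n x' = numer n x, numer n x' = (numer n x).+1 | (numer n x').+1 = numer n x].
Proof.
move=> x0 x'0; have pn : 0 < p%:R ^+ n :> R by rewrite exprn_gt0.
rewrite -(ltr_pM2l pn) divff ?gt_eqF// -[X in X * _ < _](gtr0_norm pn) -normrM mulrBr.
have h0 : 0 <= p%:R ^+ n * x by rewrite mulr_ge0// ltW.
have h0' : 0 <= p%:R ^+ n * x' by rewrite mulr_ge0// ltW.
have /andP[h1 h2] := truncn_itv h0; have /andP[h3 h4] := truncn_itv h0'.
rewrite ltr_norml -/(numer n x) -/(numer n x') in h1 h2 h3 h4 * => /andP[h5 h6].
have l1 : (numer n x < (numer n x').+2)%N.
  by rewrite -(ltr_nat R) -natr1; lra.
have l2 : (numer n x' < (numer n x).+2)%N.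
  by rewrite -(ltr_nat R) -natr1; lra.
by apply: nat_adjacent.
Qed.

Lemma measurable_Tq q : measurable_fun [set: R] (Tq q : R -> R).
Proof.
rewrite /Tq; apply: measurable_funB; first exact: measurable_funM.
apply: nondecreasing_measurable => // x y xy; rewrite ler_int le_floor//.
by rewrite ler_wpM2l.
Qed.

Lemma mlab_dig {d} {X : measurableType d} (f : X -> R) : measurable_fun setT f ->
  mlab (dig \o f).
Proof.
move=> mf a; rewrite comp_preimage -[X in measurable X]setTI; apply: mf => //.
rewrite (_ : _ @^-1` _ = \bigcup_(n in [set n | inord n = a])
  ((fun x => (numer 1 x)%:R) @^-1` [set n%:R : R])).
  apply: bigcup_measurable => n _; rewrite -[X in measurable X]setTI.
  suff : measurable_fun setT (fun x : R => (numer 1 x)%:R : R) by apply => //; exact: measurable_set1.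
  apply: nondecreasing_measurable => // x y xy; rewrite ler_nat.
  by rewrite /numer le_truncn// ler_wpM2l.
apply/seteqP; split => x /=; first by move=> e; exists (numer 1 x) => //=; rewrite -e /numer expr1.
by move=> [n /= <- /eqP]; rewrite eqr_nat /numer expr1 => /eqP <-.
Qed.

End Digits.

(** * Hausdorff dimension *)

Section HausdorffLemmas.
Context {R : realType} {V : normedModType R}.
Implicit Types (U A B : set V) (s c delta : R).

Lemma diam_le U c : (forall x y, U x -> U y -> `|x - y| <= c) -> (diam U <= c%:E)%E.
Proof.
by move=> h; apply: ge_ereal_sup => _ [[x y] [/= Ux Uy] <-]; rewrite lee_fin; exact: h.
Qed.

Lemma diam_ge0 U : U !=set0 -> (0 <= diam U)%E.
Proof.
move=> [x Ux]; apply: ereal_sup_ubound; exists (x, x) => //=.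
by rewrite subrr normr0.
Qed.

Lemma hcost_ge0 s U : (0 <= hcost s U)%E.
Proof. by rewrite /hcost; case: pselect => //= _; rewrite lee_fin powR_ge0. Qed.

Lemma hcost_le s U c : 0 <= c -> 0 <= s ->
  (forall x y, U x -> U y -> `|x - y| <= c) -> (hcost s U <= (c `^ s)%:E)%E.
Proof.
move=> c0 s0 h; rewrite /hcost; case: pselect => [?|nU] /=.
  by rewrite lee_fin powR_ge0.
have U0 : U !=set0 by apply/set0P/eqP.
have d0 := diam_ge0 U0; have dc := diam_le h.
have df : diam U \is a fin_num by rewrite ge0_fin_numE// (le_lt_trans dc)// ltry.
rewrite lee_fin; apply: ge0_ler_powR => //; rewrite ?nnegrE//; first exact: fine_ge0.
by rewrite -lee_fin fineK.
Qed.

Lemma hausdorff_delta_ge0 s delta A : (0 <= hausdorff_delta s delta A)%E.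
Proof.
apply: le_ereal_inf_tmp => _ [F _ <-]; apply: nneseries_ge0 => *; exact: hcost_ge0.
Qed.

Lemma hausdorff_measure_ge0 s A : (0 <= hausdorff_measure s A)%E.
Proof.
apply: le_trans (hausdorff_delta_ge0 s 1 A) _.
by apply: ereal_sup_ubound; exists 1 => //=.
Qed.

Lemma hausdorff_delta_double s delta B (G : nat -> nat -> set V) :
  B `<=` \bigcup_i \bigcup_j G i j -> (forall i j, (diam (G i j) <= delta%:E)%E) ->
  (hausdorff_delta s delta B <= \sum_(0 <= i <oo) \sum_(0 <= j <oo) hcost s (G i j))%E.
Proof.
move=> BG dG; have [f fb] : exists f : nat -> nat * nat, set_bij setT setT f.
  by apply/card_set_bijP; rewrite card_eq_sym; exact: card_nat2.
apply: (@le_trans _ _ (\sum_(0 <= n <oo) hcost s (G (f n).1 (f n).2))%E).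
  apply: ereal_inf_lbound; exists (fun n => G (f n).1 (f n).2) => //=; split => //.
  move=> z /BG[i _ [j _ Gz]]; have [_ _ fs] := fb; have [n _ fn] := fs (i, j) I.
  by exists n => //; rewrite fn.
rewrite nneseries_esumT => [|n]; last exact: hcost_ge0.
rewrite -(@reindex_esum _ _ _ setT setT f (fun ij => hcost s (G ij.1 ij.2)) fb).
rewrite nneseries_esumT => [|i]; last by apply: nneseries_ge0 => *; exact: hcost_ge0.
rewrite (_ : (fun i => (\sum_(0 <= j <oo) hcost s (G i j))%E) =
    (fun i => \esum_(j in [set: nat]) hcost s (G i j))%E); last first.
  by apply/funext => i; rewrite nneseries_esumT// => j; exact: hcost_ge0.
rewrite esum_esum => [|i j _ _]; last exact: hcost_ge0.
by rewrite (_ : [set: nat] `*`` _ = setT)//; apply/seteqP; split.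
Qed.

End HausdorffLemmas.

Lemma nneseries_finite_le {R : realType} (f : nat -> \bar R) (M : nat) (c : R) : 0 <= c ->
  (forall j, (0 <= f j)%E) -> (forall j, (f j <= c%:E)%E) ->
  (forall j, (M <= j)%N -> f j = 0%E) -> (\sum_(0 <= j <oo) f j <= (M%:R * c)%:E)%E.
Proof.
move=> c0 f0 fc fM; apply: lime_le; first exact: is_cvg_nneseries.
apply: nearW => n.
have h : (\sum_(0 <= j < n) f j <= ((minn n M)%:R * c)%:E)%E.
  elim: n => [|n ih]; first by rewrite big_geq// min0n mul0r.
  rewrite big_nat_recr//=; have [nM|Mn] := ltnP n M.
    rewrite (minn_idPl nM) -natr1 mulrDl mul1r EFinD; apply: leeD => //.
    by move: ih; rewrite (minn_idPl (ltnW nM)).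
  by rewrite fM// adde0 (minn_idPr (leqW Mn)); move: ih; rewrite (minn_idPr Mn).
by apply: le_trans h _; rewrite lee_fin ler_wpM2r// ler_nat geq_minr.
Qed.

Lemma powR_le1 {R : realType} (x e : R) : 0 <= x -> x <= 1 -> 0 <= e -> x `^ e <= 1.
Proof.
by move=> x0 x1 e0; rewrite [leRHS](_ : 1 = 1 `^ e); last (by rewrite powR1); apply: ge0_ler_powR; rewrite ?nnegrE.
Qed.

(** * Lifting null sets through a projection with few pieces at each scale *)

Section LiftDimension.
Context {R : realType}.
Variables (pi : R * R -> R) (A : set R^o) (B : set (R * R)) (s e K C rho0 : R).
Hypotheses (s0 : 0 <= s) (e0 : 0 < e) (K0 : 0 < K) (C0 : 0 < C) (r0 : 0 < rho0).
Hypothesis BA : B `<=` pi @^-1` A.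
Hypothesis HA : @hausdorff_measure R R^o s A = 0%E.
Hypothesis cover : forall rho : R, 0 < rho -> rho < rho0 -> exists (M : nat) (G : nat -> set (R * R)),
  [/\ forall z, B z -> exists2 j, (j < M)%N & G j z, M%:R <= C * rho `^ (- e) &
  forall j z z', G j z -> G j z' -> `|pi z - pi z'| <= rho -> `|z - z'| <= K * rho].

(** The part of [B] over a covering set of diameter d splits into at most C d^(-e) pieces of
    diameter at most K d, of total cost of order d^(s + e) in dimension s + 2 e. One [e] pays for
    the number of pieces; the other leaves a positive power of the scale even if s = 0. *)
Lemma lift_dimension : hausdorff_measure (s + 2 * e) B = 0%E.
Proof.
have se0 : 0 <= s + 2 * e by rewrite addr_ge0// mulr_ge0// ltW.
apply/eqP; rewrite eq_le hausdorff_measure_ge0 andbT.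
apply: ge_ereal_sup => _ [delta /= delta0 <-].
apply/lee_addgt0Pr => eta eta0; rewrite add0e.
pose C2 := C * K `^ (s + 2 * e).
have C20 : 0 < C2 by rewrite mulr_gt0// powR_gt0.
pose eta1 := eta / (2 * C2).
have eta10 : 0 < eta1 by rewrite divr_gt0// mulr_gt0.
pose rho1 := Num.min (rho0 / 2) (Num.min 1 (delta / K)).
have rho10 : 0 < rho1 by rewrite !lt_min !divr_gt0//= ltr01.
have rho1r : rho1 < rho0.
  apply: (@le_lt_trans _ _ (rho0 / 2)); first by rewrite /rho1 ge_min lexx.
  by rewrite ltr_pdivrMr// ltr_pMr// ltr1n.
have rho11 : rho1 <= 1 by rewrite /rho1 !ge_min lexx !orbT.
have rho1d : K * rho1 <= delta.
  by rewrite mulrC -ler_pdivlMr// /rho1 !ge_min lexx !orbT.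
(* A covering set may have diameter 0, where [cover] says nothing. The cutoff keeps scales positive,
   with summable cost. *)
pose tau i := Num.min rho1 ((eta1 / (2 ^ i.+1)%:R) `^ e^-1).
have tp i : 0 < eta1 / (2 ^ i.+1)%:R by rewrite divr_gt0// ltr0n expn_gt0.
have tau0 i : 0 < tau i by rewrite lt_min rho10 powR_gt0.
have taue i : tau i `^ e <= eta1 / (2 ^ i.+1)%:R.
  have -> : eta1 / (2 ^ i.+1)%:R = ((eta1 / (2 ^ i.+1)%:R) `^ e^-1) `^ e.
    by rewrite -powRrM mulVf ?gt_eqF// powRr1// ltW.
  apply: ge0_ler_powR; rewrite ?nnegrE ?powR_ge0 ?(ltW e0) ?(ltW (tau0 i))//.
  by rewrite /tau ge_min lexx orbT.
have taus i : tau i `^ (s + e) <= eta1 / (2 ^ i.+1)%:R.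
  apply: le_trans (taue i); rewrite powRD; last by rewrite (gt_eqF (tau0 i)) implybT.
  rewrite ler_piMl ?powR_ge0// powR_le1 ?(ltW (tau0 i))//.
  by apply: le_trans rho11; rewrite /tau ge_min lexx.
have : (hausdorff_delta s rho1 A < eta1%:E)%E.
  apply: (@le_lt_trans _ _ 0%E); last by rewrite lte_fin.
  by rewrite -HA; apply: ereal_sup_ubound; exists rho1.
move=> /ereal_inf_lt[_ [F [AF dF] <-]] sumF.
pose dd i := fine (diam (F i)).
have dF1 i : F i !=set0 -> 0 <= dd i <= rho1.
  move=> /diam_ge0 d0; rewrite fine_ge0//= -lee_fin fineK ?dF//.
  by rewrite ge0_fin_numE// (le_lt_trans (dF i))// ltry.
have dF2 i x y : F i x -> F i y -> `|x - y| <= dd i.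
  move=> Fx Fy; have Fn : F i !=set0 by exists x.
  rewrite -lee_fin fineK; last by rewrite ge0_fin_numE ?diam_ge0// (le_lt_trans (dF i))// ltry.
  by apply: ereal_sup_ubound; exists (x, y).
pose rho i := Num.max (if pselect (F i !=set0) is left _ then dd i else 0) (tau i).
have rhop i : 0 < rho i by rewrite lt_max tau0 orbT.
have rhole i : rho i <= rho1.
  rewrite ge_max; apply/andP; split; last by rewrite /tau ge_min lexx.
  by case: pselect => [/dF1/andP[]//|_]; exact: ltW.
have /choice[MG hMG] : forall i, exists MG : nat * (nat -> set (R * R)),
  [/\ forall z, B z -> exists2 j, (j < MG.1)%N & MG.2 j z, MG.1%:R <= C * rho i `^ (- e) &
  forall j z z', MG.2 j z -> MG.2 j z' -> `|pi z - pi z'| <= rho i -> `|z - z'| <= K * rho i].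
  move=> i; have [M [G h]] := cover (rhop i) (le_lt_trans (rhole i) rho1r).
  by exists (M, G).
pose S i j := [set z | [/\ (j < (MG i).1)%N, B z, F i (pi z) & (MG i).2 j z]].
have Sd i j z z' : S i j z -> S i j z' -> `|z - z'| <= K * rho i.
  move=> [_ Bz Fz Gz] [_ Bz' Fz' Gz']; have [_ _ h] := hMG i; apply: h Gz Gz' _.
  apply: le_trans (dF2 i _ _ Fz Fz') _; rewrite le_max.
  by case: pselect => [_|[]]; [rewrite lexx|exists (pi z)].
apply: (@le_trans _ _ (\sum_(0 <= i <oo) \sum_(0 <= j <oo) hcost (s + 2 * e) (S i j))%E).
  apply: hausdorff_delta_double => [z Bz|i j].
    have [i _ Fi] := AF _ (BA Bz); have [/(_ z Bz)[j jM Gj] _ _] := hMG i.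
    by exists i => //; exists j.
  apply: diam_le => x y Sx Sy; apply: le_trans (Sd i j x y Sx Sy) _.
  by apply: le_trans rho1d; rewrite ler_pM2l.
apply: (@le_trans _ _ (\sum_(0 <= i <oo) C2%:E * (hcost s (F i) + (eta1 / (2 ^ i.+1)%:R)%:E))%E).
  apply: lee_nneseries => [i _ _|i _].
    by apply: nneseries_ge0 => *; exact: hcost_ge0.
  have Kr0 : 0 <= K * rho i by rewrite mulr_ge0 ?ltW.
  have h1 : (\sum_(0 <= j <oo) hcost (s + 2 * e) (S i j) <=
      ((MG i).1%:R * (K * rho i) `^ (s + 2 * e))%:E)%E.
    apply: nneseries_finite_le => [||j|j hj].
    - exact: powR_ge0.
    - by move=> j; exact: hcost_ge0.
    - by apply: hcost_le => // x y; exact: Sd.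
    - rewrite /hcost; case: pselect => // -[]; apply/seteqP; split => // z [].
      by rewrite ltnNge hj.
  have [Fn|Fe] := pselect (F i !=set0); last first.
    have S0 j : S i j = set0.
      by apply/seteqP; split => // z [_ _ Fz _]; apply: Fe; exists (pi z).
    rewrite eseries0 => [|j _ _]; last by rewrite S0 /hcost; case: pselect.
    by rewrite mule_ge0 ?lee_fin ?(ltW C20)// adde_ge0 ?hcost_ge0 ?lee_fin ?(ltW (tp i)).
  apply: le_trans h1 _.
  have -> : hcost s (F i) = (dd i `^ s)%:E.
    by rewrite /hcost; case: pselect => // F0; exfalso; move: Fn => [x]; rewrite F0.
  rewrite -EFinD -EFinM lee_fin.
  have [_ hM _] := hMG i.
  apply: (@le_trans _ _ (C * rho i `^ (- e) * (K * rho i) `^ (s + 2 * e))).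
    by rewrite ler_wpM2r// powR_ge0.
  rewrite powRM ?(ltW K0) ?(ltW (rhop i))//.
  have -> : C * rho i `^ (- e) * (K `^ (s + 2 * e) * rho i `^ (s + 2 * e)) =
      C2 * rho i `^ (s + e).
    rewrite /C2 (_ : s + e = - e + (s + 2 * e)); last by ring.
    by rewrite (@powRD _ (rho i) (- e)) ?(gt_eqF (rhop i)) ?implybT//; ring.
  rewrite ler_pM2l//.
  have [td|dt] := leP (tau i) (dd i).
    have -> : rho i = dd i by rewrite /rho; case: pselect => // _; rewrite max_l.
    have dp : 0 < dd i by apply: lt_le_trans (tau0 i) td.
    apply: (@le_trans _ _ (dd i `^ s)); last by rewrite lerDl ltW.
    rewrite powRD ?(gt_eqF dp) ?implybT// ler_piMr ?powR_ge0//.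
    have /andP[d0 d1] := dF1 i Fn.
    by rewrite powR_le1// ?(ltW e0)//; exact: le_trans d1 rho11.
  have -> : rho i = tau i by rewrite /rho; case: pselect => // _; rewrite max_r// ltW.
  by apply: le_trans (taus i) _; rewrite lerDr powR_ge0.
rewrite nneseriesZl => [|i _]; last first.
  by rewrite adde_ge0 ?hcost_ge0// lee_fin ltW.
apply: (@le_trans _ _ (C2%:E * (eta1%:E + eta1%:E))%E).
  rewrite lee_pmul2l ?lte_fin//.
  apply: le_trans (epsilon_trick _ _ (ltW eta10)) _; first by move=> n; exact: hcost_ge0.
  by rewrite leeD2r// ltW.
rewrite -EFinD -EFinM lee_fin /eta1.
by rewrite (_ : C2 * _ = eta)//; field; rewrite gt_eqF.
Qed.

End LiftDimension.

(** * Dimension drop forces positive entropy *)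

Section Concrete.
Context {R : realType}.
Variable p : nat.
Hypothesis hp : (2 <= p)%N.
Local Notation T := (Tprod p p : R * R -> R * R).

Lemma measurable_Tprod a b : measurable_fun [set: R * R] (Tprod a b : R * R -> R * R).
Proof.
apply/measurable_fun_pairP; split.
  by apply: (measurableT_comp (measurable_Tq a)); exact: measurable_fst.
by apply: (measurableT_comp (measurable_Tq b)); exact: measurable_snd.
Qed.

Variable mu : probability (R * R)%type R.
Hypothesis hinv : is_invariant mu T.
Hypothesis herg : is_ergodic mu T.

Lemma preserving_Tprod : preserving mu T.
Proof. by split; [exact: measurable_Tprod | exact: hinv]. Qed.

Lemma ergodic_prb A : measurable A -> T @^-1` A = A -> prb mu A = 0 \/ prb mu A = 1.
Proof.
move=> mA TA; rewrite /prb; by have [->|->] := herg mA TA; [left|right].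
Qed.

Let pT := preserving_Tprod.

Section Coordinate.
Variable pr : R * R -> R.
Hypothesis mpr : measurable_fun [set: R * R] pr.
Hypothesis prT : forall z, pr (T z) = Tq p (pr z).

Definition dx (z : R * R) := dig p (pr z).

Lemma mlab_dx : mlab dx. Proof. exact: mlab_dig. Qed.

Lemma pr_iter k z : pr (iter k T z) = iter k (Tq p) (pr z).
Proof. by elim: k => //= k ih; rewrite prT ih. Qed.

Lemma wd_dig n z z' : wd T dx n z = wd T dx n z' ->
  forall k, (k < n)%N -> dig p (iter k (Tq p) (pr z)) = dig p (iter k (Tq p) (pr z')).
Proof. by move=> /wdP h k /h; rewrite /dx !pr_iter. Qed.

Variable U : set (R * R).
Hypothesis mU : measurable U.
Hypothesis aeU : {ae mu, forall z, U z}.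
Hypothesis U01 : forall z, U z -> 0 <= pr z < 1.
Variable pi : R * R -> R.
Hypothesis mpi : measurable_fun [set: R * R] pi.
Variable K : R.
Hypothesis K0 : 0 < K.
Hypothesis piK : forall z z', U z -> U z' -> `|z - z'| <= K * (`|pi z - pi z'| + `|pr z - pr z'|).

Lemma exists_level rho m : 0 < rho -> rho < (p%:R ^+ m)^-1 :> R -> exists2 N : nat,
  (m <= N)%N & ((p%:R ^+ N)^-1 <= rho :> R) /\ (p%:R ^+ N <= p%:R / rho :> R).
Proof.
move=> r0 rm.
have p1 : 1 < p%:R :> R by rewrite ltr1n.
have pp k : 0 < p%:R ^+ k :> R by rewrite exprn_gt0// (lt_trans ltr01).
have ex : exists N, (p%:R ^+ N)^-1 <= rho.
  have [N hN] := exists_nat_ge rho^-1; exists N.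
  rewrite -[leRHS]invrK lef_pV2 ?posrE ?invr_gt0//; apply: le_trans hN _.
  by rewrite -natrX ler_nat ltnW// ltn_expl.
case: (ex_minnP ex) => N hN minN.
have mN : (m < N)%N.
  rewrite ltnNge; apply/negP => Nm; move: rm; apply/negP; rewrite -leNgt; apply: le_trans hN.
  by rewrite lef_pV2 ?posrE// ler_weXn2l// ltW.
exists N; first exact: ltnW.
split => //; case: N => // N in hN minN mN *.
rewrite ler_pdivlMr// exprS -mulrA ler_piMr ?(ltW (lt_trans ltr01 p1))//.
have : rho < (p%:R ^+ N)^-1 by rewrite ltNge; apply/negP => /minN; rewrite ltnn.
by rewrite -(ltr_pM2l (pp N)) divff ?gt_eqF// => /ltW.
Qed.

Lemma positive_entropy : (dim1 (pushforward mu pi) < dim2 mu)%E -> 0 < erate mu T dx.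
Proof.
move=> drop; rewrite lt_neqAle (erate_ge0 pT mlab_dx) andbT; apply/eqP => h0.
have [_ [A [mA A0] <-] Adim] := ereal_inf_lt drop.
have [_ [s [s0 HA] <-] sdim] := ereal_inf_lt Adim.
have [s' ss' s'dim] : exists2 s', s < s' & (s'%:E < dim2 mu)%E.
  case: (dim2 mu) sdim => [r|_|//]; last by exists (s + 1); rewrite ?ltrDl ?ltry.
  rewrite lte_fin => sr; exists ((s + r) / 2); rewrite ?lte_fin; lra.
pose e := (s' - s) / 2.
have e0 : 0 < e by rewrite divr_gt0// subr_gt0.
have p1 : 1 < p%:R :> R by rewrite ltr1n.
have p0 := lt_trans ltr01 p1.
(* Makes exp (N dl) equal to (p^N)^e, the number of pieces that [lift_dimension] allows at scale
   p^(-N). *)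
pose dl := e * ln p%:R.
have dl0 : 0 < dl by rewrite mulr_gt0// ln_gt0.
have dl20 : 0 < dl / 2 by rewrite divr_gt0.
have [W0 hW0] := erate_lim pT mlab_dx dl20; have {}hW0 := hW0 W0 (leqnn _).
rewrite -h0 add0r in hW0.
pose qq n v := q mu T dx W0 n v.
pose good n := [set v : n.-tuple 'I_p.-1.+1 | 0 < qq n v /\ - ln (qq n v) <= n%:R * dl].
pose Q m := \bigcap_(n in [set n | (m <= n)%N]) wd T dx n @^-1` good n.
have mQ m : measurable (Q m).
  apply: bigcap_measurable => [|n _]; first by exists m => /=.
  exact: (mlab_set (good n) (mlab_wd pT mlab_dx (n := n))).
have mpA : measurable (pi @^-1` A) by rewrite -[X in measurable X]setTI; exact: mpi.
have aeQ : {ae mu, forall z, exists m, Q m z}.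
  apply: filterS2 (q_pos pT mlab_dx W0) (q_eventually pT mlab_dx W0 ergodic_prb dl20).
  move=> z h1 [m h2]; exists m => n mn; split; first exact: h1.
  apply: le_trans (h2 n mn) _; rewrite ler_wpM2l//; lra.
have [m Bm] : exists m, prb mu (pi @^-1` A `&` (Q m `&` U)) != 0.
  apply: contrapT => /forallNP H.
  have H' : {ae mu, forall z, forall m, ~ (pi @^-1` A `&` (Q m `&` U)) z}.
    apply: ae_foralln => m; apply: prb_null_ae.
      by apply: measurableI => //; apply: measurableI => //; exact: mU.
    by have /negP := H m; rewrite negbK => /eqP.
  have : prb mu (pi @^-1` A) = 0.
    apply: prb_ae0 => //; apply: filterS3 H' aeQ aeU => z h1 [m Qm] Uz Az.
    by apply: (h1 m).
  move=> h; have : (0 < mu (pi @^-1` A))%E := A0.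
  by rewrite prbE// h ltxx.
pose B := pi @^-1` A `&` (Q m `&` U).
have mB : measurable B.
  by apply: measurableI => //; apply: measurableI => //; exact: mU.
have B0 : (0 < mu B)%E by rewrite prbE// lte_fin lt_neqAle eq_sym Bm prb_ge0.
have : hausdorff_measure (s + 2 * e) B = 0%E.
  apply: (@lift_dimension _ pi A B s e (2 * K) (p%:R `^ e) (p%:R ^+ m)^-1) => //.
  - by rewrite mulr_gt0.
  - exact: powR_gt0.
  - by rewrite invr_gt0 exprn_gt0.
  - by move=> z [].
  move=> rho rho0 rhom; have [N mN [h1 h2]] := exists_level rho0 rhom.
  pose L := [seq v <- enum {: N.-tuple 'I_p.-1.+1} | `[< good N v >]].
  pose v0 := wd T dx N (0, 0).
  exists (size L), (fun j => [set z | U z /\ wd T dx N z = nth v0 L j]); split.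
  - move=> z [_ [/(_ N mN) Qz Uz]]; exists (index (wd T dx N z) L).
      by rewrite index_mem mem_filter mem_enum andbT; apply/asboolP.
    split => //=; rewrite nth_index// mem_filter mem_enum andbT; exact/asboolP.
  - have w0 : 0 < expR (- (N%:R * dl)) by exact: expR_gt0.
    (* Each good word has weight at least exp (- N dl) and the weights add up to at most 1, so this
       bounds the number of good words. *)
    have : (size L)%:R * expR (- (N%:R * dl)) <= 1.
      apply: le_trans (sum_q pT mlab_dx W0 N).
      have -> : \sum_(v : N.-tuple 'I_p.-1.+1) q mu T dx W0 N v =
          \sum_(v <- enum {: N.-tuple 'I_p.-1.+1}) q mu T dx W0 N v by rewrite big_enum.
      rewrite (bigID (fun v => `[< good N v >]))/=.
      rewrite -[leLHS]addr0 lerD ?sumr_ge0//; last by move=> *; exact: q_ge0.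
      rewrite -big_filter -/L.
      have -> : (size L)%:R * expR (- (N%:R * dl)) = \sum_(v <- L) expR (- (N%:R * dl)).
        by rewrite big_const_seq count_predT iter_addr_0 mulr_natl.
      rewrite !big_seq; apply: ler_sum => v; rewrite mem_filter => /andP[/asboolP[q0 lq] _].
      by rewrite -[leRHS]lnK ?posrE// ler_expR lerNl.
    rewrite -ler_pdivlMr// expRN invrK mul1r => /le_trans; apply.
    have -> : expR (N%:R * dl) = (p%:R ^+ N) `^ e.
      by rewrite /powR gt_eqF ?exprn_gt0// lnXn// -[ln _ *+ N]mulr_natl /dl; congr expR; ring.
    apply: (@le_trans _ _ ((p%:R / rho) `^ e)).
      apply: ge0_ler_powR h2; rewrite ?nnegrE; first exact: ltW.
        by rewrite exprn_ge0.
      by rewrite divr_ge0// ltW.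
    by rewrite powRM ?invr_ge0 ?(ltW rho0)// -powR_inv1 ?(ltW rho0)// -powRrM mulN1r.
  - move=> j z z' [Uz ez] [Uz' ez'] piz.
    apply: le_trans (piK Uz Uz') _; rewrite [2 * K]mulrC -mulrA ler_pM2l// mulr_natl mulr2n lerD//.
    apply: le_trans h1; apply: (word_close hp (U01 Uz) (U01 Uz')); apply: wd_dig.
    by rewrite ez ez'.
move=> HB; have : (hausdorff_dim B <= s'%:E)%E.
  apply: ereal_inf_lbound; exists (s + 2 * e); last by rewrite /e; congr EFin; lra.
  by split => //; rewrite addr_ge0// mulr_ge0// ltW.
have : (dim2 mu <= hausdorff_dim B)%E by apply: ereal_inf_lbound; exists B.
by move=> h3 h4; move: s'dim; rewrite ltNge (le_trans h3 h4).
Qed.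

End Coordinate.
End Concrete.

(** * Energy of conditional averages *)

Section Doob.
Context {R : realType} {d : measure_display} {X : measurableType d}.
Variable P : probability X R.
Local Notation Ex := (Ex P).
Local Notation prb := (prb P).
Variable T : X -> X.
Hypothesis pT : preserving P T.
Context {D : finType}.
Variable dz : X -> D.
Hypothesis mdz : mlab dz.

Let piter k : preserving P (iter k T). Proof. exact: preserving_iter. Qed.
Let mwz n : mlab (wd T dz n). Proof. exact: (mlab_wd pT mdz). Qed.

Implicit Types f g : X -> R.

(** The first [l] letters of [z] are the past of the point [iter l T z] at which [f] is
    evaluated. *)
Definition fcond f l z := cond P (wd T dz l) (f \o iter l T) z.

(** Half the squared modulus of the conditional average of f + i g; the half keeps it at most 1. *)
Definition phi (f g : X -> R) l z := (fcond f l z ^+ 2 + fcond g l z ^+ 2) / 2.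

(** By [fcond_iter] the [l]-th term concerns [f] and [g] at time [i], conditioned on the [l] letters
    just before: a martingale in [l]. The maximum over all [l] is what yields [phimax_shift]. *)
Definition phimax f g i z := \big[Num.max/0]_(l < i.+1) phi f g l (iter (i - l) T z).

Lemma bmf_fcomp f l : bmf f -> bmf (f \o iter l T).
Proof. by move=> bf; apply: bmf_comp => //; case: (piter l). Qed.

Lemma bmf_fcond f l : bmf (fcond f l).
Proof. exact: bmf_cond. Qed.

Lemma bmf_phi f g l : bmf (phi f g l).
Proof.
rewrite (_ : phi f g l = fun z => 2^-1 * (fcond f l z ^+ 2 + fcond g l z ^+ 2)).
  by apply: bmfZ; apply: bmfD; apply: bmfX; exact: bmf_fcond.
by apply/funext => z; rewrite mulrC.
Qed.

Lemma phi_ge0 f g l z : 0 <= phi f g l z.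
Proof. by rewrite divr_ge0// addr_ge0// sqr_ge0. Qed.

Lemma fcond_le f l z : bmf f -> (forall z, `|f z| <= 1) -> `|fcond f l z| <= 1.
Proof.
move=> bf f1; apply: cond_norm_le => //; first exact: bmf_fcomp.
by move=> z'; exact: f1.
Qed.

Lemma phi_le1 f g l z : bmf f -> bmf g -> (forall z, `|f z| <= 1) ->
  (forall z, `|g z| <= 1) -> phi f g l z <= 1.
Proof.
move=> bf bg f1 g1; rewrite /phi.
have sq x : `|x| <= 1 -> x ^+ 2 <= 1 :> R.
  by move=> x1; rewrite -[leLHS]real_normK ?num_real// expr_le1.
have := sq _ (fcond_le l z bf f1); have := sq _ (fcond_le l z bg g1); lra.
Qed.

Lemma phimax_ge0 f g i z : 0 <= phimax f g i z.
Proof. by rewrite /phimax; elim/big_ind: _ => // [x y x0 y0|l _]; rewrite ?le_max ?x0// phi_ge0. Qed.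

Lemma phi_le_max f g i l z : (l <= i)%N -> phi f g l (iter (i - l) T z) <= phimax f g i z.
Proof.
move=> li; rewrite /phimax.
exact: (le_bigmax 0 (fun l : 'I_i.+1 => phi f g l (iter (i - l) T z))
  (Ordinal (li : (l < i.+1)%N))).
Qed.

Lemma phimax_le f g i z c : 0 <= c -> (forall l, (l <= i)%N -> phi f g l (iter (i - l) T z) <= c) ->
  phimax f g i z <= c.
Proof.
move=> c0 h; rewrite /phimax; elim/big_ind: _ => // [x y x0 y0|l _]; first by rewrite ge_max x0.
by apply: h; rewrite -ltnS.
Qed.

Lemma bmf_phimax f g i : bmf (phimax f g i).
Proof.
suff gen n (h : nat -> X -> R) : (forall l, bmf (h l)) ->
    bmf (fun z => \big[Num.max/0]_(l < n) h l z).
  apply: (gen i.+1 (fun l => phi f g l \o iter (i - l) T)) => l.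
  by apply: bmf_fcomp; exact: bmf_phi.
elim: n h => [|n ih] h bh.
  rewrite (_ : (fun z => _) = fun=> 0); first exact: bmf_cst.
  by apply/funext => z; rewrite big_ord0.
rewrite (_ : (fun z => _) = fun z => Num.max (h 0%N z) (\big[Num.max/0]_(l < n) h l.+1 z)).
  by apply: bmf_max => //; exact: (ih (fun l => h l.+1)).
by apply/funext => z; rewrite big_ord_recl.
Qed.

Lemma phimax_shift f g i z : phimax f g i (T z) <= phimax f g i.+1 z.
Proof.
apply: phimax_le => [|l li]; first exact: phimax_ge0.
rewrite -iterSr -subSn//; apply: phi_le_max; exact: leqW.
Qed.

Let G i l := wd T dz l \o iter (i - l) T.

Let mG i l : mlab (G i l).
Proof. exact: (mlab_comp (piter (i - l)).1 (@mwz l)). Qed.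

Let G_refines i l l' : (l' <= l)%N -> (l <= i)%N -> refines (G i l) (G i l').
Proof.
move=> l'l li z z' /wdP h; apply/wdP => k kl'; rewrite -!iterD.
have -> : (k + (i - l') = (k + (l - l')) + (i - l))%N by lia.
by rewrite !(iterD (k + (l - l'))%N); apply: h; lia.
Qed.

Let fcond_iter f i l z : bmf f -> (l <= i)%N ->
  fcond f l (iter (i - l) T z) = cond P (G i l) (f \o iter i T) z.
Proof.
move=> bf li; rewrite /fcond -cond_preserving//; last exact: bmf_fcomp.
by congr (cond _ _ _ _); apply/funext => y /=; rewrite -iterD subnKC.
Qed.

Lemma Ex_phi_le f g i l h : bmf f -> bmf g -> (l <= i)%N ->
  (forall z z', G i l z = G i l z' -> h z = h z') -> (forall z, 0 <= h z) ->
  Ex (fun z => phi f g l (iter (i - l) T z) * h z) <= Ex (fun z => phi f g i z * h z).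
Proof.
move=> bf bg li hG h0.
have bh : bmf h := bmf_labm (@mG i l) hG.
have E l' : (l' <= i)%N -> Ex (fun z => phi f g l' (iter (i - l') T z) * h z) =
  2^-1 * (Ex (fun z => cond P (G i l') (f \o iter i T) z ^+ 2 * h z) +
          Ex (fun z => cond P (G i l') (g \o iter i T) z ^+ 2 * h z)).
  move=> l'i.
  have b1 : bmf (fun z => cond P (G i l') (f \o iter i T) z ^+ 2 * h z).
    by apply: bmfM => //; apply: bmfX; exact: bmf_cond.
  have b2 : bmf (fun z => cond P (G i l') (g \o iter i T) z ^+ 2 * h z).
    by apply: bmfM => //; apply: bmfX; exact: bmf_cond.
  rewrite -(ExD P b1 b2) -(ExZ P _ (bmfD b1 b2)); congr Ex; apply/funext => z.
  by rewrite /phi !fcond_iter//; ring.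
have := E i (leqnn i); rewrite subnn /= => ->; rewrite E// ler_pM2l ?invr_gt0//.
by apply: lerD; apply: cond_jensen => //; [exact: G_refines|exact: bmf_fcomp|
  exact: G_refines|exact: bmf_fcomp].
Qed.

Lemma Ex_phi_mono f g i : bmf f -> bmf g -> Ex (phi f g i) <= Ex (phi f g i.+1).
Proof.
move=> bf bg.
have := @Ex_phi_le f g i.+1 i (fun=> 1) bf bg (leqnSn i) (fun _ _ _ => erefl) (fun=> ler01).
rewrite subSnn /=.
have -> : (fun z => phi f g i (T z) * 1) = phi f g i \o T by apply/funext => z; rewrite mulr1.
have -> : (fun z => phi f g i.+1 z * 1) = phi f g i.+1 by apply/funext => z; rewrite mulr1.
by rewrite Ex_preserving//; exact: bmf_phi.
Qed.

(* Maximal inequality along the filtration obtained by revealing more and more of the past. *)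
Lemma doob f g i lam : bmf f -> bmf g -> (forall z, `|f z| <= 1) -> (forall z, `|g z| <= 1) ->
  0 < lam -> Ex (phimax f g i) <= lam + Ex (phi f g i) / lam.
Proof.
move=> bf bg f1 g1 lam0.
pose h l z := phi f g l (iter (i - l) T z).
(* [M l] tells whether [lam] was reached before [l], so [F l] marks first passage at [l]. It depends
   only on the last [l] letters, hence is an admissible weight in [Ex_phi_le]. *)
pose M l z : R := (has (fun k => lam <= h k z) (iota 0 l))%:R.
pose F l z := M l.+1 z - M l z.
have FE l z : F l z = (~~ has (fun k => lam <= h k z) (iota 0 l) && (lam <= h l z))%:R.
  rewrite /F /M -[l.+1]addn1 iotaD has_cat /= orbF add0n.
  by case: (has _ _); case: (lam <= h l z); rewrite /= ?subrr ?subr0.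
have F0 l z : 0 <= F l z by rewrite FE.
have Fh l z : lam * F l z <= h l z * F l z.
  rewrite FE; case: (boolP (lam <= h l z)); rewrite ?andbT ?andbF ?mulr0// => le.
  by rewrite ler_wpM2r.
have FG l : (l <= i)%N -> forall z z', G i l z = G i l z' -> F l z = F l z'.
  move=> li z z' e; rewrite !FE.
  have hG k : (k <= l)%N -> h k z = h k z'.
    move=> kl; have ki := leq_trans kl li.
    rewrite /h /phi !fcond_iter//.
    by rewrite (cond_lab P (f \o iter i T) (G_refines kl li e)) (cond_lab P (g \o iter i T) (G_refines kl li e)).
  rewrite (hG l (leqnn l)); congr (~~ _ && _)%:R.
  apply: eq_in_has => k; rewrite mem_iota add0n /= => kl.
  by rewrite hG// ltnW.
have bF l : (l <= i)%N -> bmf (F l) by move=> li; exact: bmf_labm (@mG i l) (FG l li).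
have bFo (l : 'I_i.+1) : bmf (F l) by apply: bF; rewrite -ltnS.
have sumF z : \sum_(l < i.+1) F l z = M i.+1 z.
  rewrite -(big_mkord xpredT (fun l => F l z)) (telescope_sumr (fun l => M l z))//.
  by rewrite /M /= subr0.
apply: (@le_trans _ _ (Ex (fun z => lam + \sum_(l < i.+1) F l z))).
  apply: Ex_le; [exact: bmf_phimax|by apply: bmfD; [exact: bmf_cst|exact: bmf_sum]|] => z.
  rewrite sumF /M; case: (boolP (has _ _)) => [_|/hasPn nh].
    apply: (@le_trans _ _ 1); last by rewrite lerDr ltW.
    by apply: phimax_le => // l li; exact: phi_le1.
  rewrite addr0; apply: phimax_le => [|l li]; first exact: ltW.
  by have := nh l; rewrite mem_iota /= add0n ltnS li -ltNge => /(_ isT) /ltW.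
rewrite (ExD P (@bmf_cst _ _ _ _)); last exact: bmf_sum.
rewrite Ex_cst lerD2l ler_pdivlMr// mulrC -(ExZ P _ (bmf_sum _ _ bFo)).
have bphi l : bmf (h l) by apply: bmf_fcomp; exact: bmf_phi.
have bi : bmf (phi f g i) by exact: bmf_phi.
have e1 : Ex (fun z => lam * \sum_(l < i.+1) F l z) <= Ex (fun z => \sum_(l < i.+1) h l z * F l z).
  apply: Ex_le; [by apply: bmfZ; exact: bmf_sum|by apply: bmf_sum => l; exact: bmfM|] => z.
  by rewrite mulr_sumr; apply: ler_sum => l _; exact: Fh.
apply: le_trans e1 _; rewrite Ex_sum => [|l]; last exact: bmfM.
apply: (@le_trans _ _ (\sum_(l < i.+1) Ex (fun z => phi f g i z * F l z))).
  apply: ler_sum => l _; have li : (l <= i)%N by rewrite -ltnS.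
  by apply: Ex_phi_le => //; exact: FG.
rewrite -Ex_sum => [|l]; last exact: bmfM.
apply: Ex_le => //; first by apply: bmf_sum => l; exact: bmfM.
move=> z; rewrite -mulr_sumr sumF ler_piMr ?phi_ge0// /M.
by case: (has _ _).
Qed.

Lemma fcond_lip f f' e l z : bmf f -> bmf f' -> (forall z, `|f z - f' z| <= e) ->
  `|fcond f l z - fcond f' l z| <= e.
Proof.
move=> bf bf' h; have e0 : 0 <= e := le_trans (normr_ge0 _) (h z).
have [p0|p0] := eqVneq (prb (atom (wd T dz l) z)) 0.
  by rewrite /fcond /cond p0 invr0 !mulr0 subrr normr0.
apply: cond_close => //; [exact: bmf_fcomp|exact: bmf_fcomp|by rewrite lt_neqAle eq_sym p0 prb_ge0|].
by apply: aeW => z' _; exact: h.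
Qed.

Lemma phi_lip f g f' g' e l z : bmf f -> bmf g -> bmf f' -> bmf g' ->
  (forall z, `|f z| <= 1) -> (forall z, `|g z| <= 1) ->
  (forall z, `|f' z| <= 1) -> (forall z, `|g' z| <= 1) ->
  (forall z, `|f z - f' z| <= e) -> (forall z, `|g z - g' z| <= e) ->
  `|phi f g l z - phi f' g' l z| <= 2 * e.
Proof.
move=> bf bg bf' bg' f1 g1 f1' g1' hf hg.
have a1 := fcond_le l z bf f1; have a2 := fcond_le l z bg g1.
have a3 := fcond_le l z bf' f1'; have a4 := fcond_le l z bg' g1'.
have b1 := fcond_lip l z bf bf' hf; have b2 := fcond_lip l z bg bg' hg.
rewrite /phi; move: (fcond f l z) (fcond g l z) (fcond f' l z) (fcond g' l z) a1 a2 a3 a4 b1 b2.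
move=> a b a' b' a1 a2 a3 a4 b1 b2.
have sq x y : `|x| <= 1 -> `|y| <= 1 -> `|x - y| <= e -> `|x ^+ 2 - y ^+ 2| <= 2 * e.
  move=> x1 y1 xy; rewrite subr_sqr normrM mulrC; apply: ler_pM => //.
  by apply: le_trans (ler_normD _ _) _; lra.
have -> : (a ^+ 2 + b ^+ 2) / 2 - (a' ^+ 2 + b' ^+ 2) / 2 =
  ((a ^+ 2 - a' ^+ 2) + (b ^+ 2 - b' ^+ 2)) / 2 by field.
rewrite normrM (ger0_norm (_ : 0 <= 2^-1)) ?invr_ge0// ler_pdivrMr//.
by apply: le_trans (ler_normD _ _) _; have := sq a a' a1 a3 b1; have := sq b b' a2 a4 b2; lra.
Qed.

Lemma phimax_lip f g f' g' e i z : bmf f -> bmf g -> bmf f' -> bmf g' ->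
  (forall z, `|f z| <= 1) -> (forall z, `|g z| <= 1) ->
  (forall z, `|f' z| <= 1) -> (forall z, `|g' z| <= 1) ->
  (forall z, `|f z - f' z| <= e) -> (forall z, `|g z - g' z| <= e) ->
  `|phimax f g i z - phimax f' g' i z| <= 2 * e.
Proof.
move=> bf bg bf' bg' f1 g1 f1' g1' hf hg.
have e0 : 0 <= 2 * e by rewrite mulr_ge0// (le_trans (normr_ge0 _) (hf z)).
have half u v u' v' : (forall l z, `|phi u v l z - phi u' v' l z| <= 2 * e) ->
    phimax u v i z <= phimax u' v' i z + 2 * e.
  move=> h; apply: phimax_le => [|l li]; first by rewrite addr_ge0 ?phimax_ge0.
  have := phi_le_max u' v' z li; have := h l (iter (i - l) T z).
  by rewrite ler_distl => /andP[]; lra.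
rewrite ler_distl lerBlDr; apply/andP; split; apply: half => l y; last exact: phi_lip.
by rewrite distrC; exact: phi_lip.
Qed.

End Doob.

(** * Interpolation between levels *)

Section Tent.
Context {R : realType}.
Implicit Types (a : nat -> R -> R) (t s x : R).

(* Piecewise linear interpolation between consecutive levels: it turns a quantity
   indexed by a level and a scale into a continuous function of time. *)
Definition tent a t := let b := Num.truncn t in let x := t - b%:R in
  (1 - x) * a b x + x * a b.+1 (x - 1).

Let tentb a (b : nat) t := (1 - (t - b%:R)) * a b (t - b%:R) + (t - b%:R) * a b.+1 (t - b%:R - 1).

Lemma truncn_frac t : 0 <= t -> 0 <= t - (Num.truncn t)%:R < 1.
Proof. by move=> /truncn_itv/andP[h1 h2]; rewrite subr_ge0 h1 ltrBlDl natr1. Qed.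

(** At the right endpoint both branches equal [a b.+1 0]; this agreement is the continuity of
    [tent]. *)
Let tentE a (b : nat) t : b%:R <= t <= b%:R + 1 -> tent a t = tentb a b t.
Proof.
move=> /andP[bt]; rewrite le_eqVlt => /orP[/eqP tb|tb].
  have e : Num.truncn t = b.+1 by apply: truncn_def; rewrite tb natr1 lexx ltr_nat ltnSn.
  rewrite /tent /tentb e tb natr1 subrr -natr1.
  have -> : b%:R + 1 - b%:R = 1 :> R by ring.
  by rewrite !subrr !mul0r !mul1r subr0 mul1r addr0 add0r.
have e : Num.truncn t = b by apply: truncn_def; rewrite bt -natr1.
by rewrite /tent e.
Qed.

Section Bounded.
Variable a : nat -> R -> R.
Hypothesis a01 : forall i x, 0 <= a i x <= 1.

Lemma tent01 t : 0 <= t -> 0 <= tent a t <= 1.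
Proof.
move=> /truncn_frac; rewrite /tent; move: (Num.truncn t) => b; move: (t - b%:R) => x /andP[x0 x1].
have /andP[h1 h2] := a01 b x; have /andP[h3 h4] := a01 b.+1 (x - 1).
apply/andP; split; first by rewrite addr_ge0// mulr_ge0// subr_ge0 ltW.
have x1' : 0 <= 1 - x by rewrite subr_ge0 ltW.
have := ler_wpM2l x1' h2; have := ler_wpM2l x0 h4; lra.
Qed.

(** On one linear piece, [e] comes from the continuity of [a] and [e] from the change of weights;
    [dl <= 1] leaves at most two adjacent pieces. *)
Lemma tent_uc e dl t t' : dl <= e -> dl <= 1 ->
  (forall i x x', -1 <= x <= 1 -> -1 <= x' <= 1 -> `|x - x'| < dl -> `|a i x - a i x'| <= e) ->
  0 <= t -> 0 <= t' -> `|t - t'| < dl -> `|tent a t - tent a t'| <= 4 * e.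
Proof.
move=> de d1 uc.
have same b s s' : b%:R <= s <= b%:R + 1 -> b%:R <= s' <= b%:R + 1 -> `|s - s'| < dl ->
    `|tent a s - tent a s'| <= 2 * e.
  move=> hs hs' ss'; rewrite !(@tentE _ b)// /tentb.
  have e1 : s - s' = (s - b%:R) - (s' - b%:R) by ring.
  rewrite e1 in ss'.
  move: ss' hs hs'; rewrite -!lerBlDl -!(subr_ge0 b%:R); move: (s - b%:R) (s' - b%:R).
  move=> x x' ss' /andP[x0 x1] /andP[x'0 x'1].
  have h1 : `|a b x - a b x'| <= e by apply: uc => //; apply/andP; split; lra.
  have h2 : `|a b.+1 (x - 1) - a b.+1 (x' - 1)| <= e.
    apply: uc; [by apply/andP; split; lra..|].
    by rewrite (_ : x - 1 - (x' - 1) = x - x')//; ring.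
  have /andP[h3 h4] := a01 b x'; have /andP[h5 h6] := a01 b.+1 (x' - 1).
  have -> : (1 - x) * a b x + x * a b.+1 (x - 1) - ((1 - x') * a b x' + x' * a b.+1 (x' - 1)) =
    (1 - x) * (a b x - a b x') + x * (a b.+1 (x - 1) - a b.+1 (x' - 1)) +
    (x - x') * (a b.+1 (x' - 1) - a b x') by ring.
  apply: le_trans (ler_normD _ _) _.
  have k1 : `|(x - x') * (a b.+1 (x' - 1) - a b x')| <= e.
    rewrite normrM -[leRHS]mulr1; apply: ler_pM => //; first by apply: le_trans (ltW ss') de.
    by rewrite ler_norml; apply/andP; split; lra.
  have k2 : `|(1 - x) * (a b x - a b x') + x * (a b.+1 (x - 1) - a b.+1 (x' - 1))| <= e.
    apply: le_trans (ler_normD _ _) _; rewrite !normrM.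
    rewrite (ger0_norm (_ : 0 <= 1 - x)) ?subr_ge0// (ger0_norm x0).
    have x1' : 0 <= 1 - x by rewrite subr_ge0.
    have := ler_wpM2l x1' h1; have := ler_wpM2l x0 h2; lra.
  lra.
wlog tt : t t' / t <= t'.
  move=> H t0 t'0; have [tt|tt] := leP t t'; first exact: H.
  by rewrite distrC => h; rewrite distrC; apply: H => //; exact: ltW.
move=> t0 t'0 dtt.
have /andP[b1 b2] := truncn_itv t0; rewrite -natr1 in b2.
move: b1 b2; set b := Num.truncn t => b1 b2.
have e0 : 0 <= e by apply: le_trans de; exact: le_trans (normr_ge0 _) (ltW dtt).
have dtt' : t' - t < dl by rewrite -(ger0_norm (_ : 0 <= t' - t)) ?subr_ge0// distrC.
have [t'b|bt'] := leP t' (b%:R + 1).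
  have := same b t t'; rewrite b1 (ltW b2) t'b (le_trans b1 tt) => /(_ isT isT dtt); lra.
have h1 : `|tent a t - tent a (b%:R + 1)| <= 2 * e.
  apply: (same b); [by rewrite b1 ltW|by rewrite lerDl lexx ler01|].
  by rewrite ler0_norm; lra.
have h2 : `|tent a (b%:R + 1) - tent a t'| <= 2 * e.
  apply: (same b.+1); rewrite -?natr1.
  - by rewrite lexx lerDl ler01.
  - by apply/andP; split; lra.
  - by rewrite ler0_norm; lra.
have -> : tent a t - tent a t' = (tent a t - tent a (b%:R + 1)) + (tent a (b%:R + 1) - tent a t') by ring.
by apply: le_trans (ler_normD _ _) _; lra.
Qed.

(** Freezes the weights at those of [t] while the scales move by [s], so that sums over several
    shifts can be bounded level by level; [3 * s] pays for the weights and a possible change of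
    level. *)
Lemma tent_shift_le t s b x : 0 <= t -> 0 <= s -> s < 1 ->
  b = Num.truncn t -> x = t - b%:R ->
  tent a (t + s) <= (1 - x) * a b (x + s) + x * a b.+1 (x - 1 + s) + 3 * s.
Proof.
move=> t0 s0 s1 eb ex; have /andP[x0 x1] := truncn_frac t0; rewrite -eb -ex in x0 x1.
have tE : t = b%:R + x by rewrite ex; ring.
have [xs|xs] := leP (x + s) 1.
  rewrite (@tentE _ b); last by rewrite tE -!addrA lerDl addr_ge0//= lerD2l.
  rewrite /tentb; have -> : t + s - b%:R = x + s by rewrite ex; ring.
  have -> : x + s - 1 = x - 1 + s by ring.
  have /andP[h1 h2] := a01 b (x + s); have /andP[h3 h4] := a01 b.+1 (x - 1 + s).
  have := ler_wpM2l s0 h4; have := ler_wpM2l s0 h1; lra.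
rewrite (@tentE _ b.+1); last by rewrite tE -natr1; apply/andP; split; lra.
rewrite /tentb; have -> : t + s - b.+1%:R = x - 1 + s by rewrite ex -natr1; ring.
have /andP[h1 h2] := a01 b (x + s); have /andP[h3 h4] := a01 b.+1 (x - 1 + s).
have /andP[h5 h6] := a01 b.+2 (x - 1 + s - 1).
have k1 : (x - 1 + s) * a b.+2 (x - 1 + s - 1) <= x - 1 + s.
  by rewrite ler_piMr//; lra.
have k2 : 0 <= (1 - x) * a b (x + s) by rewrite mulr_ge0//; lra.
have k3 : (1 - (x - 1 + s) - x) * a b.+1 (x - 1 + s) <= 1 - x.
  apply: (@le_trans _ _ ((1 - x) * a b.+1 (x - 1 + s))); last by rewrite ler_piMr//; lra.
  by rewrite ler_wpM2r//; lra.
lra.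
Qed.

End Bounded.

Lemma tent_succ a a' t : 0 <= t -> (forall i x, a i x <= a' i.+1 x) ->
  tent a t <= tent a' (t + 1).
Proof.
move=> t0 h; have /andP[h0 h1] := truncn_frac t0.
have e : Num.truncn (t + 1) = (Num.truncn t).+1.
  have /andP[k1 k2] := truncn_itv t0.
  by apply: truncn_def; rewrite -![_.+1%:R]natr1 lerD2r ltrD2r k1 natr1.
rewrite /tent e; have -> : t + 1 - (Num.truncn t).+1%:R = t - (Num.truncn t)%:R by rewrite -natr1; ring.
by rewrite lerD// ler_wpM2l// subr_ge0 ltW.
Qed.

End Tent.

(** * From the mean energy at nearby scales to the limsup along irrational times *)

Section FlowFourier.
Context {R : realType} {d : measure_display} {X : measurableType d}.
Variable P : probability X R.
Local Notation Ex := (Ex P).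
Local Notation prb := (prb P).
Variables (T : X -> X) (alpha : R).
Hypothesis pT : preserving P T.
Hypothesis alpha0 : 0 < alpha.
Hypothesis dens : forall y e : R, 0 < e -> exists k b : nat, `|k%:R * alpha - b%:R - y| < e.
Context {D : finType}.
Variable dz : X -> D.
Hypothesis mdz : mlab dz.
Variables F G : R -> X -> R.
Hypotheses (bF : forall x, bmf (F x)) (bG : forall x, bmf (G x)).
Hypotheses (F1 : forall x z, `|F x z| <= 1) (G1 : forall x z, `|G x z| <= 1).
Hypothesis ucFG : forall e : R, 0 < e -> exists2 dl, 0 < dl & forall x x' z,
  -1 <= x <= 1 -> -1 <= x' <= 1 -> `|x - x'| < dl -> `|F x z - F x' z| <= e /\ `|G x z - G x' z| <= e.

Definition psi t z := tent (fun i x => phimax P T dz (F x) (G x) i z) t.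

Let U i x := Ex (phi P T dz (F x) (G x) i).

Let phimax01 i x z : 0 <= phimax P T dz (F x) (G x) i z <= 1.
Proof.
rewrite phimax_ge0/=; apply: phimax_le => // l li; exact: phi_le1.
Qed.

Let U01 i x : 0 <= U i x <= 1.
Proof.
apply/andP; split; first by apply: Ex_ge0 => z; exact: phi_ge0.
rewrite -[leRHS](Ex_cst P); apply: Ex_le; [exact: bmf_phi|exact: bmf_cst|] => z.
exact: phi_le1.
Qed.

Lemma bmf_psi t : bmf (psi t).
Proof.
by apply: bmfD; apply: bmfZ; exact: bmf_phimax.
Qed.

Lemma psi_uc (e : R) : 0 < e -> exists2 dl, 0 < dl & forall t t' z,
  0 <= t -> 0 <= t' -> `|t - t'| < dl -> `|psi t z - psi t' z| <= e.
Proof.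
move=> e0; have e8 : 0 < e / 8 by rewrite divr_gt0.
have [dl dl0 hdl] := ucFG e8.
exists (Num.min dl (Num.min (e / 4) 1)); first by rewrite !lt_min dl0 divr_gt0//=.
move=> t t' z t0 t'0 tt'; have -> : e = 4 * (e / 4) by field.
apply: (@tent_uc _ (fun i x => phimax P T dz (F x) (G x) i z) (fun i x => phimax01 i x z)
  _ (Num.min dl (Num.min (e / 4) 1))) => //.
- by rewrite !ge_min lexx !orbT.
- by rewrite !ge_min lexx !orbT.
- move=> i x x' hx hx'; rewrite !lt_min => /and3P[xx' _ _].
  have -> : e / 4 = 2 * (e / 8) by field.
  by apply: phimax_lip => // y; have [] := hdl x x' y hx hx' xx'.
Qed.

Let K t := tent U t.

Let K_uc (e : R) : 0 < e -> exists2 dl, 0 < dl & forall t t',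
  0 <= t -> 0 <= t' -> `|t - t'| < dl -> `|K t - K t'| <= e.
Proof.
move=> e0; have e8 : 0 < e / 8 by rewrite divr_gt0.
have [dl dl0 hdl] := ucFG e8.
exists (Num.min dl (Num.min (e / 4) 1)); first by rewrite !lt_min dl0 divr_gt0//=.
move=> t t' t0 t'0 tt'; have -> : e = 4 * (e / 4) by field.
apply: (@tent_uc _ U U01 _ (Num.min dl (Num.min (e / 4) 1))) => //.
- by rewrite !ge_min lexx !orbT.
- by rewrite !ge_min lexx !orbT.
- move=> i x x' hx hx'; rewrite !lt_min => /and3P[xx' _ _].
  rewrite /U -ExB; [|exact: bmf_phi..].
  apply: Ex_norm_le; first by apply: bmfB; exact: bmf_phi.
  move=> z; have -> : e / 4 = 2 * (e / 8) by field.
  by apply: phi_lip => // y; have [] := hdl x x' y hx hx' xx'.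
Qed.

Let K_succ t (b : nat) : 0 <= t -> K t <= K (t + b%:R).
Proof.
move=> t0; elim: b => [|b ih]; first by rewrite addr0.
apply: le_trans ih _; rewrite -natr1 addrA; apply: tent_succ; first by rewrite addr_ge0.
by move=> i x; exact: Ex_phi_mono.
Qed.

Let K01 t : 0 <= t -> 0 <= K t <= 1. Proof. exact: tent01. Qed.

Let ka0 (k : nat) : 0 <= k%:R * alpha. Proof. by rewrite mulr_ge0// ltW. Qed.

(** With k0 alpha - b close to -s, monotonicity under integer shifts gives K (k alpha) at most K (k
    alpha + b), which is nearly K ((k0 + k) alpha + s); dropping [k0] terms costs a bounded
    amount. *)
Let K_translate s (e : R) : 0 <= s -> 0 < e -> exists N1, forall N, (N1 <= N)%N ->
  \sum_(k < N) K (k%:R * alpha) <= \sum_(k < N) K (k%:R * alpha + s) + N%:R * e.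
Proof.
move=> s0 e0; have e20 : 0 < e / 2 by rewrite divr_gt0.
have [dl dl0 hdl] := K_uc e20.
have [k0 [b kb]] := dens (- s) dl0.
have [N1 hN1] := exists_nat_ge ((k0 + k0)%:R / (e / 2)).
exists N1 => N N1N.
have h1 k : K (k%:R * alpha) <= K ((k0 + k)%:R * alpha + s) + e / 2.
  apply: (@le_trans _ _ (K (k%:R * alpha + b%:R))); first exact: K_succ.
  have := hdl ((k0 + k)%:R * alpha + s) (k%:R * alpha + b%:R).
  rewrite !addr_ge0// => /(_ isT isT).
  have -> : (k0 + k)%:R * alpha + s - (k%:R * alpha + b%:R) = k0%:R * alpha - b%:R - - s.
    by rewrite natrD; ring.
  by move=> /(_ kb); rewrite ler_distl => /andP[]; lra.
have := sum_le_shift N h1.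
have K1 k : `|K (k%:R * alpha + s)| <= 1.
  by have /andP[h2 h3] := K01 (addr_ge0 (ka0 k) s0); rewrite ger0_norm.
have := sum_shift_diff k0 N K1; rewrite ler_distl mulr1 => /andP[_ h2] h3.
have : (k0 + k0)%:R <= N%:R * (e / 2).
  by rewrite -ler_pdivrMr//; apply: le_trans hN1 _; rewrite ler_nat.
lra.
Qed.

Variables (M : nat) (s : nat -> R) (smax c0 : R).
Hypothesis M0 : (0 < M)%N.
Hypothesis s01 : forall r, (r < M)%N -> 0 <= s r < 1.
Hypothesis sle : forall r, (r < M)%N -> s r <= smax.
Hypothesis hU : forall i x, -1 <= x <= 1 -> \sum_(r < M) U i (x + s r) <= M%:R * c0.

Let K_avg t : 0 <= t -> \sum_(r < M) K (t + s r) <= M%:R * (c0 + 3 * smax).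
Proof.
move=> t0; have /andP[x0 x1] := truncn_frac t0.
move: x0 x1; set b := Num.truncn t; set x := t - b%:R => x0 x1.
apply: (@le_trans _ _ (\sum_(r < M) ((1 - x) * U b (x + s r) + x * U b.+1 (x - 1 + s r) + 3 * smax))).
  apply: ler_sum => r _; have /andP[h1 h2] := s01 (ltn_ord r).
  apply: le_trans (tent_shift_le U01 t0 h1 h2 erefl erefl) _; rewrite -/b -/x.
  by rewrite lerD2l ler_pM2l// sle.
rewrite !big_split/= -!mulr_sumr sumr_const card_ord -[_ *+ M]mulr_natl.
have h1 : \sum_(r < M) U b (x + s r) <= M%:R * c0 by apply: hU; apply/andP; split; lra.
have h2 : \sum_(r < M) U b.+1 (x - 1 + s r) <= M%:R * c0 by apply: hU; apply/andP; split; lra.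
have x1' : 0 <= 1 - x by lra.
have := ler_wpM2l x1' h1; have := ler_wpM2l x0 h2; lra.
Qed.

(** Averaging [K_translate] over the [M] shifts replaces each term by a mean over scales, to which
    [K_avg] applies. *)
Let K_mean (e : R) : 0 < e -> exists N1, forall N, (N1 <= N)%N ->
  \sum_(k < N) K (k%:R * alpha) <= N%:R * (c0 + 3 * smax + e).
Proof.
move=> e0.
have /choice[Nf hNf] : forall r, exists N1, (r < M)%N -> forall N, (N1 <= N)%N ->
  \sum_(k < N) K (k%:R * alpha) <= \sum_(k < N) K (k%:R * alpha + s r) + N%:R * e.
  move=> r; have [rM|rM] := ltnP r M; last by exists 0%N.
  by have /andP[h1 _] := s01 rM; have [N1 h] := K_translate h1 e0; exists N1.
exists (\max_(r < M) Nf r) => N hN.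
have cst n (x : R) : \sum_(r < n) x = n%:R * x by rewrite sumr_const card_ord mulr_natl.
have h2 : M%:R * \sum_(k < N) K (k%:R * alpha) <=
    \sum_(r < M) \sum_(k < N) K (k%:R * alpha + s r) + M%:R * (N%:R * e).
  rewrite -(cst M (N%:R * e)) -(cst M (\sum_(k < N) K (k%:R * alpha))) -big_split/=.
  apply: ler_sum => r _; apply: hNf => //; apply: leq_trans hN.
  exact: (leq_bigmax r).
rewrite exchange_big/= in h2.
have h1 : \sum_(k < N) \sum_(r < M) K (k%:R * alpha + s r) <= N%:R * (M%:R * (c0 + 3 * smax)).
  by rewrite -cst; apply: ler_sum => k _; exact: K_avg.
have MR : 0 < M%:R :> R by rewrite ltr0n.
rewrite -(ler_pM2l MR); apply: le_trans h2 _; apply: le_trans (lerD h1 (lexx _)) _.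
by rewrite le_eqVlt; apply/orP; left; apply/eqP; ring.
Qed.

Lemma flow_fourier lam l : 0 < lam -> 0 < l ->
  l * prb [set z | io_avg (fun k => psi (k%:R * alpha) z) (3 * l)] <= lam + (c0 + 3 * smax) / lam.
Proof.
move=> lam0 l0.
(* [flow_bound] asks for bounds at every real time, while [tent] is controlled only at nonnegative
   ones. *)
pose Psi t := psi (Num.max t 0).
have PsiE t : 0 <= t -> Psi t = psi t by move=> t0; rewrite /Psi max_l.
have m0 (t : R) : 0 <= Num.max t 0 by rewrite le_max lexx orbT.
have -> : [set z | io_avg (fun k => psi (k%:R * alpha) z) (3 * l)] =
    [set z | io_avg (fun k => Psi (0 + k%:R * alpha) z) (3 * l)].
  by congr mkset; apply/funext => z; congr (io_avg _ _); apply/funext => k; rewrite add0r PsiE.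
apply: (@flow_bound _ _ _ P T alpha Psi) => //.
- by move=> t; exact: bmf_psi.
- by move=> t z; exact: (tent01 (fun i x => phimax01 i x z) (m0 t)).
- move=> e e0; have [dl dl0 hdl] := psi_uc e0; exists dl => // t t' z t0 t'0 tt'.
  by rewrite !PsiE//; exact: hdl.
- move=> t z t0; rewrite !PsiE//; last by rewrite addr_ge0.
  by apply: tent_succ => // i x; exact: phimax_shift.
move=> e e0; have [N1 hN1] := K_mean (mulr_gt0 e0 lam0).
exists N1 => N /hN1 hK.
(* [doob] at both levels of the tent; [lam] passes through because the weights add up to 1. *)
apply: (@le_trans _ _ (\sum_(k < N) (lam + K (k%:R * alpha) / lam))).
  apply: ler_sum => k _; rewrite PsiE//.
  have /andP[x0 x1] := truncn_frac (ka0 k).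
  rewrite /psi /tent; move: x0 x1; set b := Num.truncn _; set x := _ - b%:R => x0 x1.
  have bp i y : bmf (phimax P T dz (F y) (G y) i) by exact: bmf_phimax.
  rewrite (ExD P (bmfZ _ (bp _ _)) (bmfZ _ (bp _ _))) (ExZ P _ (bp _ _)) (ExZ P _ (bp _ _)).
  have h1 : Ex (phimax P T dz (F x) (G x) b) <= lam + U b x / lam by exact: doob.
  have h2 : Ex (phimax P T dz (F (x - 1)) (G (x - 1)) b.+1) <= lam + U b.+1 (x - 1) / lam by exact: doob.
  have x1' : 0 <= 1 - x by lra.
  rewrite /K /tent -/b -/x; have := ler_wpM2l x1' h1; have := ler_wpM2l x0 h2.
  move: (Ex _) (Ex _) (U b x) (U b.+1 (x - 1)) => u v w y; rewrite mulrDl; lra.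
rewrite big_split/= sumr_const card_ord -mulr_suml -[_ *+ N]mulr_natl.
apply: le_trans (lerD (lexx _) (ler_wpM2r (_ : 0 <= lam^-1) hK)) _; first by rewrite invr_ge0 ltW.
rewrite le_eqVlt; apply/orP; left; apply/eqP; field; exact: lt0r_neq0.
Qed.

End FlowFourier.

(** * Averaging over an arithmetic progression of scales *)

Section Trig.
Context {R : realType}.
Implicit Types x y w : R.

Lemma trig_mvt (f f' : R -> R) x y : (forall z : R, is_derive z (1 : R) f (f' z)) -> x <= y ->
  exists2 c, x <= c <= y & f y - f x = f' c * (y - x).
Proof.
move=> df xy.
have cf : {within `[x, y], continuous f}.
  by apply: derivable_within_continuous => z _; exact: ex_derive.
have [c cxy ->] := MVT_segment xy (fun z _ => df z) cf.
by exists c => //; move: cxy; rewrite in_itv.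
Qed.

Let lip (f f' : R -> R) : (forall z : R, is_derive z (1 : R) f (f' z)) -> (forall z, `|f' z| <= 1) ->
  forall x y, `|f x - f y| <= `|x - y|.
Proof.
move=> df f1 x y; wlog xy : x y / x <= y.
  move=> H; have [xy|xy] := leP x y; first exact: H.
  by rewrite distrC (distrC x); apply: H; exact: ltW.
have [c _ e] := trig_mvt df xy.
by rewrite distrC (distrC x) e normrM ler_piMl.
Qed.

Lemma cos_lip x y : `|cos x - cos y| <= `|x - y|.
Proof. by apply: (@lip cos (fun z => - sin z)) => z; rewrite normrN sin_max. Qed.

Lemma sin_lip x y : `|sin x - sin y| <= `|x - y|.
Proof. by apply: (@lip sin cos) => z; rewrite cos_max. Qed.

Lemma sin_ge_half x : 0 <= x <= 2^-1 -> x / 2 <= sin x.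
Proof.
move=> /andP[x0 x1]; have [c /andP[c0 cx]] := trig_mvt (@is_derive_sin R) x0.
rewrite sin0 !subr0 => ->; rewrite mulrC ler_wpM2r//.
have := cos_lip c 0; rewrite cos0 subr0 (ger0_norm c0) ler_distl => /andP[+ _].
by have := le_trans cx x1; lra.
Qed.

(** Each product 2 sin (w / 2) cos is a difference of two sines, and the sum telescopes. *)
Lemma cos_sum y w n : 2 * sin (w / 2) * (\sum_(r < n) cos (y + r%:R * w)) =
  sin (y + n%:R * w - w / 2) - sin (y - w / 2).
Proof.
elim: n => [|n ih]; first by rewrite big_ord0 mulr0 mul0r addr0 subrr.
rewrite big_ord_recr/= mulrDr ih -[n.+1%:R]natr1.
have -> : y + (n%:R + 1) * w - w / 2 = (y + n%:R * w) + w / 2 by field.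
rewrite (sinB (y + n%:R * w)) (sinD (y + n%:R * w)); ring.
Qed.

Lemma cos_sum_bound y w n : 0 < `|w| <= 1 -> `|\sum_(r < n) cos (y + r%:R * w)| <= 4 / `|w|.
Proof.
move=> /andP[w0 w1].
have s0 : `|w| / 4 <= `|sin (w / 2)|.
  have h : `|w| / 4 <= sin (`|w| / 2).
    have -> : `|w| / 4 = (`|w| / 2) / 2 by field.
    by apply: sin_ge_half; apply/andP; split; lra.
  have [wp|wn] := leP 0 w; first by apply: le_trans (ler_norm _); rewrite -{2}(ger0_norm wp).
  apply: le_trans h _; rewrite ltr0_norm// mulNr sinN -(normrN (sin _)); exact: ler_norm.
have : `|w| / 2 * `|\sum_(r < n) cos (y + r%:R * w)| <= 2.
  apply: (@le_trans _ _ `|2 * sin (w / 2) * (\sum_(r < n) cos (y + r%:R * w))|).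
    rewrite normrM ler_wpM2r// normrM (ger0_norm (_ : 0 <= 2))//; lra.
  rewrite cos_sum; apply: le_trans (ler_normB _ _) _.
  by have := @sin_max R (y + n%:R * w - w / 2); have := @sin_max R (y - w / 2); lra.
rewrite ler_pdivlMr//; lra.
Qed.

End Trig.

Section CondSum.
Context {R : realType} {d : measure_display} {X : measurableType d}.
Variable P : probability X R.

Lemma cond_sum (F : finType) (U : X -> F) n (f : nat -> X -> R) z : mlab U ->
  (forall r, bmf (f r)) -> 0 < prb P (atom U z) ->
  cond P U (fun z => \sum_(r < n) f r z) z = \sum_(r < n) cond P U (f r) z.
Proof.
move=> mU bf p0; elim: n => [|n ih].
  rewrite big_ord0 -[RHS](cond_cst 0 mU p0); congr cond.
  by apply/funext => y; rewrite big_ord0.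
rewrite big_ord_recr/= -ih -condD//; last by apply: bmf_sum => r; exact: bf.
by congr cond; apply/funext => y; rewrite big_ord_recr.
Qed.

End CondSum.

(** * Energy of conditional averages over an arithmetic progression of frequencies *)

Section Scales.
Context {R : realType} {d : measure_display} {X : measurableType d}.
Variable P : probability X R.
Local Notation Ex := (Ex P).
Local Notation prb := (prb P).
Variable T : X -> X.
Hypothesis pT : preserving P T.
Variable p : nat.
Hypothesis hp : (2 <= p)%N.
Variable u : X -> R.
Hypothesis mu : measurable_fun [set: X] u.
Hypothesis u01 : forall z, 0 <= u z < 1.
Hypothesis uT : forall z, u (T z) = Tq p (u z).
Context {D : finType}.
Variable dz : X -> D.
Hypothesis mdz : mlab dz.

Let dx := dig p \o u.
Let mdx : mlab dx. Proof. exact: mlab_dig. Qed.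
Let p0 : 0 < p%:R :> R. Proof. by rewrite ltr0n; exact: leq_trans hp. Qed.
Let p1 : 1 < p%:R :> R. Proof. by rewrite ltr1n. Qed.
Let lnp0 : 0 < ln p%:R :> R. Proof. exact: ln_gt0. Qed.
Let piter k : preserving P (iter k T). Proof. exact: preserving_iter. Qed.
Let mwz n : mlab (wd T dz n). Proof. exact: (mlab_wd pT mdz). Qed.
Let mjoint i n : mlab (joint T dz dx i n). Proof. exact: (mlab_joint pT mdz mdx). Qed.
Let u_iter k z : u (iter k T z) = iter k (Tq p) (u z).
Proof. by elim: k => //= k ih; rewrite uT ih. Qed.

Lemma measurable_num n c : measurable [set z | numer p n (u z) = c].
Proof.
have mn : measurable_fun setT (fun x : R => (numer p n x)%:R : R).
  apply: nondecreasing_measurable => // x y xy; rewrite ler_nat.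
  by rewrite /numer le_truncn// ler_wpM2l// exprn_ge0// ltW.
have := measurableT_comp mn mu; move=> /(_ measurableT [set c%:R]).
rewrite setTI => /(_ (measurable_set1 _)).
by congr measurable; apply/seteqP; split => z /= => [/eqP|->//]; rewrite eqr_nat => /eqP.
Qed.

Section Prediction.
Variables (n : nat) (e1 : R).
Hypothesis e10 : 0 <= e1.

Let heavy i := [set z | e1 <= predict P T dz dx i n z].

Let mheavy i : measurable (heavy i).
Proof. by apply: measurable_ge; exact: (bmf_predict pT mdz mdx). Qed.

(* A cell of generation [n] meeting the light part of the atom is no heavier than [e1] there. *)
Lemma cond_cell i c z : 0 < prb (atom (wd T dz i) z) ->
  cond P (wd T dz i) \1_[set z' | numer p n (u (iter i T z')) = c] z <=
  e1 + cond P (wd T dz i) \1_(heavy i) z.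
Proof.
move=> A0; set A := atom _ z in A0; set C := [set z' | _ = c].
have mA : measurable A by exact: measurable_atom.
have mC : measurable C by exact: (preimage_measurable (piter i) (measurable_num n c)).
have condE B : measurable B -> cond P (wd T dz i) \1_B z = prb (B `&` A) / prb A.
  move=> mB; rewrite /cond -(Ex_indic P (measurableI _ _ mB mA)); congr (Ex _ / _).
  by apply/funext => z'; rewrite indicI.
rewrite !condE//.
have [[z0 [Cz0 Az0 pz0]]|H] := pselect (exists z0, [/\ C z0, A z0 & predict P T dz dx i n z0 < e1]).
  apply: (@le_trans _ _ e1); last by rewrite lerDl divr_ge0// prb_ge0.
  apply: le_trans (ltW pz0); rewrite /predict.
  have -> : atom (wd T dz i) z0 = A by rewrite /atom Az0.
  rewrite ler_wpM2r ?invr_ge0 ?prb_ge0//; apply: prb_le.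
  - exact: measurableI.
  - exact: measurable_atom.
  move=> z' [Cz' Az']; rewrite /atom /= /joint; apply/pair_equal_spec; split; first by rewrite Az' Az0.
  apply/wdP => k kn; rewrite /dx/= 2!(u_iter k).
  exact: (numer_word hp (u01 _) (u01 _) (etrans Cz' (esym Cz0)) kn).
apply: (@le_trans _ _ (prb (heavy i `&` A) / prb A)); last by rewrite lerDr.
rewrite ler_wpM2r ?invr_ge0 ?prb_ge0//; apply: prb_le; [exact: measurableI..|].
move=> z' [Cz' Az']; split => //; rewrite /heavy/= leNgt; apply/negP => h; apply: H.
by exists z'.
Qed.

Variables (J : R) (M : nat).
Hypothesis J0 : J != 0.

(** The frequency is J p^x with a real exponent [x], which later ranges over [-1, 1]. *)
Definition cwave (x : R) z := cos (J * expR (x * ln p%:R) * u z).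
Definition swave (x : R) z := sin (J * expR (x * ln p%:R) * u z).

Lemma bmf_cwave x : bmf (cwave x).
Proof.
split; last by exists 1 => z; exact: cos_max.
apply: measurableT_comp; first by apply: continuous_measurable_fun; exact: continuous_cos.
exact: measurable_funM.
Qed.

Lemma bmf_swave x : bmf (swave x).
Proof.
split; last by exists 1 => z; exact: sin_max.
apply: measurableT_comp; first by apply: continuous_measurable_fun; exact: continuous_sin.
exact: measurable_funM.
Qed.

Lemma wave_uc (e : R) : 0 < e -> exists2 dl, 0 < dl & forall x x' z,
  -1 <= x <= 1 -> -1 <= x' <= 1 -> `|x - x'| < dl ->
  `|cwave x z - cwave x' z| <= e /\ `|swave x z - swave x' z| <= e.
Proof.
move=> e_gt0; pose L := `|J| * p%:R * ln p%:R.
have L0 : 0 < L by rewrite !mulr_gt0// normr_gt0.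
exists (e / L); first by rewrite divr_gt0.
move=> x x' z hx hx' xx'.
suff h : `|J * expR (x * ln p%:R) * u z - J * expR (x' * ln p%:R) * u z| <= e.
  by split; [apply: le_trans (cos_lip _ _) h|apply: le_trans (sin_lip _ _) h].
have {}xx' : `|x - x'| * L <= e by rewrite -ler_pdivlMr// ltW.
apply: le_trans xx'; wlog le : x x' hx hx' / x <= x'.
  move=> H; have [le|le] := leP x x'; first exact: H.
  by rewrite distrC (distrC x); apply: H => //; exact: ltW.
have /andP[u0 u1] := u01 z.
have le' : x * ln p%:R <= x' * ln p%:R by rewrite ler_pM2r.
have [c /andP[_ cx] ec] := trig_mvt (@is_derive_expR R) le'.
have /andP[_ hx'1] := hx'.
have cp : expR c <= p%:R.
  rewrite -[leRHS]lnK ?posrE// ler_expR; apply: le_trans cx _.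
  by rewrite ler_piMl// ltW.
have -> : J * expR (x * ln p%:R) * u z - J * expR (x' * ln p%:R) * u z =
  - (J * (expR (x' * ln p%:R) - expR (x * ln p%:R)) * u z) by ring.
rewrite ec -mulrBl normrN !normrM (ger0_norm (expR_ge0 c)) (gtr0_norm lnp0) (ger0_norm u0) (distrC x' x).
have -> : `|x - x'| * L = `|J| * ((p%:R * (`|x - x'| * ln p%:R)) * 1) by rewrite /L; ring.
rewrite -!(mulrA `|J|) ler_wpM2l//.
have h0 : 0 <= `|x - x'| * ln p%:R by rewrite mulr_ge0// ltW.
apply: ler_pM => //; [by rewrite mulr_ge0// expR_ge0|by rewrite ler_wpM2r|exact: ltW].
Qed.

(** For x at most 1 and points of [0, 1) the increment of the phase from one frequency to the next
    is then at most 1 in absolute value, as [cos_sum_bound] requires. *)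
Let delta := (`|J| * p%:R)^-1.

(** Chosen so that p^(scale r) = 1 + r delta: equally spaced frequencies, written as shifts of the
    exponent. *)
Definition scale (r : nat) : R := ln (1 + r%:R * delta) / ln p%:R.

Let delta0 : 0 < delta. Proof. by rewrite invr_gt0 mulr_gt0// normr_gt0. Qed.

Let scale_ge1 r : 1 <= 1 + r%:R * delta. Proof. by rewrite lerDl mulr_ge0// ltW. Qed.

Lemma expR_scale x r : expR ((x + scale r) * ln p%:R) = expR (x * ln p%:R) * (1 + r%:R * delta).
Proof.
rewrite mulrDl expRD /scale divfK ?gt_eqF// lnK// posrE; exact: lt_le_trans (scale_ge1 r).
Qed.

Let y x r := J * expR (x * ln p%:R) * (1 + r%:R * delta).

(** The phase step is at least p^(-(n + 2)): a factor p^(-n) from the distance, one 1/p from x >= -1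
    and one from [delta]. *)
Lemma wave_sum (x v v' : R) : -1 <= x <= 1 -> 0 <= v < 1 -> 0 <= v' < 1 ->
  (p%:R ^+ n)^-1 <= `|v - v'| -> \sum_(r < M) cos (y x r * (v - v')) <= 4 * p%:R ^+ n.+2.
Proof.
move=> /andP[x0 x1] /andP[v0 v1] /andP[v'0 v'1] vv'.
pose w := J * expR (x * ln p%:R) * delta * (v - v').
have pn : 0 < p%:R ^+ n :> R by rewrite exprn_gt0.
have lo : p%:R ^-1 <= expR (x * ln p%:R).
  rewrite -[leLHS]lnK ?posrE ?invr_gt0// ler_expR lnV ?posrE//.
  by rewrite -mulN1r ler_pM2r.
have hi : expR (x * ln p%:R) <= p%:R.
  by rewrite -[leRHS]lnK ?posrE// ler_expR ler_piMl// ltW.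
have wE : `|w| = expR (x * ln p%:R) / p%:R * `|v - v'|.
  rewrite /w !normrM (ger0_norm (expR_ge0 _)) (gtr0_norm delta0) /delta.
  by field; rewrite normr_eq0 J0 gt_eqF.
have w1 : `|w| <= 1.
  rewrite wE -[leRHS]mulr1; apply: ler_pM => //.
  - by rewrite ler_pdivrMr// mul1r.
  - by rewrite ler_norml; apply/andP; split; lra.
have w0 : (p%:R ^+ n.+2)^-1 <= `|w|.
  rewrite wE !exprS !invfM mulrA; apply: ler_pM => //.
  by rewrite ler_wpM2r// invr_ge0 ltW.
have pn2 : 0 < p%:R ^+ n.+2 :> R by rewrite exprn_gt0.
have w00 : 0 < `|w| by apply: lt_le_trans w0; rewrite invr_gt0.
have -> : \sum_(r < M) cos (y x r * (v - v')) =
    \sum_(r < M) cos (J * expR (x * ln p%:R) * (v - v') + r%:R * w).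
  by apply: eq_bigr => r _; rewrite /y /w; congr cos; ring.
apply: le_trans (ler_norm _) _; apply: le_trans (cos_sum_bound _ _ _) _; first by rewrite w00.
by rewrite ler_pM2l// -[leRHS]invrK lef_pV2 ?posrE ?invr_gt0.
Qed.

(** The sum of squared moduli is half the double average over the atom of the sums of cos (y (v z' -
    v z'')). Distant pairs are handled by [wave_sum]; close pairs lie in equal or adjacent cells,
    which [cond_cell] makes light. *)
Lemma phi_sum i (x : R) z : -1 <= x <= 1 -> 0 < prb (atom (wd T dz i) z) ->
  \sum_(r < M) phi P T dz (cwave (x + scale r)) (swave (x + scale r)) i z <=
  (M%:R * (3 * (e1 + cond P (wd T dz i) \1_(heavy i) z)) + 4 * p%:R ^+ n.+2) / 2.
Proof.
move=> hx A0; set Bd := (X in _ <= X / 2).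
pose v z := u (iter i T z).
pose a r := fcond P T dz (cwave (x + scale r)) i z.
pose b r := fcond P T dz (swave (x + scale r)) i z.
have cE r z' : cwave (x + scale r) (iter i T z') = cos (y x r * v z').
  by rewrite /cwave expR_scale mulrA.
have sE r z' : swave (x + scale r) (iter i T z') = sin (y x r * v z').
  by rewrite /swave expR_scale mulrA.
have bc r : bmf (cwave (x + scale r) \o iter i T) by exact: (bmf_fcomp pT i (bmf_cwave _)).
have bs r : bmf (swave (x + scale r) \o iter i T) by exact: (bmf_fcomp pT i (bmf_swave _)).
pose comb c c' r z' := c r * (cwave (x + scale r) \o iter i T) z' +
                     c' r * (swave (x + scale r) \o iter i T) z'.
have bcomb c c' r : bmf (comb c c' r) by apply: bmfD; exact: bmfZ.
have ccomb c c' r : cond P (wd T dz i) (comb c c' r) z = c r * a r + c' r * b r.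
  by rewrite /comb condD ?condZ//; exact: bmfZ.
have bI (B : set X) : measurable B -> bmf (\1_B : X -> R) by exact: bmf_indic.
pose C c := [set z' | numer p n (v z') = c].
have mC c : measurable (C c) by exact: (preimage_measurable (piter i) (measurable_num n c)).
have main z' : \sum_(r < M) comb a b r z' <= Bd.
  pose c := numer p n (v z').
  (* The three cells that can contain a point close to z'. If c = 0 then [c.-1] repeats cell 0,
     which only enlarges the bound. *)
  pose g z'' : R := M%:R * ((\1_(C c) z'' + \1_(C c.+1) z'') + \1_(C c.-1) z'') + 4 * p%:R ^+ n.+2.
  have b2 : bmf (fun z'' => (\1_(C c) z'' + \1_(C c.+1) z'') : R) by apply: bmfD; exact: bI.
  have b3 : bmf (fun z'' => ((\1_(C c) z'' + \1_(C c.+1) z'') + \1_(C c.-1) z'') : R).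
    by apply: bmfD => //; exact: bI.
  have bg : bmf g by apply: bmfD; [exact: bmfZ|exact: bmf_cst].
  have -> : \sum_(r < M) comb a b r z' =
      cond P (wd T dz i) (fun z'' => \sum_(r < M)
        comb (fun r => cos (y x r * v z')) (fun r => sin (y x r * v z')) r z'') z.
    rewrite cond_sum//; apply: eq_bigr => r _.
    by rewrite ccomb /comb /= cE sE; congr (_ + _); rewrite mulrC.
  apply: (@le_trans _ _ (cond P (wd T dz i) g z)).
    apply: cond_le_ae => //; first by apply: bmf_sum => r; exact: bcomb.
    apply: aeW => z'' _.
    have -> : \sum_(r < M) comb (fun r => cos (y x r * v z')) (fun r => sin (y x r * v z')) r z'' =
        \sum_(r < M) cos (y x r * (v z' - v z'')).
      by apply: eq_bigr => r _; rewrite /comb /= cE sE mulrBr cosB.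
    have g0 (B : set X) : (0 : R) <= \1_B z'' by rewrite indicE; case: (_ \in _).
    have Mn : \sum_(r < M) cos (y x r * (v z' - v z'')) <= M%:R.
      apply: (@le_trans _ _ (\sum_(r < M) 1)); last by rewrite sumr_const card_ord.
      by apply: ler_sum => r _; apply: le_trans (ler_norm _) (cos_max _).
    have M0 : 0 <= M%:R :> R by [].
    have pn2 : 0 <= 4 * p%:R ^+ n.+2 :> R by rewrite mulr_ge0// exprn_ge0// ltW.
    have [near|far] := ltP `|v z' - v z''| (p%:R ^+ n)^-1; last first.
      apply: le_trans (wave_sum hx (u01 _) (u01 _) far) _.
      by rewrite lerDr mulr_ge0// !addr_ge0.
    apply: le_trans Mn _; rewrite /g.
    have /andP[v0 _] := u01 (iter i T z'); have /andP[v0' _] := u01 (iter i T z'').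
    suff : 1 <= ((\1_(C c) z'' + \1_(C c.+1) z'') + \1_(C c.-1) z'' : R).
      by move=> /(ler_wpM2l M0); rewrite mulr1 => h; apply: le_trans h _; rewrite lerDl.
    have i1 (B : set X) : B z'' -> \1_B z'' = 1 :> R by move=> h; rewrite indicE mem_set.
    have := g0 (C c); have := g0 (C c.+1); have := g0 (C c.-1).
    have [e|e|e] := numer_adjacent hp v0 v0' near.
    - by rewrite (i1 (C c))//; lra.
    - by rewrite (i1 (C c.+1))//; lra.
    - by rewrite (i1 (C c.-1)) /C/= ?/c -?e//; lra.
  rewrite /g (condD P z (@mwz i) (bmfZ _ b3) (bmf_cst _)) cond_cst//.
  rewrite (condZ P _ z (@mwz i) b3) (condD P z (@mwz i) b2 (bI _ (mC _))).
  rewrite (condD P z (@mwz i) (bI _ (mC _)) (bI _ (mC _))).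
  rewrite lerD2r ler_wpM2l//.
  have := cond_cell c A0; have := cond_cell c.+1 A0; have := cond_cell c.-1 A0.
  by rewrite -!/(C _); lra.
have -> : \sum_(r < M) phi P T dz (cwave (x + scale r)) (swave (x + scale r)) i z =
    cond P (wd T dz i) (fun z' => \sum_(r < M) comb a b r z') z / 2.
  by rewrite cond_sum// mulr_suml; apply: eq_bigr => r _; rewrite ccomb /phi -!expr2.
rewrite ler_pM2r ?invr_gt0// -[leRHS](cond_cst Bd (@mwz i) A0).
apply: cond_le_ae => //; [by apply: bmf_sum => r; exact: bcomb|exact: bmf_cst|].
by apply: aeW => z' _; exact: main.
Qed.

Hypothesis light : forall i, prb (heavy i) <= e1.

Lemma Ex_phi_sum i (x : R) : -1 <= x <= 1 ->
  \sum_(r < M) Ex (phi P T dz (cwave (x + scale r)) (swave (x + scale r)) i) <=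
  3 * e1 * M%:R + 2 * p%:R ^+ n.+2.
Proof.
move=> hx.
have bphi r : bmf (phi P T dz (cwave (x + scale r)) (swave (x + scale r)) i).
  exact: bmf_phi.
rewrite -(Ex_sum P _ _ (fun r : 'I_M => bphi r)).
pose h := cond P (wd T dz i) \1_(heavy i).
have bh : bmf h by exact: bmf_cond.
pose K0 := 3 * e1 * M%:R / 2 + 2 * p%:R ^+ n.+2.
apply: (@le_trans _ _ (Ex (fun z => K0 + (3 * M%:R / 2) * h z))).
  apply: Ex_le_ae; [by apply: bmf_sum => r; exact: bphi
    |by apply: bmfD; [exact: bmf_cst|exact: bmfZ]|].
  apply: filterS (atom_pos_ae P (@mwz i)) => z A0.
  apply: le_trans (phi_sum hx A0) _; rewrite /K0 -/(h z).
  by rewrite le_eqVlt; apply/orP; left; apply/eqP; field.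
rewrite (ExD P (bmf_cst _) (bmfZ _ bh)) Ex_cst (ExZ P _ bh).
have -> : Ex h = prb (heavy i).
  rewrite -Ex_indic// -[LHS]/(Ex (fun z => h z)).
  have := @Ex_cond _ _ _ P _ (wd T dz i) \1_(heavy i) (fun=> 1) (@mwz i) (bmf_indic (mheavy i)) (fun _ _ _ => erefl).
  by under eq_fun do rewrite mulr1; under [X in _ = Ex X -> _]eq_fun do rewrite mulr1.
have M0 : 0 <= 3 * M%:R / 2 :> R by rewrite divr_ge0// mulr_ge0.
have := ler_wpM2l M0 (light i); rewrite /K0; lra.
Qed.

End Prediction.
End Scales.

(** * Equidistribution of characters *)

(** Trades amplitudes for energies: errors are linear in the conditional averages, whereas [phi]
    controls their squares. *)
Lemma norm_add_amgm {R : realType} (a b e : R) : 0 < e ->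
  `|a| + `|b| <= e + (a ^+ 2 + b ^+ 2) / 2 / e.
Proof.
move=> e0; rewrite -(real_normK (num_real a)) -(real_normK (num_real b)); move: `|a| `|b| => x y.
have -> : e + (x ^+ 2 + y ^+ 2) / 2 / e = x + y + ((x - e) ^+ 2 + (y - e) ^+ 2) / (2 * e).
  by field; exact: lt0r_neq0.
by rewrite lerDl divr_ge0 ?addr_ge0 ?sqr_ge0// mulr_ge0// ltW.
Qed.

Lemma dist01_le1 {R : realType} (a b : R) : 0 <= a < 1 -> 0 <= b < 1 -> `|a - b| <= 1.
Proof. by move=> /andP[a0 a1] /andP[b0 b1]; rewrite ler_norml; apply/andP; split; lra. Qed.

Lemma geometric_sum_le {R : realType} (x : R) n : 0 <= x -> 0 < 1 - x ->
  \sum_(k < n) x ^+ k <= (1 - x)^-1.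
Proof.
move=> x0 x1; rewrite -[leRHS]mul1r ler_pdivlMr// mulrC.
have -> : (1 - x) * (\sum_(k < n) x ^+ k) = 1 - x ^+ n.
  elim: n => [|n ih]; first by rewrite big_ord0 mulr0 expr0 subrr.
  by rewrite big_ord_recr/= mulrDr ih exprS; ring.
by rewrite gerBl exprn_ge0.
Qed.

Lemma sum_dist_le {R : realType} (a b f : nat -> R) c e D x n : 0 <= D -> 0 <= x -> 0 < 1 - x ->
  (forall k, `|a k - b k| <= c + f k / e + 2 * (D * x ^+ k)) ->
  `|\sum_(k < n) a k| <= `|\sum_(k < n) b k| + (n%:R * c + (\sum_(k < n) f k) / e + 2 * D * (1 - x)^-1).
Proof.
move=> D0 x0 x1 h.
have -> : \sum_(k < n) a k = \sum_(k < n) b k + \sum_(k < n) (a k - b k).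
  by rewrite -big_split/=; apply: eq_bigr => k _; ring.
apply: le_trans (ler_normD _ _) _; rewrite lerD2l; apply: le_trans (ler_norm_sum _ _ _) _.
apply: (@le_trans _ _ (\sum_(k < n) (c + f k / e + 2 * (D * x ^+ k)))).
  by apply: ler_sum => k _; exact: h.
rewrite !big_split/= sumr_const card_ord -[c *+ n]mulr_natl -mulr_suml -!mulr_sumr lerD2l mulrA.
by rewrite ler_wpM2l ?mulr_ge0// geometric_sum_le.
Qed.

Lemma interpolation_bound {R : realType} (o a b c x c1 e f g f' g' D : R) : 0 <= x -> x < 1 -> 0 < e ->
  0 <= D -> `|o - a| <= c1 + D -> `|b| <= e + f / e + D -> `|c| <= e + g / e + D ->
  f <= f' -> g <= g' ->
  `|o - (a - ((1 - x) * b + x * c))| <= (c1 + e) + ((1 - x) * f' + x * g') / e + 2 * D.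
Proof.
move=> x0 x1 e0 D0 h1 h2 h3 ff gg.
have x1' : 0 <= 1 - x by lra.
have -> : o - (a - ((1 - x) * b + x * c)) = (o - a) + ((1 - x) * b + x * c) by ring.
apply: le_trans (ler_normD _ _) _.
have {}h2 : `|(1 - x) * b| <= (1 - x) * (e + f' / e + D).
  rewrite normrM (ger0_norm x1') ler_wpM2l//; apply: le_trans h2 _.
  by rewrite lerD2r lerD2l ler_pM2r// invr_gt0.
have {}h3 : `|x * c| <= x * (e + g' / e + D).
  rewrite normrM (ger0_norm x0) ler_wpM2l//; apply: le_trans h3 _.
  by rewrite lerD2r lerD2l ler_pM2r// invr_gt0.
have := ler_normD ((1 - x) * b) (x * c).
have -> : ((1 - x) * f' + x * g') / e = (1 - x) * (f' / e) + x * (g' / e) by ring.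
move: (f' / e) (g' / e) h2 h3 h1 => F G.
by move: (`|_|) (`|_|) (`|_|) (`|_|) => *; lra.
Qed.

(** * One frequency q^k seen from the levels around k alpha *)

Section Levels.
Context {R : realType} {d : measure_display} {X : measurableType d}.
Variable P : probability X R.
Local Notation Ex := (Ex P).
Local Notation prb := (prb P).
Variable T : X -> X.
Hypothesis pT : preserving P T.
Variable p : nat.
Hypothesis hp : (2 <= p)%N.
Variable u : X -> R.
Hypothesis mu : measurable_fun [set: X] u.
Hypothesis u01 : forall z, 0 <= u z < 1.
Hypothesis uT : forall z, u (T z) = Tq p (u z).
Context {D : finType}.
Variable dz : X -> D.
Hypothesis mdz : mlab dz.
Hypothesis dzx : refines dz (dig p \o u).
Variable q : nat.
Hypothesis pq : (p < q)%N.

Let p0 : 0 < p%:R :> R. Proof. by rewrite ltr0n; exact: leq_trans hp. Qed.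
Let p1 : 1 < p%:R :> R. Proof. by rewrite ltr1n. Qed.
Let lnp0 : 0 < ln p%:R :> R. Proof. exact: ln_gt0. Qed.
Let q0 : 0 < q%:R :> R. Proof. by apply: lt_trans p0 _; rewrite ltr_nat. Qed.
Let mwz n : mlab (wd T dz n). Proof. exact: (mlab_wd pT mdz). Qed.

Definition log_ratio : R := ln q%:R / ln p%:R.
Local Notation alpha := log_ratio.

Lemma log_ratio_gt1 : 1 < alpha.
Proof. by rewrite ltr_pdivlMr// mul1r ltr_ln ?posrE// ltr_nat. Qed.

Let alpha0 : 0 < alpha. Proof. exact: lt_trans ltr01 log_ratio_gt1. Qed.

Lemma expR_log_ratio k (i : nat) :
  expR ((k%:R * alpha - i%:R) * ln p%:R) = q%:R ^+ k / p%:R ^+ i.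
Proof.
rewrite mulrBl expRD -mulrA divfK ?gt_eqF// expRN.
by rewrite !mulr_natl -!lnXn ?lnK// posrE exprn_gt0.
Qed.

Variables (J C r : R) (xi : nat -> X -> R).
Hypothesis mxi : forall k, measurable_fun [set: X] (xi k).
Hypothesis C0 : 0 <= C.
Hypothesis r0 : 0 <= r.
Hypothesis rq : r < q%:R.
Hypothesis hxi : forall k i z z', wd T dz i z = wd T dz i z' ->
  `|xi k z - xi k z'| <= C * r ^+ k / p%:R ^+ i.

Definition osc k z := cos (J * q%:R ^+ k * u z + xi k z).

Lemma bmf_osc k : bmf (osc k).
Proof.
split; last by exists 1 => z; exact: cos_max.
apply: measurableT_comp; first by apply: continuous_measurable_fun; exact: continuous_cos.
by apply: measurable_funD => //; exact: measurable_funM.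
Qed.

Let word_u i z z' : wd T dz i z = wd T dz i z' ->
  p%:R ^+ i * (u z - u z') = u (iter i T z) - u (iter i T z').
Proof.
have u_iter k y : u (iter k T y) = iter k (Tq p) (u y).
  by elim: k => //= k ih; rewrite uT ih.
move=> /wdP h; rewrite !u_iter; apply: word_diff => // k ki.
by have := dzx (h k ki); rewrite /= !u_iter.
Qed.

Let pi0 i : 0 < p%:R ^+ i :> R. Proof. exact: exprn_gt0. Qed.

Let level k := Num.truncn (k%:R * alpha).

Let levelP k : q%:R ^+ k / p%:R ^+ level k <= p%:R :> R.
Proof.
rewrite -expR_log_ratio -[leRHS]lnK ?posrE// ler_expR ler_piMl ?(ltW lnp0)//.
have h : 0 <= k%:R * alpha by rewrite mulr_ge0// ltW.
have /andP[_ h2] := truncn_itv h.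
by rewrite lerBlDl natr1 ltW.
Qed.

(** From level [level k] on, p^i is at least q^k / p, so the phase varies on a word by a
    geometrically small amount. *)
Let drift_le k i : (level k <= i)%N -> C * r ^+ k / p%:R ^+ i <= C * p%:R * (r / q%:R) ^+ k.
Proof.
move=> li; have rk : 0 <= r ^+ k by rewrite exprn_ge0.
have qk : 0 < q%:R ^+ k :> R by rewrite exprn_gt0.
rewrite -!mulrA ler_wpM2l// expr_div_n mulrCA ler_wpM2l//.
rewrite ler_pdivlMr// mulrC; apply: le_trans (levelP k).
by rewrite ler_wpM2l ?(ltW qk)// lef_pV2 ?posrE// ler_weXn2l// ltW.
Qed.

(** [M] letters beyond [level k] determine q^k u up to p / p^M. *)
Lemma osc_close M k z : 0 < prb (atom (wd T dz (level k + M)) z) ->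
  `|osc k z - cond P (wd T dz (level k + M)) (osc k) z| <=
  `|J| * p%:R / p%:R ^+ M + C * p%:R * (r / q%:R) ^+ k.
Proof.
move=> A0; rewrite -{1}(cond_cst (osc k z) (@mwz _) A0).
apply: cond_close => //; [exact: bmf_cst|exact: bmf_osc|apply: aeW => z' e].
apply: le_trans (cos_lip _ _) _.
rewrite opprD addrACA -mulrBr; apply: le_trans (ler_normD _ _) _.
apply: lerD; last by apply: le_trans (hxi k (esym e)) _; apply: drift_le; exact: leq_addr.
have h := word_u (esym e).
have {h} : `|u z - u z'| <= (p%:R ^+ (level k + M))^-1.
  rewrite -(ler_pM2l (pi0 (level k + M))) divff ?gt_eqF// -{1}(gtr0_norm (pi0 _)) -normrM h.
  exact: dist01_le1.
move=> h; rewrite !normrM -!mulrA ler_wpM2l//.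
rewrite ger0_norm ?exprn_ge0 ?(ltW q0)//.
apply: le_trans (ler_wpM2l _ h) _; first by rewrite exprn_ge0// ltW.
by rewrite exprD invfM mulrA ler_wpM2r ?invr_ge0 ?(ltW (pi0 _))//.
Qed.

(** On the word of [z], q^k u z' is a constant plus (q^k / p^i) u (T^i z'). Freezing the slow phase
    too, the oscillation is a fixed combination of [cwave] and [swave] at T^i z'. *)
Lemma cond_osc i k z e : 0 < e -> (level k <= i)%N -> 0 < prb (atom (wd T dz i) z) ->
  `|cond P (wd T dz i) (osc k) z| <= e +
  phi P T dz (cwave p u J (k%:R * alpha - i%:R)) (swave p u J (k%:R * alpha - i%:R)) i z / e +
  C * p%:R * (r / q%:R) ^+ k.
Proof.
move=> e0 li A0; set x := _ - _.
pose c := J * q%:R ^+ k * (u z - u (iter i T z) / p%:R ^+ i) + xi k z.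
pose f := cwave p u J x \o iter i T; pose g := swave p u J x \o iter i T.
have bf : bmf f by exact: (bmf_fcomp pT i (bmf_cwave p mu _ _)).
have bg : bmf g by exact: (bmf_fcomp pT i (bmf_swave p mu _ _)).
pose h z' := cos c * f z' + (- sin c) * g z'.
have bh : bmf h by apply: bmfD; exact: bmfZ.
have oh : `|cond P (wd T dz i) (osc k) z - cond P (wd T dz i) h z| <= C * p%:R * (r / q%:R) ^+ k.
  apply: cond_close => //; [exact: bmf_osc|apply: aeW => z' e'].
  have -> : h z' = cos (J * q%:R ^+ k * u z' + xi k z).
    rewrite /h mulNr -cosD /c /f /g /= /cwave /swave; congr cos.
    rewrite /x expR_log_ratio.
    have hu := word_u e'.
    have -> : u z' = u z - u (iter i T z) / p%:R ^+ i + u (iter i T z') / p%:R ^+ i.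
      by rewrite -[LHS](subrK (u z)) -[X in X + _](mulKf (lt0r_neq0 (pi0 i))) hu; ring.
    by field; rewrite gt_eqF.
  apply: le_trans (cos_lip _ _) _; rewrite opprD addrACA subrr add0r.
  by apply: le_trans (hxi k e') _; exact: drift_le.
have hE : `|cond P (wd T dz i) h z| <= e + phi P T dz (cwave p u J x) (swave p u J x) i z / e.
  rewrite /h (condD P z (@mwz i) (bmfZ _ bf) (bmfZ _ bg)) (condZ P _ z (@mwz i) bf) (condZ P _ z (@mwz i) bg).
  apply: le_trans (ler_normD _ _) _; apply: le_trans (norm_add_amgm _ _ e0).
  by rewrite !normrM normrN lerD// ler_piMl// ?cos_max ?sin_max.
have := ler_normD (cond P (wd T dz i) (osc k) z - cond P (wd T dz i) h z) (cond P (wd T dz i) h z).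
rewrite subrK => /le_trans; apply; rewrite [leRHS]addrC; exact: lerD.
Qed.

Let frac k : 0 <= k%:R * alpha - (level k)%:R < 1.
Proof. by apply: truncn_frac; rewrite mulr_ge0// ltW. Qed.

(* Uncorrelated from everything measurable at level [level k]; the interpolation makes the
   subtracted term comparable to [psi] at time [k alpha]. *)
Definition innovation M k z := let x := k%:R * alpha - (level k)%:R in
  cond P (wd T dz (level k + M)) (osc k) z -
  ((1 - x) * cond P (wd T dz (level k)) (osc k) z + x * cond P (wd T dz (level k).+1) (osc k) z).

Let bmf_cosc i k : bmf (cond P (wd T dz i) (osc k)).
Proof. exact: bmf_cond. Qed.

Let bmf_innovation M k : bmf (innovation M k).
Proof.
apply: bmfB; first exact: bmf_cosc.
by apply: bmfD; apply: bmfZ; exact: bmf_cosc.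
Qed.

Let level_add k l M : (k + M <= l)%N -> (level k + M <= level l)%N.
Proof.
move=> kl; have h0 j : 0 <= j%:R * alpha by rewrite mulr_ge0// ltW.
have /andP[h1 _] := truncn_itv (h0 k).
rewrite -ltnS -(ltr_nat R); have /andP[_ h2] := truncn_itv (h0 l).
apply: le_lt_trans h2; rewrite natrD.
apply: (@le_trans _ _ (k%:R * alpha + M%:R * alpha)).
  by rewrite lerD// ler_peMr// ltW// log_ratio_gt1.
by rewrite -mulrDl -natrD ler_wpM2r ?(ltW alpha0)// ler_nat.
Qed.

(** For l >= k + M the levels grow enough ([alpha] exceeds 1) for [innovation M k] to be measurable
    at each of the three levels used for [l]. All three correlations are then equal, and the
    coefficients 1, -(1 - x), -x cancel. *)
Lemma innovation_avg0 M : (0 < M)%N -> {ae P, forall z, avg0 (fun k => innovation M k z)}.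
Proof.
move=> M0; apply: (@lln _ _ _ P (innovation M) 3 M) => //.
  move=> k z; have c1 i : `|cond P (wd T dz i) (osc k) z| <= 1.
    by apply: cond_norm_le => // [|z']; [exact: bmf_osc|exact: cos_max].
  rewrite /innovation; have /andP[x0 x1] := frac k; move: x0 x1; move: (_ - _) => x x0 x1.
  apply: le_trans (ler_normB _ _) _; rewrite [leRHS](_ : 3 = 1 + ((1 - x) + x * 1 + 1)); last by ring.
  apply: lerD => //; apply: le_trans (ler_normD _ _) _; rewrite -[leLHS]addr0 lerD// (normrM (1 - x)) (normrM x).
  rewrite (ger0_norm x0) (ger0_norm (_ : 0 <= 1 - x)) ?subr_ge0 ?(ltW x1)//.
  by apply: lerD; [apply: ler_piMr; rewrite ?subr_ge0 ?(ltW x1)|exact: ler_wpM2l].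
move=> k l kl; have kl' := level_add kl.
have Econd i : (level k + M <= i)%N ->
    Ex (fun z => cond P (wd T dz i) (osc l) z * innovation M k z) = Ex (fun z => osc l z * innovation M k z).
  move=> li; apply: (@Ex_cond _ _ _ P _ (wd T dz i) (osc l) (innovation M k) (@mwz i) (bmf_osc l)) => z z' e.
  have lab j : (j <= level k + M)%N -> cond P (wd T dz j) (osc k) z = cond P (wd T dz j) (osc k) z'.
    by move=> jl; apply: cond_lab; apply: wd_refines e; exact: leq_trans li.
  by rewrite /innovation !lab ?leq_addr ?leqnn// -addn1 leq_add2l.
have bc i : bmf (fun z => cond P (wd T dz i) (osc l) z * innovation M k z).
  by apply: bmfM; [exact: bmf_cosc|exact: bmf_innovation].
pose x := l%:R * alpha - (level l)%:R.
have -> : (fun z => innovation M k z * innovation M l z) = (fun z =>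
    cond P (wd T dz (level l + M)) (osc l) z * innovation M k z -
    ((1 - x) * (cond P (wd T dz (level l)) (osc l) z * innovation M k z) +
     x * (cond P (wd T dz (level l).+1) (osc l) z * innovation M k z))).
  by apply/funext => z; rewrite {2}/innovation -/x; ring.
rewrite (ExB P (bc _) (bmfD (bmfZ _ (bc _)) (bmfZ _ (bc _)))).
rewrite (ExD P (bmfZ _ (bc _)) (bmfZ _ (bc _))) !(ExZ P _ (bc _)) !Econd//; last 2 first.
- exact: leqW.
- exact: leq_trans kl' (leq_addr _ _).
by ring.
Qed.

Lemma osc_avg M e : (0 < M)%N -> 0 < e -> {ae P, forall z, forall L eta,
  ~ io_avg (fun k => psi P T dz (cwave p u J) (swave p u J) (k%:R * alpha) z) L -> 0 < eta ->
  exists n0, forall n, (n0 <= n)%N ->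
  `|\sum_(k < n) osc k z| <= n%:R * (`|J| * p%:R / p%:R ^+ M + e + L / e + eta)}.
Proof.
move=> M0 e0.
have := ae_foralln (fun i => atom_pos_ae P (@mwz i)).
apply: filterS2 (innovation_avg0 M0) => z hY A0 L eta hL eta0.
pose rho := r / q%:R.
have rho0 : 0 <= rho by rewrite divr_ge0// ltW.
have rho1 : 0 < 1 - rho by rewrite subr_gt0 ltr_pdivrMr// mul1r.
pose c1 := `|J| * p%:R / p%:R ^+ M.
pose ce := c1 + e; pose D0 := C * p%:R; have D00 : 0 <= D0 by rewrite mulr_ge0// ltW.
pose ps k := psi P T dz (cwave p u J) (swave p u J) (k%:R * alpha) z.
have step k : `|osc k z - innovation M k z| <= ce + ps k / e + 2 * (D0 * rho ^+ k).
  pose x := k%:R * alpha - (level k)%:R; have /andP[x0 x1] := frac k; rewrite -/x in x0 x1.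
  have h1 := osc_close (A0 (level k + M)%N).
  have h2 := cond_osc e0 (leqnn _) (A0 (level k)).
  have h3 := cond_osc e0 (leqnSn _) (A0 (level k).+1).
  have p2 := phi_le_max P T dz (cwave p u J x) (swave p u J x) z (leqnn (level k)).
  have p3 := phi_le_max P T dz (cwave p u J (x - 1)) (swave p u J (x - 1)) z (leqnn (level k).+1).
  rewrite !subnn /= in p2 p3.
  have ex : k%:R * alpha - (level k).+1%:R = x - 1 by rewrite /x -[(level k).+1%:R]natr1; ring.
  rewrite -/c1 -/D0 -/rho in h1 h2 h3; rewrite ex in h3; rewrite -/x in h2.
  have -> : ps k = (1 - x) * phimax P T dz (cwave p u J x) (swave p u J x) (level k) z +
      x * phimax P T dz (cwave p u J (x - 1)) (swave p u J (x - 1)) (level k).+1 z by [].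
  rewrite /innovation -/x; apply: (interpolation_bound x0 x1 e0 _ h1 h2 h3 p2 p3).
  by rewrite mulr_ge0// exprn_ge0.
have sum_le n : `|\sum_(k < n) osc k z| <= `|\sum_(k < n) innovation M k z| +
    (n%:R * ce + (\sum_(k < n) ps k) / e + 2 * D0 * (1 - rho)^-1).
  exact: (sum_dist_le n D00 rho0 rho1 step).
have eta3 : 0 < eta / 3 by rewrite divr_gt0.
have etae : 0 < eta * e / 3 by rewrite divr_gt0// mulr_gt0.
have [n1 h1] := hY _ eta3; have [n2 h2] := io_avgN hL etae.
have [n3 h3] := exists_nat_ge (2 * D0 * (1 - rho)^-1 / (eta / 3)).
exists (maxn n1 (maxn n2 n3)) => n; rewrite !geq_max => /and3P[/h1 k1 /h2 k2 n3n].
apply: le_trans (sum_le n) _.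
have k3 : 2 * D0 * (1 - rho)^-1 <= n%:R * (eta / 3).
  by rewrite -ler_pdivrMr ?divr_gt0//; apply: le_trans h3 _; rewrite ler_nat.
have k2' : (\sum_(k < n) ps k) / e <= n%:R * (L / e + eta / 3).
  rewrite ler_pdivrMr//; apply: le_trans (ltW k2) _.
  by rewrite le_eqVlt; apply/orP; left; apply/eqP; field; rewrite gt_eqF.
move: k1 k2' k3; rewrite -/c1 -/ce; move: (`|_|) (_ / e) (2 * _ * _) (L / e) => a b c l.
by move=> *; lra.
Qed.

End Levels.

Section Equidistribution.
Context {R : realType} {d : measure_display} {X : measurableType d}.
Variable P : probability X R.
Local Notation Ex := (Ex P).
Local Notation prb := (prb P).
Variable T : X -> X.
Hypothesis pT : preserving P T.
Hypothesis ergT : forall A, measurable A -> T @^-1` A = A -> prb A = 0 \/ prb A = 1.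
Variable p : nat.
Hypothesis hp : (2 <= p)%N.
Variable u : X -> R.
Hypothesis mu : measurable_fun [set: X] u.
Hypothesis u01 : forall z, 0 <= u z < 1.
Hypothesis uT : forall z, u (T z) = Tq p (u z).
Context {D : finType}.
Variable dz : X -> D.
Hypothesis mdz : mlab dz.
Hypothesis dzx : refines dz (dig p \o u).
Hypothesis hent : 0 < erate P T (dig p \o u).
Variable q : nat.
Hypothesis pq : (p < q)%N.
Local Notation alpha := (@log_ratio R p q).
Hypothesis dens : forall y e : R, 0 < e -> exists k b : nat, `|k%:R * alpha - b%:R - y| < e.

Let p0 : 0 < p%:R :> R. Proof. by rewrite ltr0n; exact: leq_trans hp. Qed.
Let p1 : 1 < p%:R :> R. Proof. by rewrite ltr1n. Qed.
Let lnp0 : 0 < ln p%:R :> R. Proof. exact: ln_gt0. Qed.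
Let alpha0 : 0 < alpha. Proof. exact: lt_trans ltr01 (log_ratio_gt1 hp pq). Qed.
Let mdx : mlab (dig p \o u). Proof. exact: mlab_dig. Qed.

Let psiJ J := psi P T dz (cwave p u J) (swave p u J).

Let bpsi J t : bmf (psiJ J t).
Proof. exact: bmf_psi. Qed.

(** [unpredictable] fixes the block length, then enough frequencies beat the distant pairs, then a
    large |J| packs their exponents into a short interval. *)
Lemma psi_rarely_large l s : 0 < l -> 0 < s -> exists N : R, forall J, N <= `|J| ->
  prb [set z | io_avg (fun k => psiJ J (k%:R * alpha) z) (3 * l)] <= s.
Proof.
move=> l0 s0; pose lam := l * s / 2.
have lam0 : 0 < lam by rewrite divr_gt0// mulr_gt0.
pose eps := lam ^+ 2; have eps0 : 0 < eps by rewrite exprn_gt0.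
have e10 : 0 < eps / 12 by rewrite divr_gt0.
have [n hn] := unpredictable pT ergT mdz mdx dzx hent e10.
(* Gives 2 p^(n + 2) at most M eps / 4; with 3 (eps / 12) M from the light cells this is M eps /
   2. *)
have [M hM] := exists_nat_ge (8 * p%:R ^+ n.+2 / eps).
have pn2 : 0 < p%:R ^+ n.+2 :> R by rewrite exprn_gt0.
have M0 : 0 < M%:R :> R by apply: lt_le_trans hM; rewrite divr_gt0// mulr_gt0.
(* [eps / 6] makes the translation error 3 smax half of [eps], so the final bound is lam + eps / lam
   = 2 lam = l s; [1 / 2] keeps the shifts below 1. *)
pose sm := Num.min (eps / 6) (1 / 2).
have sm0 : 0 < sm by rewrite lt_min !divr_gt0.
pose N := M%:R / (p%:R * ln p%:R * sm).
have N0 : 0 < N by rewrite divr_gt0// !mulr_gt0.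
exists N => J NJ; have aJ0 := lt_le_trans N0 NJ.
have J0 : J != 0 by rewrite -normr_gt0.
have scale_le r : (r < M)%N -> 0 <= scale p J r <= sm.
  move=> rM; rewrite /scale; set dl := _^-1.
  have dl0 : 0 < dl by rewrite invr_gt0 mulr_gt0.
  have rd0 : 0 <= r%:R * dl by rewrite mulr_ge0// ltW.
  apply/andP; split; first by rewrite divr_ge0 ?(ltW lnp0)// ln_ge0// lerDl.
  rewrite ler_pdivrMr//; apply: (@le_trans _ _ (r%:R * dl)).
    by have := @ln_le_sub1 R (1 + r%:R * dl); rewrite addrAC subrr add0r; apply; rewrite ltr_wpDr.
  apply: (@le_trans _ _ (M%:R * dl)); first by rewrite ler_wpM2r ?(ltW dl0)// ler_nat ltnW.
  rewrite /dl ler_pdivrMr ?mulr_gt0//.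
  have := NJ; rewrite /N ler_pdivrMr ?mulr_gt0//.
  by move=> /le_trans; apply; rewrite le_eqVlt; apply/orP; left; apply/eqP; ring.
pose c0 := eps / 2.
have sumU i (x : R) : -1 <= x <= 1 -> \sum_(r < M)
    Ex (phi P T dz (cwave p u J (x + scale p J r)) (swave p u J (x + scale p J r)) i) <= M%:R * c0.
  move=> hx; apply: le_trans (Ex_phi_sum pT hp mu u01 uT mdz (ltW e10) M J0 hn i hx) _.
  rewrite ler_pdivrMr// in hM; rewrite /c0; lra.
have := flow_fourier pT alpha0 dens mdz (bmf_cwave p mu J) (bmf_swave p mu J)
  (fun x z => cos_max _) (fun x z => sin_max _) (wave_uc hp u01 J0) (s := scale p J) (smax := eps / 6)
  (c0 := c0) (M := M) _ _ _ sumU lam0 l0.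
rewrite -(ltr0n R) => /(_ M0).
have s1 r : (r < M)%N -> 0 <= scale p J r < 1.
  move=> /scale_le/andP[-> /le_lt_trans]; apply.
  by rewrite /sm gt_min; apply/orP; right; lra.
have s2 r : (r < M)%N -> scale p J r <= eps / 6.
  by move=> /scale_le/andP[_ /le_trans]; apply; rewrite ge_min lexx.
move=> /(_ s1 s2); rewrite /c0.
have -> : (eps / 2 + 3 * (eps / 6)) / lam = lam.
  by rewrite /eps; field; rewrite gt_eqF.
have -> : lam + lam = l * s by rewrite /lam; field.
by rewrite ler_pM2l.
Qed.

Variables (J C r : R) (xi : nat -> X -> R).
Hypothesis J0 : J != 0.
Hypothesis mxi : forall k, measurable_fun [set: X] (xi k).
Hypothesis C0 : 0 <= C.
Hypothesis r0 : 0 <= r.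
Hypothesis rq : r < q%:R.
Hypothesis hxi : forall k i z z', wd T dz i z = wd T dz i z' ->
  `|xi k z - xi k z'| <= C * r ^+ k / p%:R ^+ i.

Let q1 : 1 < q%:R :> R. Proof. by apply: lt_trans p1 _; rewrite ltr_nat. Qed.

Let exists_pow (y : R) : exists k, y <= `|J * q%:R ^+ k|.
Proof.
have [k hk] := exists_nat_ge (y / `|J|); exists k.
have aJ : 0 < `|J| by rewrite normr_gt0.
rewrite normrM mulrC -ler_pdivrMr//; apply: le_trans hk _.
rewrite ger0_norm ?exprn_ge0// -natrX ler_nat ltnW// ltn_expl//.
by rewrite -(ltr_nat R).
Qed.

(* Dropping the first [k0] terms replaces [J] by [J q^k0], for which [psi_rarely_large] applies. *)
Theorem osc_avg0 : {ae P, forall z, avg0 (fun k => osc u q J xi k z)}.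
Proof.
suff main (eta : R) : 0 < eta -> {ae P, forall z, exists n0, forall n, (n0 <= n)%N ->
    `|\sum_(k < n) osc u q J xi k z| <= eta * n%:R}.
  have : {ae P, forall z, forall j, exists n0, forall n, (n0 <= n)%N ->
      `|\sum_(k < n) osc u q J xi k z| <= j.+1%:R^-1 * n%:R}.
    by apply: ae_foralln => j; apply: main; rewrite invr_gt0.
  apply: filterS => z h e e0; have [j hj] := exists_inv e0; have [n0 hn0] := h j.
  by exists n0 => n /hn0 /le_trans; apply; rewrite ler_wpM2r// ltW.
(* Four errors of size [e] come from [osc_avg], the one due to the limsup being 3 l / e = e by the
   choice of [l]; the remaining half of [eta] covers the dropped terms. *)
move=> eta0; pose e := eta / 8; have e0 : 0 < e by rewrite divr_gt0.
pose l := e ^+ 2 / 3; have l0 : 0 < l by rewrite divr_gt0// exprn_gt0.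
pose bad k0 := [set z | io_avg (fun k => psiJ (J * q%:R ^+ k0) (k%:R * alpha) z) (3 * l)].
have mbad k0 : measurable (bad k0) by apply: measurable_io_avg => k; exact: bpsi.
have good k0 : {ae P, forall z, ~ bad k0 z -> exists n0, forall n, (n0 <= n)%N ->
    `|\sum_(k < n) osc u q J xi k z| <= eta * n%:R}.
  pose J' := J * q%:R ^+ k0; pose xi' k := xi (k0 + k)%N.
  have [M hM] : exists M : nat, (0 < M)%N /\ `|J'| * p%:R / p%:R ^+ M <= e.
    have [M hM] := exists_nat_ge (`|J'| * p%:R / e); exists M.+1; split => //.
    rewrite ler_pdivrMr ?exprn_gt0// -ler_pdivrMl// mulrC; apply: le_trans hM _.
    by rewrite -natrX ler_nat; apply: leq_trans (ltnW (ltn_expl M hp)) _; rewrite leq_exp2l.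
  have hxi' k i z z' : wd T dz i z = wd T dz i z' ->
      `|xi' k z - xi' k z'| <= (C * r ^+ k0) * r ^+ k / p%:R ^+ i.
    by move=> h; rewrite -(mulrA C) -exprD; exact: hxi.
  have C'0 : 0 <= C * r ^+ k0 by rewrite mulr_ge0// exprn_ge0.
  have := osc_avg pT hp mu u01 uT mdz dzx pq J' (fun k => mxi (k0 + k)) C'0 r0 rq hxi' hM.1 e0.
  apply: filterS => z h nbad; have {h}[n0 h] := h (3 * l) e nbad e0.
  have [n1 hn1] := exists_nat_ge ((k0 + k0)%:R / e).
  exists (maxn n0 n1) => n; rewrite geq_max => /andP[/h hn n1n].
  have dist := sum_shift_diff k0 n (fun k => cos_max (J * q%:R ^+ k * u z + xi k z)).
  rewrite -/(osc u q J xi _ z) mulr1 in dist.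
  have E : \sum_(k < n) osc u q J' xi' k z = \sum_(k < n) osc u q J xi (k0 + k) z.
    by apply: eq_bigr => k _; rewrite /osc exprD mulrA.
  rewrite E in hn.
  have {}n1n : (k0 + k0)%:R <= n%:R * e.
    by rewrite -ler_pdivrMr//; apply: le_trans hn1 _; rewrite ler_nat.
  have le4 : n%:R * (`|J'| * p%:R / p%:R ^+ M + e + 3 * l / e + e) <= n%:R * (4 * e).
    rewrite ler_wpM2l//; have -> : 3 * l / e = e by rewrite /l; field; rewrite gt_eqF.
    by have := hM.2; lra.
  have -> : \sum_(k < n) osc u q J xi k z = \sum_(k < n) osc u q J xi (k0 + k) z -
    (\sum_(k < n) osc u q J xi (k0 + k) z - \sum_(k < n) osc u q J xi k z) by ring.
  apply: le_trans (ler_normB _ _) _.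
  have -> : eta * n%:R = n%:R * (4 * e) + n%:R * (4 * e) by rewrite /e; field.
  apply: lerD; first exact: le_trans hn le4.
  apply: le_trans dist _; apply: le_trans n1n _; rewrite ler_wpM2l//; lra.
have bad_small : {ae P, forall z, exists k0, ~ bad k0 z}.
  have mcap : measurable (\bigcap_k0 bad k0).
    by apply: bigcap_measurable => [|k0 _]; [exists 0%N|exact: mbad].
  have : prb (\bigcap_k0 bad k0) = 0.
    apply/eqP; rewrite eq_le prb_ge0 andbT; apply/ler_addgt0Pl => s s0; rewrite addr0.
    have [N hN] := psi_rarely_large l0 s0; have [k0 hk0] := exists_pow N.
    by apply: le_trans (hN _ hk0); apply: (prb_le P mcap (mbad k0)) => z h; exact: h.
  move=> /(prb_null_ae mcap); apply: filterS => z.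
  by move=> h; apply: contrapT => /forallNP nh; apply: h => k0 _; apply: contrapT; exact: nh.
apply: filterS2 bad_small (ae_foralln good) => z [k0 hk0] h; exact: h hk0.
Qed.

End Equidistribution.

(** * Density of trigonometric polynomials on the torus *)

Lemma frac_itv {R : realType} (x : R) : x - (Num.floor x)%:~R \in `[0, 1].
Proof.
have /andP[h1 h2] := floor_itv x; rewrite in_itv/= subr_ge0 h1 lerBlDl.
by rewrite intrD in h2; exact: ltW.
Qed.

Section TorusContinuous.
Context {R : realType}.
Variable f : R * R -> R.
Hypothesis tf : torus_continuous f.

Lemma torus_shift (x y : R) (i j : int) : f (x + i%:~R, y + j%:~R) = f (x, y).
Proof.
have h1 (n : nat) a b : f (a + n%:R, b) = f (a, b).
  by elim: n => [|n ih]; rewrite ?addr0// -natr1 addrA (tf.2 _ _).1.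
have h2 (n : nat) a b : f (a, b + n%:R) = f (a, b).
  by elim: n => [|n ih]; rewrite ?addr0// -natr1 addrA (tf.2 _ _).2.
have k1 (i' : int) a b : f (a + i'%:~R, b) = f (a, b).
  case: i' => n; first exact: h1.
  by rewrite NegzE mulrNz -(h1 n.+1 (a - _)) subrK.
have k2 (i' : int) a b : f (a, b + i'%:~R) = f (a, b).
  case: i' => n; first exact: h2.
  by rewrite NegzE mulrNz -(h2 n.+1 _ (b - _)) subrK.
by rewrite k1 k2.
Qed.

(** Compactness of the closed square, then periodicity: both points are moved by the same integer
    vector, and only the first has to land in the square. *)
Lemma torus_uc (e : R) : 0 < e -> exists2 n : nat, forall z, `|f z| <= n%:R &
  forall x y x' y', `|x - x'| < n.+1%:R^-1 -> `|y - y'| < n.+1%:R^-1 ->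
  `|f (x, y) - f (x', y')| <= e.
Proof.
move=> e0; pose K : set (R * R) := `[0, 1] `*` `[0, 1].
have cK : compact K by apply: compact_setX; exact: segment_compact.
pose Q (n : nat) z := `|f z| <= n%:R /\ forall z', `|z.1 - z'.1| < n.+1%:R^-1 ->
  `|z.2 - z'.2| < n.+1%:R^-1 -> `|f z - f z'| <= e.
have /(_ nat \oo Q _) [] := (iffLR (compact_near_coveringP K)) cK.
  move=> z _; have e20 : 0 < e / 2 by rewrite divr_gt0.
  have /cvgrPdist_lt/(_ _ e20) := tf.1 z.
  move=> /nbhs_ballP[r /= r0 hr].
  have r20 : 0 < r / 2 by rewrite divr_gt0.
  have [n0 hn0] := exists_inv r20; have [n1 hn1] := exists_nat_ge (`|f z| + e / 2).
  exists (ball z (r / 2), [set n | (maxn n0 n1 <= n)%N]).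
    by split; [exact: nbhsx_ballx|exists (maxn n0 n1)].
  move=> [w n] /= [[w1 w2]]; rewrite /ball/= in w1 w2; rewrite geq_max => /andP[n0n n1n].
  have zw : `|f z - f w| < e / 2.
    by apply: hr; split => /=; rewrite /ball/=; [apply: lt_trans w1 _|apply: lt_trans w2 _]; lra.
  split.
    have := ler_normD (f w - f z) (f z); rewrite subrK distrC => h; apply: le_trans h _.
    apply: (@le_trans _ _ (`|f z| + e / 2)); first lra.
    by apply: le_trans hn1 _; rewrite ler_nat.
  have nr : n.+1%:R^-1 < r / 2.
    by apply: le_lt_trans hn0; rewrite lef_pV2 ?posrE// ler_nat.
  move=> z' h1 h2.
  have zz' : `|f z - f z'| < e / 2.
    apply: hr; split; rewrite /ball/=.
      by have := ler_distD w.1 z.1 z'.1; move: h1 nr w1; set c := _^-1; lra.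
    by have := ler_distD w.2 z.2 z'.2; move: h2 nr w2; set c := _^-1; lra.
  have := ler_distD (f z) (f w) (f z'); rewrite (distrC (f w) (f z)); lra.
move=> n _ hn; exists n.
  move=> [x y]; rewrite -(torus_shift x y (- Num.floor x) (- Num.floor y)).
  apply: (hn n (leqnn n) _ _).1; rewrite !mulrNz; split; exact: frac_itv.
move=> x y x' y' hx hy.
rewrite -(torus_shift x y (- Num.floor x) (- Num.floor y)) -(torus_shift x' y' (- Num.floor x) (- Num.floor y)).
apply: (hn n (leqnn n) _ _).2 => /=; last 2 first.
- by rewrite opprD addrACA subrr addr0.
- by rewrite opprD addrACA subrr addr0.
rewrite !mulrNz; split; exact: frac_itv.
Qed.

End TorusContinuous.

(** The error of averaging against a product kernel: [F] is at most [h] unless one index is marked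
    by [p] or [q], and marked indices carry little weight. *)
Lemma double_average {R : realType} n (u v : 'I_n -> R) (p q : pred 'I_n) (F : 'I_n -> 'I_n -> R)
    (c h B t : R) : 0 <= c -> 0 <= B -> (forall a, 0 <= u a) -> (forall b, 0 <= v b) ->
  \sum_a u a = c -> \sum_b v b = c -> \sum_(a | p a) u a <= t * c -> \sum_(b | q b) v b <= t * c ->
  (forall a b, `|F a b| <= h + B * ((p a)%:R + (q b)%:R)) ->
  `|\sum_a \sum_b F a b * (u a * v b)| <= (h + 2 * B * t) * c ^+ 2.
Proof.
move=> c0 B0 u0 v0 uc vc pc qc hF.
have e1 a : \sum_b (h + B * ((p a)%:R + (q b)%:R)) * (u a * v b) =
    (h + B * (p a)%:R) * u a * c + B * u a * \sum_(b | q b) v b.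
  rewrite -vc !mulr_sumr [X in _ = _ + X]big_mkcond/= -big_split/=; apply: eq_bigr => b _.
  by case: (q b) => /=; ring.
apply: (@le_trans _ _ (\sum_a ((h + B * (p a)%:R) * u a * c + B * u a * \sum_(b | q b) v b))).
  apply: le_trans (ler_norm_sum _ _ _) _; apply: ler_sum => a _; rewrite -e1.
  apply: le_trans (ler_norm_sum _ _ _) _; apply: ler_sum => b _.
  by rewrite normrM (ger0_norm (mulr_ge0 (u0 a) (v0 b))) ler_wpM2r// mulr_ge0.
rewrite big_split/= -!mulr_suml -mulr_sumr uc.
have -> : \sum_a (h + B * (p a)%:R) * u a = h * c + B * \sum_(a | p a) u a.
  rewrite -uc !mulr_sumr [X in _ = _ + X]big_mkcond/= -big_split/=; apply: eq_bigr => a _.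
  by case: (p a) => /=; ring.
have := ler_wpM2l (mulr_ge0 B0 c0) pc; have := ler_wpM2l (mulr_ge0 B0 c0) qc.
by move: (\sum_(a | p a) u a) (\sum_(b | q b) v b) => x y; lra.
Qed.

(** * A trigonometric kernel summing to a constant over equally spaced points *)

Section Bump.
Context {R : realType}.

Lemma cos_int_period (x : R) (i : int) : cos (x + i%:~R * (2 * pi)) = cos x.
Proof.
have h (n : nat) (y : R) : cos (y + n%:R * (2 * pi)) = cos y.
  have -> : n%:R * (2 * pi) = pi *+ 2 *+ n :> R by rewrite -[RHS]mulr_natl -[pi *+ 2]mulr_natl.
  exact: (periodicn (@cosD2pi R)).
by case: i => n; [exact: h|rewrite NegzE mulrNz mulNr -(h n.+1 (x - _)) subrK].
Qed.

(** Membership in the trigonometric polynomials is used only through closure under linear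
    combinations, so no coefficients are ever listed. *)
Definition span_closed (V : Type) (A : (V -> R) -> Prop) :=
  (forall g h, A g -> A h -> A (fun t => g t + h t)) /\ (forall c g, A g -> A (fun t => c * g t)).

(** Equal to cos (pi t)^(2 N): a nonnegative trigonometric polynomial of degree [N], concentrated
    near the integers. *)
Definition bump (N : nat) (t : R) : R := ((1 + cos (2 * pi * t)) / 2) ^+ N.

Lemma bump_span N (A : (R -> R) -> Prop) : span_closed A ->
  (forall j, (j <= N)%N -> A (fun t => cos (2 * pi * (j%:R * t)))) -> A (bump N).
Proof.
elim: N A => [|N ih] A cA hA.
  have -> : bump 0 = fun t => cos (2 * pi * (0%:R * t)).
    by apply/funext => t; rewrite /bump expr0 mul0r mulr0 cos0.
  exact: hA.
have -> : bump N.+1 = fun t => bump N t * ((1 + cos (2 * pi * t)) / 2).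
  by apply/funext => t; rewrite /bump exprSr.
(* The induction is over all classes at once: it is applied to the functions whose product with one
   more factor lies in [A]. *)
apply: (ih (fun g => A (fun t => g t * ((1 + cos (2 * pi * t)) / 2)))).
  split=> [g h Ag Ah|c g Ag].
    have -> : (fun t => (g t + h t) * ((1 + cos (2 * pi * t)) / 2)) =
      (fun t => g t * ((1 + cos (2 * pi * t)) / 2) + h t * ((1 + cos (2 * pi * t)) / 2)).
      by apply/funext => t; rewrite mulrDl.
    exact: cA.1.
  have -> : (fun t => c * g t * ((1 + cos (2 * pi * t)) / 2)) =
    (fun t => c * (g t * ((1 + cos (2 * pi * t)) / 2))) by apply/funext => t; rewrite -mulrA.
  exact: cA.2.
move=> [_|j jN].
  have -> : (fun t : R => cos (2 * pi * (0%:R * t)) * ((1 + cos (2 * pi * t)) / 2)) =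
    (fun t => 2^-1 * cos (2 * pi * (0%:R * t)) + 2^-1 * cos (2 * pi * (1%:R * t))).
    by apply/funext => t; rewrite mul0r mulr0 cos0 !mul1r; field.
  by apply: cA.1; apply: cA.2; exact: hA.
have -> : (fun t : R => cos (2 * pi * (j.+1%:R * t)) * ((1 + cos (2 * pi * t)) / 2)) =
  (fun t => 2^-1 * cos (2 * pi * (j.+1%:R * t)) +
    4^-1 * (cos (2 * pi * (j.+2%:R * t)) + cos (2 * pi * (j%:R * t)))).
  apply/funext => t; set x := 2 * pi * (j.+1%:R * t).
  have -> : 2 * pi * (j.+2%:R * t) = x + 2 * pi * t by rewrite /x -[j.+2%:R]natr1; ring.
  have -> : 2 * pi * (j%:R * t) = x - 2 * pi * t by rewrite /x -[j.+1%:R]natr1; ring.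
  by rewrite cosD cosB; field.
apply: cA.1; first by apply: cA.2; apply: hA; exact: leqW.
by apply: cA.2; apply: cA.1; apply: hA; [exact: jN|exact: leqW (ltnW jN)].
Qed.

(** Harmonics of order between 1 and [N < M] sum to 0 over [M] equally spaced points, so only the
    constant term survives. *)
Lemma bump_sum N M : (N < M)%N -> exists c, forall x, \sum_(a < M) bump N (x - a%:R / M%:R) = c.
Proof.
move=> NM; have M0 : 0 < M%:R :> R by rewrite ltr0n; exact: leq_trans NM.
apply: (bump_span (A := fun h => exists c, forall x, \sum_(a < M) h (x - a%:R / M%:R) = c)).
  split=> [g h [c hc] [c' hc']|c g [c' hc']].
    by exists (c + c') => x; rewrite big_split/= hc hc'.
  by exists (c * c') => x; rewrite -mulr_sumr hc'.
move=> [_|j jN].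
  exists M%:R => x; under eq_bigr do rewrite mul0r mulr0 cos0.
  by rewrite sumr_const card_ord.
exists 0 => x; pose w : R := - (2 * pi * j.+1%:R / M%:R).
have -> : \sum_(a < M) cos (2 * pi * (j.+1%:R * (x - a%:R / M%:R))) =
    \sum_(a < M) cos (2 * pi * (j.+1%:R * x) + a%:R * w).
  by apply: eq_bigr => a _; congr cos; rewrite /w; field; rewrite gt_eqF.
apply/eqP; have := cos_sum (2 * pi * (j.+1%:R * x)) w M.
set y := 2 * pi * _.
have -> : sin (y + M%:R * w - w / 2) = sin (y - w / 2).
  have -> : y + M%:R * w - w / 2 = y - w / 2 + (- j.+1%:Z)%:~R * (2 * pi).
    by rewrite mulrNz /w; field; rewrite gt_eqF.
  by rewrite -!cosBpihalf addrAC cos_int_period.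
rewrite subrr => /eqP; rewrite !mulf_eq0 pnatr_eq0/= => /orP[|//].
rewrite /w mulNr sinN oppr_eq0 gt_eqF//; apply: sin_gt0_pi; apply/andP; split.
  by rewrite !mulr_gt0// ?invr_gt0// ?pi_gt0.
rewrite (_ : _ / 2 = pi * (j.+1%:R / M%:R)); last by field; rewrite gt_eqF.
rewrite -[ltRHS]mulr1 ltr_pM2l ?pi_gt0// ltr_pdivrMr// mul1r ltr_nat.
exact: leq_ltn_trans jN NM.
Qed.

Let base_ge0 (t : R) : 0 <= (1 + cos (2 * pi * t)) / 2.
Proof. by have := @cos_geN1 R (2 * pi * t); lra. Qed.

Lemma bump_ge0 N t : 0 <= bump N t.
Proof. by rewrite exprn_ge0. Qed.

Lemma bump_int N t (i : int) : bump N (t - i%:~R) = bump N t.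
Proof.
rewrite /bump (_ : 2 * pi * (t - i%:~R) = 2 * pi * t + (- i)%:~R * (2 * pi)); last by rewrite mulrNz; ring.
by rewrite cos_int_period.
Qed.

Let cos_le (x y : R) : 0 <= x -> x <= y -> y <= 2^-1 -> cos (2 * pi * y) <= cos (2 * pi * x).
Proof.
move=> x0 xy y2; have p0 := @pi_gt0 R.
have h (z : R) : 0 <= z -> z <= 2^-1 -> 2 * pi * z \in `[0, pi].
  move=> z0 z1; rewrite in_itv/= mulr_ge0 ?mulr_ge0 ?(ltW p0)//=.
  by have := ler_wpM2l (ltW p0) z1; lra.
move: xy; rewrite le_eqVlt => /orP[/eqP -> //|xy].
rewrite ltW// ltr_cos; [by rewrite ltr_pM2l// mulr_gt0|apply: h => //; exact: le_trans (ltW xy) y2|].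
by apply: h => //; exact: le_trans x0 (ltW xy).
Qed.

Lemma bump_far N (t dl : R) : 0 <= dl -> (forall i : int, dl <= `|t - i%:~R|) -> bump N t <= bump N dl.
Proof.
move=> dl0 h; pose i := Num.floor (t + 2^-1).
have /andP[h1 h2] := floor_itv (t + 2^-1); rewrite intrD -/i in h1 h2.
have ti : `|t - i%:~R| <= 2^-1 by rewrite ler_norml; apply/andP; split; lra.
rewrite -(bump_int N t i); apply: lerXn2r; rewrite ?nnegrE//.
rewrite ler_pM2r ?invr_gt0// lerD2l.
have -> : cos (2 * pi * (t - i%:~R)) = cos (2 * pi * `|t - i%:~R|).
  by have [t0|t0] := ger0P (t - i%:~R); rewrite // mulrN cosN.
exact: cos_le.
Qed.

(** With s the square root of x, (N + 1) s^N is at most the geometric sum C; squaring gives x^N (N +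
    1)^2 <= C^2. *)
Lemma exists_pow_small (x t : R) : 0 <= x < 1 -> 0 < t -> exists N : nat, N.+1%:R * x ^+ N <= t.
Proof.
move=> /andP[x0 x1] t0; pose s := Num.sqrt x; have s0 : 0 <= s := sqrtr_ge0 x.
have s1 : 0 < 1 - s.
  by rewrite subr_gt0 -[ltRHS](@sqrtr1 R) ltr_sqrt.
pose C := (1 - s)^-1; have C0 : 0 < C by rewrite invr_gt0.
have [N hN] := exists_nat_ge (C ^+ 2 / t); exists N.
have N0 : 0 < N.+1%:R :> R by [].
have h : N.+1%:R * s ^+ N <= C.
  apply: le_trans (geometric_sum_le N.+1 s0 s1).
  rewrite mulr_natl -[N.+1 in leLHS]card_ord -sumr_const; apply: ler_sum => k _.
  by apply: ler_wiXn2l => //; [rewrite -subr_ge0 ltW|rewrite -ltnS].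
rewrite -(ler_pM2l N0); apply: (@le_trans _ _ (C ^+ 2)).
  have -> : N.+1%:R * (N.+1%:R * x ^+ N) = (N.+1%:R * s ^+ N) ^+ 2.
    by rewrite -{1}(sqr_sqrtr x0) -/s !expr2 exprMn; ring.
  by rewrite lerXn2r// nnegrE ?(ltW C0)// mulr_ge0// exprn_ge0.
rewrite -ler_pdivrMr//; apply: le_trans hN _; by rewrite ler_nat.
Qed.

Definition far (dl t : R) := `[< forall i : int, dl <= `|t - i%:~R| >].

(** The constant is at least 1, the value of the kernel at 0, while the far terms total at most (N +
    1) k^N. *)
Lemma bump_concentrated (dl t : R) : 0 < dl <= 2^-1 -> 0 < t -> exists N c, [/\ 0 < c,
  forall x, \sum_(a < N.+1) bump N (x - a%:R / N.+1%:R) = c &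
  forall x, \sum_(a < N.+1 | far dl (x - a%:R / N.+1%:R)) bump N (x - a%:R / N.+1%:R) <= t * c].
Proof.
move=> /andP[dl0 dl2] t0; pose k : R := (1 + cos (2 * pi * dl)) / 2.
have p0 := @pi_gt0 R.
have k1 : 0 <= k < 1.
  have cos1 : cos (2 * pi * dl) < cos 0.
    rewrite ltr_cos; first by rewrite mulr_gt0// mulr_gt0.
      by rewrite in_itv/= lexx ltW.
    rewrite in_itv/= !mulr_ge0 ?(ltW p0) ?(ltW dl0)//=.
    by have := ler_wpM2l (ltW p0) dl2; lra.
  by rewrite base_ge0 /k; rewrite cos0 in cos1; lra.
have [N hN] := exists_pow_small k1 t0; have [c hc] := bump_sum (ltnSn N).
have c1 : 1 <= c.
  rewrite -(hc 0) big_ord_recl/= mul0r subrr {1}/bump mulr0 cos0.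
  have -> : (1 + 1) / 2 = 1 :> R by field.
  by rewrite expr1n lerDl sumr_ge0// => a _; exact: bump_ge0.
exists N, c; split => [|//|x]; first exact: lt_le_trans ltr01 c1.
apply: (@le_trans _ _ (\sum_(a < N.+1) k ^+ N)).
  rewrite big_mkcond/=; apply: ler_sum => a _; case: ifP => [/asboolP h|_].
    exact: (bump_far N (ltW dl0) h).
  by case/andP: k1 => k0 _; rewrite exprn_ge0.
rewrite sumr_const card_ord -[_ *+ N.+1]mulr_natl; apply: le_trans hN _.
by rewrite ler_peMr// ltW.
Qed.

Section Density.
Variable A : (R * R -> R) -> Prop.
Hypothesis cA : span_closed A.
Hypothesis hA : forall (j l : int) (s : R), A (fun z => cos (2 * pi * (j%:~R * z.1 + l%:~R * z.2) + s)).

Lemma span_sum n (g : nat -> R * R -> R) : (forall a, A (g a)) -> A (fun z => \sum_(a < n) g a z).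
Proof.
move=> hg; elim: n => [|n ih].
  have -> : (fun z => \sum_(a < 0) g a z) = (fun z => 0 * g 0%N z).
    by apply/funext => z; rewrite big_ord0 mul0r.
  exact: cA.2.
have -> : (fun z => \sum_(a < n.+1) g a z) = (fun z => \sum_(a < n) g a z + g n z).
  by apply/funext => z; rewrite big_ord_recr.
exact: cA.1.
Qed.

Lemma span_bump N s t : A (fun z => bump N (z.1 - s) * bump N (z.2 - t)).
Proof.
apply: (bump_span (A := fun h => A (fun z => h (z.1 - s) * bump N (z.2 - t)))).
  split=> [g h Ag Ah|c g Ag].
    rewrite (_ : (fun z => _) = (fun z : R * R => g (z.1 - s) * bump N (z.2 - t) + h (z.1 - s) * bump N (z.2 - t))).
      exact: cA.1.
    by apply/funext => z; rewrite mulrDl.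
  rewrite (_ : (fun z => _) = (fun z : R * R => c * (g (z.1 - s) * bump N (z.2 - t)))); first exact: cA.2.
  by apply/funext => z; rewrite mulrA.
move=> j _.
apply: (bump_span (A := fun h => A (fun z => cos (2 * pi * (j%:R * (z.1 - s))) * h (z.2 - t)))).
  split=> [g h Ag Ah|c g Ag].
    rewrite (_ : (fun z => _) = (fun z : R * R => cos (2 * pi * (j%:R * (z.1 - s))) * g (z.2 - t) +
       cos (2 * pi * (j%:R * (z.1 - s))) * h (z.2 - t))); first exact: cA.1.
    by apply/funext => z; rewrite mulrDr.
  rewrite (_ : (fun z => _) = (fun z : R * R => c * (cos (2 * pi * (j%:R * (z.1 - s))) * g (z.2 - t)))).
    exact: cA.2.
  by apply/funext => z; rewrite mulrCA.
move=> l _.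
rewrite (_ : (fun z => _) = (fun z : R * R => 2^-1 *
  (cos (2 * pi * ((Posz j)%:~R * z.1 + (Posz l)%:~R * z.2) - 2 * pi * (j%:R * s + l%:R * t)) +
   cos (2 * pi * ((Posz j)%:~R * z.1 + (- Posz l)%:~R * z.2) - 2 * pi * (j%:R * s - l%:R * t))))).
  by apply: cA.2; apply: cA.1; exact: hA.
apply/funext => z; set x := 2 * pi * (j%:R * _); set y := 2 * pi * (l%:R * _).
have -> : 2 * pi * ((Posz j)%:~R * z.1 + (Posz l)%:~R * z.2) - 2 * pi * (j%:R * s + l%:R * t) = x + y.
  by rewrite /x /y -!pmulrn; ring.
have -> : 2 * pi * ((Posz j)%:~R * z.1 + (- Posz l)%:~R * z.2) - 2 * pi * (j%:R * s - l%:R * t) = x - y.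
  by rewrite /x /y mulrNz -!pmulrn; ring.
by rewrite cosD cosB; field.
Qed.

Theorem trig_density f (e : R) : torus_continuous f -> 0 < e ->
  exists2 g, A g & forall z, `|f z - g z| <= e.
Proof.
move=> tf e0; have e20 : 0 < e / 2 by rewrite divr_gt0.
have [n fn uc] := torus_uc tf e20.
(* Below the modulus [n.+1%:R^-1] of [torus_uc] and at most one half, as [bump_concentrated]
   demands. *)
pose dl : R := n.+2%:R^-1.
have dl0 : 0 < dl <= 2^-1 by rewrite invr_gt0 ltr0n lef_pV2 ?posrE// ler_nat.
pose B : R := 2 * n.+1%:R; have B0 : 0 < B by rewrite mulr_gt0.
(* [B] bounds the oscillation of [f], and 2 B t is the second half of [e]. *)
pose t := e / (4 * B); have t0 : 0 < t by rewrite divr_gt0// mulr_gt0.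
have [N [c [c0 hc hfar]]] := bump_concentrated dl0 t0.
pose x (a : nat) : R := a%:R / N.+1%:R.
pose w z a b := bump N (z.1 - x a) * bump N (z.2 - x b).
exists (fun z => \sum_(a < N.+1) \sum_(b < N.+1) (f (x a, x b) / c ^+ 2) * w z a b).
  apply: (@span_sum _ (fun a z => \sum_(b < N.+1) (f (x a, x b) / c ^+ 2) * w z a b)) => a.
  apply: (@span_sum _ (fun b z => (f (x a, x b) / c ^+ 2) * w z a b)) => b.
  by apply: cA.2; exact: span_bump.
move=> z; have c20 : 0 < c ^+ 2 by rewrite exprn_gt0.
have sumw : \sum_(a < N.+1) \sum_(b < N.+1) w z a b = c ^+ 2.
  under eq_bigr => a _ do rewrite -mulr_sumr (hc z.2).
  by rewrite -mulr_suml (hc z.1) expr2.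
have -> : f z - \sum_(a < N.+1) \sum_(b < N.+1) (f (x a, x b) / c ^+ 2) * w z a b =
    (\sum_(a < N.+1) \sum_(b < N.+1) (f z - f (x a, x b)) * w z a b) / c ^+ 2.
  have -> : \sum_(a < N.+1) \sum_(b < N.+1) (f z - f (x a, x b)) * w z a b =
      f z * c ^+ 2 - \sum_(a < N.+1) \sum_(b < N.+1) f (x a, x b) * w z a b.
    rewrite -sumw mulr_sumr -sumrB; apply: eq_bigr => a _.
    by rewrite mulr_sumr -sumrB; apply: eq_bigr => b _; rewrite mulrBl.
  rewrite mulrBl mulfK ?gt_eqF//; congr (_ - _); rewrite mulr_suml; apply: eq_bigr => a _.
  by rewrite mulr_suml; apply: eq_bigr => b _; rewrite mulrAC.
rewrite normrM (gtr0_norm (_ : 0 < (c ^+ 2)^-1)) ?invr_gt0// ler_pdivrMr//.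
have -> : e = e / 2 + 2 * B * t by rewrite /t; field; rewrite gt_eqF.
apply: (@double_average _ _ (fun a : 'I_N.+1 => bump N (z.1 - x a)) (fun b : 'I_N.+1 => bump N (z.2 - x b))
  (fun a : 'I_N.+1 => far dl (z.1 - x a)) (fun b : 'I_N.+1 => far dl (z.2 - x b))
  (fun a b => f z - f (x a, x b)) c (e / 2) B t (ltW c0) (ltW B0)
  (fun a => bump_ge0 _ _) (fun b => bump_ge0 _ _) (hc _) (hc _) (hfar _) (hfar _)).
have nB : n%:R + n%:R <= B by rewrite /B -[n.+1%:R]natr1; lra.
move=> a b.
have triv : `|f z - f (x a, x b)| <= B.
  by apply: le_trans (ler_normB _ _) _; apply: le_trans (lerD (fn _) (fn _)) nB.
rewrite /far; case: asboolP => [_|/existsNP[i /negP]]; last case: asboolP => [_ _|/existsNP[j /negP]].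
- by apply: le_trans triv _; clear -e20 B0; case: (`[< _ >]) => /=; lra.
- by apply: le_trans triv _; clear -e20 B0; rewrite /=; lra.
rewrite -!ltNge addr0 mulr0 addr0 => hj hi.
rewrite -(torus_shift tf (x a) (x b) i j) [z]surjective_pairing; apply: uc.
  by rewrite opprD addrA; apply: lt_le_trans hi _; rewrite lef_pV2 ?posrE// ler_nat.
by rewrite opprD addrA; apply: lt_le_trans hj _; rewrite lef_pV2 ?posrE// ler_nat.
Qed.

End Density.
End Bump.

(** * Characters on the torus *)

Section Fractional.
Context {R : realType}.
Implicit Types x y : R.

Lemma Tq_frac_def (q : nat) x y (i : int) : 0 <= y < 1 -> q%:R * x = y + i%:~R -> Tq q x = y.
Proof.
move=> /andP[y0 y1] e; rewrite /Tq e (@floor_def _ _ i) ?addrK//.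
by rewrite intrD lerDr y0/= addrC ltrD2l.
Qed.

Lemma Tq_comp (a b : nat) x : Tq a (Tq b x) = Tq (a * b)%N x.
Proof.
apply: (@Tq_frac_def _ _ _ (Num.floor ((a * b)%N%:R * x) - a%:Z * Num.floor (b%:R * x))%R); first exact: Tq01.
by rewrite /Tq (natrM _ a b) intrD mulrNz intrM -pmulrn; ring.
Qed.

Lemma Tq1_small x : 0 <= x < 1 -> Tq 1 x = x.
Proof. by move=> x01; apply: (@Tq_frac_def _ _ _ 0) => //; rewrite mul1r addr0. Qed.

(** [Tq 1] is the fractional part; starting from it makes the formula true at k = 0 as well. *)
Lemma iter_Tq (q k : nat) x : iter k (Tq q) (Tq 1 x) = Tq (q ^ k)%N x.
Proof. by elim: k => //= k ->; rewrite Tq_comp expnS. Qed.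

Lemma iter_Tprod (a b k : nat) (z : R * R) :
  iter k (Tprod a b) z = (iter k (Tq a) z.1, iter k (Tq b) z.2).
Proof. by elim: k => [|k ih]; [case: z|rewrite /= ih]. Qed.

End Fractional.

Section Torus.
Context {R : realType}.
Variable p : nat.
Hypothesis hp : (2 <= p)%N.
Variable mu : probability (R * R)%type R.
Hypothesis hinv : is_invariant mu (Tprod p p).
Hypothesis herg : is_ergodic mu (Tprod p p).

Let T : R * R -> R * R := Tprod p p.
Let pT : preserving mu T. Proof. exact: preserving_Tprod. Qed.

Definition square : set (R * R) := [set z | 0 <= z.1 < 1 /\ 0 <= z.2 < 1].

Lemma measurable_square : measurable square.
Proof.
rewrite (_ : square = `[0, 1[ `*` `[0, 1[); first by apply: measurableX; exact: measurable_itv.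
by apply/seteqP; split => z; rewrite /square /= !in_itv/=.
Qed.

(** [T] sends every point into the half-open square, so invariance gives it full measure. *)
Lemma ae_square : {ae mu, forall z, square z}.
Proof.
have : prb mu square = 1.
  rewrite -(prb_preimage pT measurable_square) (_ : T @^-1` square = setT) ?prb_setT//.
  by apply/seteqP; split => // z _; rewrite /square /=; split; exact: Tq01.
move=> h; have h0 : prb mu (~` square) = 0.
  by rewrite prb_setC ?h ?subrr//; exact: measurable_square.
apply: filterS (prb_null_ae (measurableC measurable_square) h0) => z.
by move=> /contrapT.
Qed.

Section Characters.
Variables (c c' : R * R -> R).
Hypotheses (mc : measurable_fun [set: R * R] c) (mc' : measurable_fun [set: R * R] c').
Hypotheses (cT : forall z, c (T z) = Tq p (c z)) (c'T : forall z, c' (T z) = Tq p (c' z)).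

(** The reduction modulo 1 puts the coordinate in [0, 1) at every point, as the digit lemmas
    require, and changes nothing on [square]. *)
Let u z := Tq 1 (c z).
Let u' z := Tq 1 (c' z).
Let m_u : measurable_fun [set: R * R] u. Proof. exact: (measurableT_comp (measurable_Tq 1)). Qed.
Let m_u' : measurable_fun [set: R * R] u'. Proof. exact: (measurableT_comp (measurable_Tq 1)). Qed.
Let uT z : u (T z) = Tq p (u z). Proof. by rewrite /u cT !Tq_comp mul1n muln1. Qed.
Let u'T z : u' (T z) = Tq p (u' z). Proof. by rewrite /u' c'T !Tq_comp mul1n muln1. Qed.

Lemma coordinate_entropy (pi : R * R -> R) (K : R) : measurable_fun [set: R * R] pi -> 0 < K ->
  (forall z, square z -> 0 <= c z < 1) ->
  (forall z z', `|z - z'| <= K * (`|pi z - pi z'| + `|c z - c z'|)) ->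
  (dim1 (pushforward mu pi) < dim2 mu)%E -> 0 < erate mu T (dig p \o u).
Proof.
move=> mpi K0 c01 piK.
apply: (@positive_entropy _ p hp mu hinv herg u m_u uT square measurable_square ae_square _ pi mpi K K0).
  by move=> z _; exact: Tq01.
by move=> z z' /c01 h /c01 h'; rewrite /u !Tq1_small.
Qed.

Hypothesis hent : 0 < erate mu T (dig p \o u).

Lemma character_avg0 (q r : nat) (J L s : R) : (p < q)%N -> (r < q)%N ->
  (forall y e : R, 0 < e -> exists k b : nat, `|k%:R * log_ratio p q - b%:R - y| < e) -> J != 0 ->
  {ae mu, forall z, avg0 (fun k => cos (J * q%:R ^+ k * u z + (L * r%:R ^+ k * u' z + s)))}.
Proof.
move=> pq rq dens J0.
pose dz z := (dig p (u z), dig p (u' z)).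
have mdz : mlab dz by apply: mlab_pair; exact: mlab_dig.
have dzx : refines dz (dig p \o u) by move=> z z' /pair_equal_spec[].
pose xi k z := L * r%:R ^+ k * u' z + s.
have mxi k : measurable_fun [set: R * R] (xi k).
  by apply: measurable_funD => //; exact: measurable_funM.
apply: (@osc_avg0 _ _ _ mu T pT (ergodic_prb herg) p hp u m_u (fun z => Tq01 1 (c z)) uT _ dz mdz dzx hent
  q pq dens J `|L| r%:R xi J0 mxi (normr_ge0 _) (ler0n _ _)); first by rewrite ltr_nat.
move=> k i z z' /wdP h.
have iu j y : u' (iter j T y) = iter j (Tq p) (u' y) by elim: j => //= j ih; rewrite u'T ih.
have close : `|u' z - u' z'| <= (p%:R ^+ i)^-1.
  apply: (word_close hp); [exact: Tq01|exact: Tq01|] => j ji.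
  by have /pair_equal_spec[_] := h j ji; rewrite /= !iu.
rewrite /xi opprD addrACA subrr addr0 -mulrBr !normrM (ger0_norm (exprn_ge0 _ (ler0n _ _))).
by rewrite ler_wpM2l// mulr_ge0// exprn_ge0.
Qed.

End Characters.
End Torus.

Section ProductIntegral.
Context {R : realType}.
Variables nu1 nu2 : probability R R.
Local Notation rho := (nu1 \x nu2 : probability (R * R)%type R)%E.

Lemma Ex_product (f g : R -> R) : bmf f -> bmf g ->
  Ex rho (fun z => f z.1 * g z.2) = Ex nu1 f * Ex nu2 g.
Proof.
move=> bf bg.
have bh : bmf (fun z : R * R => f z.1 * g z.2).
  apply: (@bmfM _ _ _ (fun z => f z.1) (fun z => g z.2)).
    split; first by apply: measurableT_comp; [exact: bmf_measurable|exact: measurable_fst].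
    by have [_ [M fM]] := bf; exists M.
  split; first by apply: measurableT_comp; [exact: bmf_measurable|exact: measurable_snd].
  by have [_ [M fM]] := bg; exists M.
rewrite -(ExZr nu1 _ bf) /Ex /Rintegral; congr fine.
rewrite -(integral12_prod_meas1 (bmf_integrable rho bh)); apply: eq_integral => x _.
have ig := bmf_integrable nu2 bg.
have := integralZl measurableT ig (f x).
rewrite /fubini_F /= => ->.
by rewrite EFinM fineK//; exact: integrable_fin_num.
Qed.

End ProductIntegral.

Section UnitInterval.
Context {R : realType}.

Let lam := mrestr (@lebesgue_measure R) (measurable_itv `[0%R, 1%R]).

Let lambda01_setT : @lambda01 R setT = 1%E.
Proof.
by rewrite /lambda01 /mrestr setTI lebesgue_measure_itv/= lte_fin ltr01 oppr0 adde0.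
Qed.

Let lambda01_set0 : @lambda01 R set0 = 0%E. Proof. exact: (measure0 lam). Qed.
Let lambda01_ge0 A : (0 <= @lambda01 R A)%E. Proof. exact: (measure_ge0 lam). Qed.
Let lambda01_additive : semi_sigma_additive (@lambda01 R).
Proof. exact: (@measure_semi_sigma_additive _ _ _ lam). Qed.

HB.instance Definition _ := isMeasure.Build _ _ _ (@lambda01 R) lambda01_set0 lambda01_ge0 lambda01_additive.
HB.instance Definition _ := Measure_isProbability.Build _ _ _ (@lambda01 R) lambda01_setT.

Definition unit_lebesgue : probability R R := @lambda01 R.

(* The Borel structure carried by [R] and the one generated by intervals have the same
   measurable sets but are different records: integrals are transported along the identity. *)
Let idR : measurableTypeR R -> R := idfun.

Lemma Ex_unit_lebesgue (f : R -> R) : bmf f ->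
  Ex unit_lebesgue f = fine (\int[@lebesgue_measure R]_(x in `[0%R, 1%R]) (f x)%:E)%E.
Proof.
move=> bf; pose lam' : {measure set (measurableTypeR R) -> \bar R} := lam.
have mid : measurable_fun [set: measurableTypeR R] idR.
  exact: (@measurable_id _ (measurableTypeR R) setT).
have mf : measurable_fun [set: measurableTypeR R] (f : measurableTypeR R -> R) by exact: bf.1.
have intf : lam'.-integrable [set: measurableTypeR R] (EFin \o (f : measurableTypeR R -> R)).
  apply: measurable_bounded_integrable => //.
    by rewrite [X in (X < _)%E](lambda01_setT : lam' setT = 1%E) ltry.
  have [M fM] := bf.2; exists M; split; first exact: num_real.
  by move=> x Mx z _; apply: le_trans (fM z) (ltW Mx).
have mD : measurable (~` `[0%R, 1%R] : set (measurableTypeR R)).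
  by apply: measurableC; exact: measurable_itv.
have N0 : lam' (~` `[0%R, 1%R]) = 0%E.
  by rewrite -[LHS]/(@lebesgue_measure R (~` `[0%R, 1%R] `&` `[0%R, 1%R])) setICl measure0.
have mEf : measurable_fun [set: R] (EFin \o f) by apply/measurable_EFinP; exact: bf.1.
have H := @integral_pushforward _ _ _ _ R idR mid lam' setT (EFin \o f) mEf intf measurableT.
transitivity (fine (\int[lam']_(x in [set: measurableTypeR R]) (EFin \o f) x)%E).
  by congr fine; exact: H.
rewrite (negligible_integral mD measurableT intf N0) setTD setCK; congr fine.
apply: eq_measure_integral => A mA A01.
by rewrite -[LHS]/(@lebesgue_measure R (A `&` `[0%R, 1%R])) (setIidl A01).
Qed.

Lemma Ex_unit_cos (j : int) (s : R) : j != 0 -> Ex unit_lebesgue (fun x => cos (2 * pi * (j%:~R * x) + s)) = 0.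
Proof.
move=> j0; pose w : R := 2 * pi * j%:~R.
have w0 : w != 0 by rewrite !mulf_neq0 ?intr_eq0// gt_eqF// pi_gt0.
have -> : (fun x : R => cos (2 * pi * (j%:~R * x) + s)) = (fun x => cos (w * x + s)).
  by apply/funext => x; rewrite /w mulrA.
pose F (x : R) : R := w^-1 * sin (w * x + s).
have dF (x : R) : is_derive x (1 : R) F (cos (w * x + s)).
  have dl : is_derive x (1 : R) (w \*: (@idfun R) + cst s : R -> R) (w *: 1 + 0) by exact: is_deriveD.
  have ds := is_deriveZ w^-1 (@is_derive1_comp R sin (w \*: (@idfun R) + cst s) x _ _ (is_derive_sin (w * x + s)) dl).
  apply: is_derive_eq ds _.
  by rewrite addr0 /GRing.scale/= mulr1 mulrCA mulVf// mulr1.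
have cF : continuous F by move=> x; apply: differentiable_continuous; apply/derivable1_diffP; exact: ex_derive.
have cf : continuous (fun x : R => cos (w * x + s)).
  move=> x; apply: continuous_comp; last exact: continuous_cos.
  by apply: cvgD; [apply: cvgM; [exact: cvg_cst|exact: cvg_id]|exact: cvg_cst].
rewrite Ex_unit_lebesgue; last first.
  split; last by exists 1 => x; exact: cos_max.
  by apply: continuous_measurable_fun.
rewrite (@continuous_FTC2 _ _ F) ?ltr01//.
- have -> : F 1 = F 0.
    rewrite /F mulr1 mulr0 add0r addrC -!cosBpihalf addrAC (_ : w = j%:~R * (2 * pi)) ?cos_int_period//.
    by rewrite /w mulrC.
  by rewrite -EFinB subrr.
- exact: continuous_subspaceT.
- split; first by move=> x _; exact: ex_derive.
    by apply: cvg_at_right_filter; exact: cF.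
  by apply: cvg_at_left_filter; exact: cF.
- by move=> x _; rewrite derive1E; exact: derive_val.
Qed.
End UnitInterval.

Section Generic.
Context {R : realType}.

Definition chi (j l : int) (s : R) (z : R * R) := cos (2 * pi * (j%:~R * z.1 + l%:~R * z.2) + s).

Lemma bmf_chi j l s : bmf (chi j l s).
Proof.
split; last by exists 1 => z; exact: cos_max.
apply: measurableT_comp; first by apply: continuous_measurable_fun; exact: continuous_cos.
apply: measurable_funD => //; apply: measurable_funM => //; apply: measurable_funD; apply: measurable_funM => //.
Qed.

Lemma chi_Tq j l s (a b : nat) (x y : R) : chi j l s (Tq a x, Tq b y) =
  cos (2 * pi * j%:~R * (a%:R * x) + (2 * pi * l%:~R * (b%:R * y) + s)).
Proof.
rewrite /chi /Tq /= -[RHS](cos_int_period _ (- (j * Num.floor (a%:R * x) + l * Num.floor (b%:R * y)))).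
by congr cos; rewrite mulrNz intrD !intrM; ring.
Qed.

(** The addition formula, with both sines written as shifted cosines so that a single family of
    functions suffices. *)
Lemma Ex_chi (nu1 nu2 : probability R R) j l s :
  Ex (nu1 \x nu2)%E (chi j l s) =
  Ex nu1 (fun x => cos (2 * pi * (j%:~R * x) + 0)) * Ex nu2 (fun y => cos (2 * pi * (l%:~R * y) + s)) +
  Ex nu1 (fun x => cos (2 * pi * (j%:~R * x) + pi / 2)) * Ex nu2 (fun y => cos (2 * pi * (l%:~R * y) + (s - pi / 2))).
Proof.
have b (i : int) (t : R) : bmf (fun x : R => cos (2 * pi * (i%:~R * x) + t)).
  split; last by exists 1 => z; exact: cos_max.
  apply: measurableT_comp; first by apply: continuous_measurable_fun; exact: continuous_cos.
  by apply: measurable_funD => //; apply: measurable_funM => //; exact: measurable_funM.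
have b2 (i i' : int) (t t' : R) : bmf (fun z : R * R =>
    cos (2 * pi * (i%:~R * z.1) + t) * cos (2 * pi * (i'%:~R * z.2) + t')).
  apply: (@bmfM _ _ _ (fun z : R * R => cos (2 * pi * (i%:~R * z.1) + t))
    (fun z : R * R => cos (2 * pi * (i'%:~R * z.2) + t'))).
    split; last by exists 1 => z; exact: cos_max.
    exact: (measurableT_comp (bmf_measurable (b i t)) measurable_fst).
  split; last by exists 1 => z; exact: cos_max.
  exact: (measurableT_comp (bmf_measurable (b i' t')) measurable_snd).
rewrite -!Ex_product// -ExD//; congr Ex; apply/funext => z; rewrite /chi mulrDr addr0.
move: (2 * pi * _) (2 * pi * _) => x y.
by rewrite cosDpihalf addrA cosBpihalf -addrA cosD; ring.
Qed.

(** Weyl's criterion with one null set for all [f]: the phases 0 and pi / 2 yield every phase by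
    linearity, and the pairs of frequencies are countable. *)
Lemma generic_of_characters (mu : probability (R * R)%type R) (T : R * R -> R * R) (rho : probability (R * R)%type R) :
  (forall j l s, {ae mu, forall z, avg0 (fun k => chi j l s (iter k T z) - Ex rho (chi j l s))}) ->
  pointwise_generic mu T rho.
Proof.
move=> H.
have H2 : {ae mu, forall z, forall n, if unpickle n is Some jl then
    avg0 (fun k => chi jl.1 jl.2 0 (iter k T z) - Ex rho (chi jl.1 jl.2 0)) /\
    avg0 (fun k => chi jl.1 jl.2 (pi / 2) (iter k T z) - Ex rho (chi jl.1 jl.2 (pi / 2)))
  else True}.
  apply: ae_foralln => n; case: (unpickle n : option (int * int)) => [[j l]|]; last exact: aeW.
  by apply: filterS2 (H j l 0) (H j l (pi / 2)).
apply: filterS H2 => z hz f tf.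
pose A g := bmf g /\ avg0 (fun k => g (iter k T z) - Ex rho g).
have cA : span_closed A.
  split=> [g h [bg Ag] [bh Ah]|c g [bg Ag]].
    split; first exact: bmfD.
    by rewrite (ExD rho bg bh); apply: eq_avg0 (avg0D Ag Ah) => k; ring.
  split; first exact: bmfZ.
  by rewrite (ExZ rho c bg); apply: eq_avg0 (avg0Z c Ag) => k; ring.
have hA (j l : int) (s : R) : A (fun z => cos (2 * pi * (j%:~R * z.1 + l%:~R * z.2) + s)).
  have := hz (pickle (j, l)); rewrite pickleK => -[h0 h1].
  have -> : (fun z : R * R => cos (2 * pi * (j%:~R * z.1 + l%:~R * z.2) + s)) =
      (fun z => cos s * chi j l 0 z + sin s * chi j l (pi / 2) z).
    by apply/funext => w; rewrite /chi addr0 cosDpihalf cosD; ring.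
  by apply: cA.1; apply: cA.2; split => //; exact: bmf_chi.
have dens := trig_density cA hA tf.
have bf : bmf f.
  split.
    (* [f] is a uniform limit of trigonometric polynomials, which gives its measurability on the
       product space. *)
    have /choice[g hg] : forall n : nat, exists g, A g /\ forall z, `|f z - g z| <= n.+1%:R^-1.
      move=> n; have n0 : 0 < n.+1%:R^-1 :> R by rewrite invr_gt0.
      by have [g Ag hg] := dens _ n0; exists g.
    apply: (@measurable_fun_cvg _ _ _ _ g) => [n|w _]; first exact: (bmf_measurable (hg n).1.1).
    apply/cvgrPdist_le => e e0; have [n0 hn0] := exists_inv e0.
    exists n0 => // n /= n0n; apply: le_trans ((hg n).2 w) _; apply: le_trans (ltW hn0).
    by rewrite lef_pV2 ?posrE// ler_nat ltnS.
  by have [n fn _] := torus_uc tf ltr01; exists n%:R.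
have af : avg0 (fun k => f (iter k T z) - Ex rho f).
  move=> e e0; have e3 : 0 < e / 3 by rewrite divr_gt0.
  have [g [bg Ag] fg] := dens _ e3; have [n0 hn0] := Ag _ e3.
  exists n0 => n /hn0 hn.
  have -> : \sum_(k < n) (f (iter k T z) - Ex rho f) = \sum_(k < n) (g (iter k T z) - Ex rho g) +
      \sum_(k < n) ((f (iter k T z) - g (iter k T z)) - (Ex rho f - Ex rho g)).
    by rewrite -big_split/=; apply: eq_bigr => k _; ring.
  apply: le_trans (ler_normD _ _) _.
  have : `|\sum_(k < n) ((f (iter k T z) - g (iter k T z)) - (Ex rho f - Ex rho g))| <= (e / 3 + e / 3) * n%:R.
    apply: le_trans (ler_norm_sum _ _ _) _.
    apply: (@le_trans _ _ (\sum_(k < n) (e / 3 + e / 3))); last first.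
      by rewrite sumr_const card_ord mulr_natr.
    apply: ler_sum => k _; apply: le_trans (ler_normB _ _) _; apply: lerD; first exact: fg.
    by rewrite -ExB//; apply: Ex_norm_le => //; exact: bmfB.
  by move: hn; lra.
have E : (\int[rho]_x (f x)%:E)%E = (Ex rho f)%:E.
  by rewrite /Ex /Rintegral fineK//; apply: integrable_fin_num => //; exact: bmf_integrable.
rewrite E; apply: cvg_EFin; first by near=> n.
rewrite (_ : _ \o _ = fun N : nat => N%:R^-1 * \sum_(k < N) f (iter k T z))//.
apply/cvgrPdist_le => e e0; have [n0 hn0] := af _ e0.
exists n0.+1 => // n /= n0n; have n_gt0 : 0 < n%:R :> R by rewrite ltr0n; exact: leq_ltn_trans n0n.
have -> : Ex rho f - n%:R^-1 * \sum_(k < n) f (iter k T z) = - (n%:R^-1 * \sum_(k < n) (f (iter k T z) - Ex rho f)).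
  rewrite sumrB sumr_const card_ord -[Ex rho f *+ n]mulr_natl; field; exact: lt0r_neq0.
by rewrite normrN normrM gtr0_norm ?invr_gt0// ler_pdivrMl// mulrC; apply: hn0; exact: ltnW.
Unshelve. all: by end_near.
Qed.

End Generic.

(** * Generic points *)

Section Equidistribution.
Context {R : realType}.
Variable p : nat.
Hypothesis hp : (2 <= p)%N.
Variable mu : probability (R * R)%type R.
Hypothesis hinv : is_invariant mu (Tprod p p).
Hypothesis herg : is_ergodic mu (Tprod p p).
Hypothesis drop : exists a b : R, a != 0 /\ b != 0 /\
  (dim1 (pushforward mu (fun z : R * R => (a * z.1 + b * z.2)%R)) < dim2 mu)%E.

Let T : R * R -> R * R := Tprod p p.

(** One coordinate and the projection determine the other coordinate; this is where a nonzero
    coefficient is needed, [b] for [entropy_fst] and [a] for [entropy_snd]. *)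
Lemma projection_lip (a b x y w : R) : b != 0 -> w = a * x + b * y ->
  Num.max `|x| `|y| <= (1 + (1 + `|a|) / `|b|) * (`|w| + `|x|).
Proof.
move=> b0 e; have b1 : 0 < `|b| by rewrite normr_gt0.
have a0 := normr_ge0 a; have x0 := normr_ge0 x; have w0 := normr_ge0 w.
have c0 : 0 <= (1 + `|a|) / `|b| by rewrite divr_ge0// addr_ge0.
rewrite ge_max; apply/andP; split.
  have := mulr_ge0 c0 (addr_ge0 w0 x0); rewrite mulrDl mul1r; lra.
have -> : y = (w - a * x) / b by rewrite e; field.
have h : `|(w - a * x) / b| <= (1 + `|a|) / `|b| * (`|w| + `|x|).
  rewrite normrM normfV mulrAC ler_wpM2r ?invr_ge0//; apply: le_trans (ler_normB _ _) _.
  by rewrite normrM; have := mulr_ge0 a0 w0; lra.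
apply: le_trans h _; rewrite ler_wpM2r ?addr_ge0//; lra.
Qed.

Let mpi (a b : R) : measurable_fun [set: R * R] (fun z : R * R => a * z.1 + b * z.2).
Proof. by apply: measurable_funD; apply: measurable_funM. Qed.

Lemma entropy_fst : 0 < erate mu T (dig p \o (fun z => Tq 1 z.1)).
Proof.
have [a [b [a0 [b0 hab]]]] := drop.
apply: (coordinate_entropy hp hinv herg measurable_fst (fun z => erefl) (mpi a b)
  (K := 1 + (1 + `|a|) / `|b|) _ _ _ hab).
- by rewrite addr_gt0// divr_gt0 ?normr_gt0// ltr_pwDl.
- by move=> z [].
- move=> z z'; rewrite prod_normE; apply: projection_lip => //=; ring.
Qed.

Lemma entropy_snd : 0 < erate mu T (dig p \o (fun z => Tq 1 z.2)).
Proof.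
have [a [b [a0 [b0 hab]]]] := drop.
apply: (coordinate_entropy hp hinv herg measurable_snd (fun z => erefl) (mpi a b)
  (K := 1 + (1 + `|b|) / `|a|) _ _ _ hab).
- by rewrite addr_gt0// divr_gt0 ?normr_gt0// ltr_pwDl.
- by move=> z [].
- move=> z z'; rewrite prod_normE maxC; apply: projection_lip => //=; ring.
Qed.

Lemma log_ratio_dense q : (p < q)%N -> @mult_indep R q p ->
  forall y e : R, 0 < e -> exists k b : nat, `|k%:R * log_ratio p q - b%:R - y| < e.
Proof.
move=> pq ind; apply: kronecker; first exact: lt_trans ltr01 (log_ratio_gt1 hp pq).
move=> [r hr]; apply: ind; exists r^-1.
by rewrite fmorphV/= -hr /log_ratio invf_div.
Qed.

Lemma square_iter (a b k : nat) z : square z ->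
  iter k (Tprod a b) z = (Tq (a ^ k)%N z.1, Tq (b ^ k)%N z.2) :> R * R.
Proof. by move=> [h1 h2]; rewrite iter_Tprod -{1}(Tq1_small h1) -{1}(Tq1_small h2) !iter_Tq. Qed.

(** The oscillation is driven by m^k times the first coordinate; as n < m, the second coordinate is
    a slow phase. *)
Lemma chi_first_avg0 (m n : nat) (j l : int) (s : R) : (p < m)%N -> (n < m)%N -> @mult_indep R m p ->
  j != 0 -> {ae mu, forall z, avg0 (fun k => chi j l s (iter k (Tprod m n) z))}.
Proof.
move=> pm nm ind j0.
have J0 : 2 * pi * j%:~R != 0 :> R by rewrite !mulf_neq0 ?intr_eq0// gt_eqF// pi_gt0.
have := character_avg0 hp hinv herg measurable_fst measurable_snd (fun z => erefl) (fun z => erefl)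
  entropy_fst (2 * pi * l%:~R) s pm nm (log_ratio_dense pm ind) J0.
apply: filterS2 (ae_square hinv) => z sq h; apply: eq_avg0 h => k.
by rewrite square_iter// chi_Tq !natrX !Tq1_small ?sq.1 ?sq.2// !mulrA.
Qed.

(** Without the first coordinate the oscillation is driven by n^k times the second one, with a
    constant phase. *)
Lemma chi_second_avg0 (m n : nat) (l : int) (s : R) : (p < n)%N -> @mult_indep R n p ->
  l != 0 -> {ae mu, forall z, avg0 (fun k => chi 0 l s (iter k (Tprod m n) z))}.
Proof.
move=> pn ind l0.
have J0 : 2 * pi * l%:~R != 0 :> R by rewrite !mulf_neq0 ?intr_eq0// gt_eqF// pi_gt0.
have := character_avg0 hp hinv herg measurable_snd measurable_fst (fun z => erefl) (fun z => erefl)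
  entropy_snd 0 s pn pn (log_ratio_dense pn ind) J0.
apply: filterS2 (ae_square hinv) => z sq h; apply: eq_avg0 h => k.
by rewrite square_iter// chi_Tq !natrX !Tq1_small ?sq.1 ?sq.2// mulr0 !mul0r !add0r !mulrA.
Qed.

Let cos_bmf (i : int) (t : R) : bmf (fun x : R => cos (2 * pi * (i%:~R * x) + t)).
Proof.
split; last by exists 1 => z; exact: cos_max.
apply: measurableT_comp; first by apply: continuous_measurable_fun; exact: continuous_cos.
by apply: measurable_funD => //; apply: measurable_funM => //; exact: measurable_funM.
Qed.

Lemma Ex_chi_first (nu : probability R R) (j l : int) (s : R) : j != 0 ->
  Ex (@unit_lebesgue R \x nu)%E (chi j l s) = 0.
Proof. by move=> j0; rewrite Ex_chi !Ex_unit_cos// !mul0r addr0. Qed.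

Lemma Ex_chi_second (nu : probability R R) (l : int) (s : R) :
  Ex (@unit_lebesgue R \x nu)%E (chi 0 l s) = Ex nu (fun y => cos (2 * pi * (l%:~R * y) + s)).
Proof.
have c (t : R) : (fun x : R => cos (2 * pi * ((0 : int)%:~R * x) + t)) = fun=> cos t.
  by apply/funext => x; rewrite mul0r mulr0 add0r.
by rewrite Ex_chi !c !Ex_cst cos0 cos_pihalf mul1r mul0r addr0.
Qed.

Lemma generic_both (m n : nat) : (p < n)%N -> (n < m)%N -> @mult_indep R m p -> @mult_indep R n p ->
  pointwise_generic mu (Tprod m n) (lambda01 \x lambda01)%E.
Proof.
move=> pn nm im in_.
apply: (@generic_of_characters _ mu (Tprod m n) (@unit_lebesgue R \x @unit_lebesgue R)%E) => j l s.
have [->|j0] := eqVneq j 0; last first.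
  apply: filterS (chi_first_avg0 l s (ltn_trans pn nm) nm im j0) => z; apply: eq_avg0 => k.
  by rewrite Ex_chi_first// subr0.
rewrite Ex_chi_second; have [->|l0] := eqVneq l 0; last first.
  apply: filterS (chi_second_avg0 m s pn in_ l0) => z; apply: eq_avg0 => k.
  by rewrite Ex_unit_cos// subr0.
apply: aeW => z e e0; exists 0%N => N _.
rewrite big1 => [|k _]; first by rewrite normr0 mulr_ge0// ltW.
have -> : (fun y : R => cos (2 * pi * ((0 : int)%:~R * y) + s)) = fun=> cos s.
  by apply/funext => x; rewrite mul0r mulr0 add0r.
by rewrite Ex_cst /chi !mul0r addr0 mulr0 add0r subrr.
Qed.

(** As the distribution of a random variable, the push-forward carries the probability structure
    needed to form the product. *)
Let snd_rv : {RV mu >-> R} :=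
  HB.pack (fun z : R * R => z.2) (isMeasurableFun.Build _ _ _ _ (fun z : R * R => z.2) measurable_snd).

Lemma generic_fst (m : nat) : (p < m)%N -> @mult_indep R m p ->
  pointwise_generic mu (Tprod m p) (lambda01 \x pushforward mu (fun z : R * R => z.2))%E.
Proof.
move=> pm im.
pose nu2 : probability R R := distribution mu snd_rv.
apply: (@generic_of_characters _ mu (Tprod m p) (@unit_lebesgue R \x nu2)%E) => j l s.
have [->|j0] := eqVneq j 0; last first.
  apply: filterS (chi_first_avg0 l s pm pm im j0) => z; apply: eq_avg0 => k.
  by rewrite Ex_chi_first// subr0.
rewrite Ex_chi_second.
pose f (z : R * R) : R := cos (2 * pi * (l%:~R * z.2) + s).
have bf : bmf f.
  split; last by exists 1 => z; exact: cos_max.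
  exact: (measurableT_comp (bmf_measurable (cos_bmf l s)) measurable_snd).
have -> : Ex nu2 (fun y => cos (2 * pi * (l%:~R * y) + s)) = Ex mu f.
  rewrite /Ex /Rintegral; congr fine.
  apply: (@integral_pushforward _ _ _ _ R (fun z : R * R => z.2) measurable_snd mu setT
    (EFin \o (fun y => cos (2 * pi * (l%:~R * y) + s)))) => //.
    by apply/measurable_EFinP; exact: bmf_measurable.
  exact: (bmf_integrable mu bf).
apply: filterS (birkhoff (preserving_Tprod hinv) (ergodic_prb herg) bf) => z; apply: eq_avg0 => k.
by rewrite /chi /f !iter_Tprod /= mul0r add0r.
Qed.

End Equidistribution.

Theorem theorem1p1 (R : realType) (m p : nat)
  (hp : (2 <= p)%N) (hmp : (p < m)%N) (hind : @mult_indep R m p)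
  (mu : probability (R * R)%type R)
  (hsupp : mu (`[0%R, 1%R] `*` `[0%R, 1%R]) = 1%E)
  (hinv : is_invariant mu (Tprod p p)) (herg : is_ergodic mu (Tprod p p))
  (hproj : exists a b : R, a != 0 /\ b != 0 /\
     (dim1 (pushforward mu (fun z : R * R => (a * z.1 + b * z.2)%R)) < dim2 mu)%E) :
  pointwise_generic mu (Tprod m p)
      (lambda01 \x pushforward mu (fun z : R * R => z.2))%E
  /\
  (forall n : nat, @mult_indep R n p -> (p < n)%N -> (n < m)%N ->
     pointwise_generic mu (Tprod m n) (lambda01 \x lambda01)%E).
Proof.
split=> [|n hn pn nm]; first exact: (generic_fst hp hinv herg hproj hmp hind).
exact: (generic_both hp hinv herg hproj pn nm hind hn).
Qed.
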